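(* Let $G$ be a nontrivial finite subgroup of $\mathrm{SU}(2)$ and let $F : (\mathbb{C}^2,0)\to(\mathbb{C}^2,0)$ be a $G$-equivariant local biholomorphism with Jacobian matrix $J := F'(0)\in \mathrm{GL}_2(\mathbb{C})$ at the origin. Then $J$ normalizes $G$, that is, $JgJ^{-1}\in G$ for every $g\in G$, and $J$ is diagonalizable unless $G$ is a group of order $2$. Suppose in addition that (i) $J$ is diagonalizable when $G$ is a group of order $2$ (so that $J$ is diagonalizable in any case), and (ii) the pair $(\alpha_1,\alpha_2)$ of eigenvalues of $J$ is Diophantine. Then there exists a unique local biholomorphism $\Phi : (\mathbb{C}^2,0)\to(\mathbb{C}^2,0)$ such that $$\Phi\circ F\circ\Phi^{-1} = J,\qquad \Phi'(0)=I,$$ and $\Phi$ commutes with every element of $G$ (so $F$ is $G$-equivariantly linearizable to $J$).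
   Context: $(\mathbb{C}^2,0)$ denotes an open neighborhood of the origin in $\mathbb{C}^2$ (germs). A local biholomorphism $F:(\mathbb{C}^2,0)\to(\mathbb{C}^2,0)$ is $G$-equivariant if for any $g\in G$ and any $z\in\mathbb{C}^2$ sufficiently close to the origin, $(F\circ g\circ F^{-1})(z)$ lies in the $G$-orbit of $z$. A pair $(\alpha_1,\alpha_2)$ of nonzero complex numbers is Diophantine if there exist positive constants $K$ and $c$ such that $|\alpha_j-\alpha_1^{n_1}\alpha_2^{n_2}|\ge K(n_1+n_2)^{-c}$ for $j=1,2$ and all integers $n_1,n_2\ge 0$ with $n_1+n_2\ge 2$. *)

(* Defs.v *)
From mathcomp Require Export all_boot all_order all_algebra.
From mathcomp Require Export finmap.
From mathcomp Require Export all_classical all_reals all_analysis.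
From mathcomp Require Export complex.
Export Order.TTheory GRing.Theory Num.Theory.
Export numFieldNormedType.Exports.

Set Implicit Arguments.
Unset Strict Implicit.
Unset Printing Implicit Defensive.

Local Open Scope classical_set_scope.
Local Open Scope ring_scope.

(* Stated over an arbitrary scalar field [K] so that the norm and topology of a
   numFieldType are found; [K] is meant to be [R[i]].  Vectors are columns, so
   that a matrix [A] acts on the left by [A *m z]. *)
Section Germs.
Variable K : numFieldType.
Local Notation K2 := 'cV[K]_2.

(* Germs (K^2,0) -> (K^2,0) are represented by total functions, of which only
   the restriction to some neighborhood of 0 matters. *)
Definition germ_eq (F H : K2 -> K2) : Prop := \forall z \near (0 : K2), F z = H z.

(* [differentiable] is Frechet differentiability over [K]; for [K = R[i]] this
   is complex differentiability. *)
Definition holomorphic_germ (F : K2 -> K2) : Prop :=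
  F 0 = 0 /\ \forall z \near (0 : K2), differentiable F z.

Definition inverse_germ (F Finv : K2 -> K2) : Prop :=
  [/\ holomorphic_germ Finv, germ_eq (Finv \o F) id & germ_eq (F \o Finv) id].

Definition local_biholo (F : K2 -> K2) : Prop :=
  holomorphic_germ F /\ exists Finv, inverse_germ F Finv.

Definition jac (F : K2 -> K2) : 'M[K]_2 :=
  \matrix_(i < 2, j < 2) ('d F (0 : K2) (delta_mx j 0 : K2) : K2) i 0.

(* For a local biholomorphism, the inverse germ exists and is unique, so the
   existential quantifiers over [Finv] below just give it a name. *)
Definition equivariant (G : {fset 'M[K]_2}) (F : K2 -> K2) : Prop :=
  exists2 Finv, inverse_germ F Finv &
    forall g, g \in G -> \forall z \near (0 : K2),
      exists2 h, h \in G & F (g *m Finv z) = h *m z.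

Definition normalized_linearization (F Phi : K2 -> K2) : Prop :=
  [/\ local_biholo Phi,
      exists2 Phinv, inverse_germ Phi Phinv &
        germ_eq (Phi \o F \o Phinv) (mulmx (jac F))
    & jac Phi = 1%:M].
End Germs.

Section ComplexData.
Variable R : realType.
Local Notation C := R[i].

Definition finite_subgroup_SU2 (G : {fset 'M[C]_2}) : Prop :=
  [/\ forall g, g \in G -> g \is unitarymx /\ \det g = 1,
      1%:M \in G,
      forall g h, g \in G -> h \in G -> g *m h \in G
    & forall g, g \in G -> invmx g \in G].

(* [c] and [k] are real; [_%:C] embeds R into R[i], where the norm is valued
   and where [x <= y] means that [y - x] is a nonnegative real. *)
Definition diophantine (a1 a2 : C) : Prop :=
  [/\ a1 != 0, a2 != 0 &
    exists k c : R, [/\ 0 < k, 0 < c &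
      forall (a : C) (n1 n2 : nat), a = a1 \/ a = a2 -> (2 <= n1 + n2)%N ->
        (k * (n1 + n2)%:R `^ (- c))%:C%C <= `|a - a1 ^+ n1 * a2 ^+ n2|]].
End ComplexData.

(* Main.v *)
Require Import Defs.
From mathcomp Require Import ring lra zify.

(** Write J for the linear part of F and F' for the inverse germ. For g in G the germ z
    |-> F (g F' z) takes at every point one of the finitely many values h z with h in G,
    and its linear part is A = J g J^-1. Along a direction v on which no nonzero h - A
    vanishes, first order contact with A at 0 leaves only h = A; hence A is in G
    (linear_part_mem). Two distinct elements of SU(2) differ by an invertible matrix,
    since the entries p, q of a matrix of quaternion shape give it determinant |p|^2 +
    |q|^2 (quaternion_det0). So near 0 the choice h = A is forced at every point and F
    (g z) = (J g J^-1) F z as germs (conj_equivariant). Conjugation by J permutes the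
    finite set G, so for each g some power of J commutes with g. If J is not
    diagonalizable, it is a + N with N nonzero and N^2 = 0, and then g commutes with N;
    in SU(2) only 1 and -1 do (SU2_commuting_nilpotent), so G has order 2.

    The linearization is Siegel's theorem. In coordinates where J is the diagonal matrix
    D with entries a_0, a_1, write F = D + f and solve F (H z) = H (D z) for H = id + T
    (f o H), where T divides the coefficient of index n in component k by the small
    divisor a^n - a_k. The Picard iterates of this equation, with f truncated, are
    polynomials (iter_sol). They are bounded in a weighted l^1 norm, because the weights
    w satisfy w (n + m) <= w n * w m even after division by the divisor of index n + m,
    and because f has order two; their coefficients stabilize one order at each step, so
    on half the radius they converge geometrically (ev_iter_cauchy). Weights with at
    most geometric decay exist by the counting argument of Siegel and Brjuno: two nested
    indices whose divisors are both below theta * 2^-(c q) differ by at least 2^q in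
    degree (tiny_sep), and a superadditive potential turns this separation into the
    weight (pot_super, weight_divisor). With the constant divisor -1 and the weight 1
    the same solver gives the inverse function theorem (right_inverse).

    To pass between complex differentiable germs and power series, Cauchy's formula on
    the square [-1, 1]^2 is proved for a substitute of the contour integral: midpoint
    sums over the dyadic subdivisions of the sides, divided by the same sums for 1/z,
    and a limit along an ultrafilter. This functional is linear and bounded, is 1 on 1/z
    and, by Goursat's subdivision argument, 0 on differentiable functions; this is
    enough for Cauchy's formula in two variables (cauchy2), Taylor expansions
    (holo_expand) and differentiability of uniform limits (limit_diff).

    If Phi and Psi both linearize F and H inverts Phi, then E = Psi o H - id commutes
    with J and has no linear part; its Taylor coefficients are killed by the nonzero
    divisors, so E = 0 and Psi = Phi near 0 (linearizing_chart_unique). The average over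
    g in G of g^-1 Phi (g z) linearizes F too, because conjugation by J permutes G; it
    therefore equals Phi, and the average commutes with G by construction. *)

Set Implicit Arguments.
Unset Strict Implicit.
Unset Printing Implicit Defensive.

Local Open Scope classical_set_scope.
Local Open Scope ring_scope.
Local Open Scope complex_scope.

(** * Real-valued modulus on R[i] *)

Section Modulus.
Variable R : realType.
Local Notation C := R[i].
Implicit Types x y z : C.

(** The norm of R[i] has its values in R[i] itself; md is the same number as an element
    of the ordered field R. *)
Definition md x : R := complex.Re `|x|.

Lemma normC_md x : `|x| = (md x)%:C.
Proof. by rewrite /md normc_def. Qed.

Lemma md_ge0 x : 0 <= md x.
Proof. by rewrite -ler0c -normC_md. Qed.

Lemma md0 : md 0 = 0. Proof. by rewrite /md normr0. Qed.
Lemma md1 : md 1 = 1. Proof. by rewrite /md normr1. Qed.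
Lemma mdN x : md (- x) = md x. Proof. by rewrite /md normrN. Qed.
Lemma mdB x y : md (x - y) = md (y - x). Proof. by rewrite /md distrC. Qed.

Lemma mdM x y : md (x * y) = md x * md y.
Proof. by apply: complexI; rewrite rmorphM /= -!normC_md normrM. Qed.

Lemma mdV x : md x^-1 = (md x)^-1.
Proof. by apply: complexI; rewrite fmorphV /= -!normC_md normfV. Qed.

Lemma mdX x n : md (x ^+ n) = md x ^+ n.
Proof. by apply: complexI; rewrite rmorphXn /= -!normC_md normrX. Qed.

Lemma mdD x y : md (x + y) <= md x + md y.
Proof. by rewrite -lecR rmorphD /= -!normC_md ler_normD. Qed.

Lemma mdBD x y : md (x - y) <= md x + md y.
Proof. by rewrite -(mdN y) mdD. Qed.

Lemma mdBB x y : md x - md y <= md (x - y).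
Proof. by rewrite lerBlDr; apply: le_trans (mdD _ _); rewrite subrK. Qed.

Lemma md_eq0 x : (md x == 0) = (x == 0).
Proof. by rewrite -(inj_eq (@complexI _)) -normC_md normr_eq0. Qed.

Lemma md_gt0 x : (0 < md x) = (x != 0).
Proof. by rewrite lt0r md_ge0 andbT md_eq0. Qed.

Lemma md_real (r : R) : md r%:C = `|r|.
Proof. by rewrite /md normc_def /= expr0n addr0 sqrtr_sqr. Qed.

Lemma md_nat n : md n%:R = n%:R.
Proof. by rewrite -(rmorph_nat (real_complex R)) md_real normr_nat. Qed.

Lemma md2 : md 2 = 2. Proof. exact: md_nat. Qed.

Lemma md_i : md 'i = 1.
Proof. by rewrite /md normc_def /= expr0n expr1n add0r sqrtr1. Qed.

Lemma md_sum I (r : seq I) (P : pred I) (F : I -> C) :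
  md (\sum_(i <- r | P i) F i) <= \sum_(i <- r | P i) md (F i).
Proof.
elim/big_rec2: _ => [|i u v _ h]; first by rewrite md0.
by apply: le_trans (mdD _ _) _; rewrite lerD2l.
Qed.

Lemma ler_ReIm x : md x <= `|complex.Re x| + `|complex.Im x|.
Proof.
have {1}-> : x = (complex.Re x)%:C + 'i * (complex.Im x)%:C by apply: complexE.
by apply: le_trans (mdD _ _) _; rewrite mdM !md_real md_i mul1r.
Qed.

Lemma Re_le_md x : `|complex.Re x| <= md x.
Proof. by rewrite -lecR -normC_md normc_ge_Re. Qed.

Lemma Im_le_md x : `|complex.Im x| <= md x.
Proof.
have -> : complex.Im x = complex.Re (- 'i * x) by case: x => a b; rewrite /=; ring.
by apply: le_trans (Re_le_md _) _; rewrite mdM mdN md_i mul1r.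
Qed.

(** Spelled out with moduli instead of filters, since the estimates below handle e and d
    directly. *)
Definition cdiff (f : C -> C) (a : C) := exists l : C, forall e : R, 0 < e ->
  exists2 d : R, 0 < d &
    forall z, md (z - a) < d -> md (f z - f a - l * (z - a)) <= e * md (z - a).

End Modulus.

(** * Midpoint sums along segments and squares *)

Section Segments.
Variable R : realType.
Local Notation C := R[i].

Definition midpt n k : R := (k%:R + 2^-1) / 2 ^+ n.

Lemma midpt01 n k : (k < 2 ^ n)%N -> 0 <= midpt n k <= 1.
Proof.
move=> kn; rewrite /midpt divr_ge0 ?exprn_ge0 ?addr_ge0 ?invr_ge0 //=.
rewrite ler_pdivrMr ?exprn_gt0 // mul1r.
have : (k.+1%:R <= (2 ^ n)%:R :> R) by rewrite ler_nat.
by rewrite natrX -addn1 natrD; lra.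
Qed.

(** A midpoint sum for the integral of f along the segment from p to p + d. Halving the
    segment splits it exactly (segS) and it is exact on affine functions, so the
    subdivision argument of Goursat applies to the sums themselves. *)
Definition seg (f : C -> C) (p d : C) n : C :=
  \sum_(0 <= k < 2 ^ n) f (p + d * (midpt n k)%:C) * (d / 2 ^+ n).

Lemma seg0 f p d : seg f p d 0 = f (p + d / 2) * d.
Proof.
rewrite /seg expn0 big_nat1 /midpt add0r expr0 !divr1.
by rewrite fmorphV rmorph_nat.
Qed.

Lemma two_neq0 : (2 : C) != 0. Proof. by rewrite pnatr_eq0. Qed.

Lemma segS f p d n :
  seg f p d n.+1 = seg f p (d / 2) n + seg f (p + d / 2) (d / 2) n.
Proof.
have e2 : (2 : C) ^+ n != 0 by rewrite expf_neq0 // two_neq0.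
have r2 : (2 : R) ^+ n != 0 by rewrite expf_neq0 // pnatr_eq0.
have h2 := two_neq0.
rewrite /seg [LHS](big_cat_nat (n := (2 ^ n)%N)) /= ?leq_exp2l //.
congr (_ + _); last first.
  rewrite -{1}[(2 ^ n)%N]add0n big_addn.
  have -> : (2 ^ n.+1 - 2 ^ n = 2 ^ n)%N by rewrite expnS mul2n -addnn addnK.
  apply: eq_bigr => k _; congr (f _ * _); last first.
    by rewrite exprS invfM mulrA.
  have -> : midpt n.+1 (k + 2 ^ n) = 2^-1 * (1 + midpt n k).
    by rewrite /midpt natrD natrX exprS; field.
  by rewrite rmorphM rmorphD /= fmorphV rmorph_nat rmorph1; ring.
apply: eq_bigr => k _; congr (f _ * _); last first.
  by rewrite exprS invfM mulrA.
have -> : midpt n.+1 k = 2^-1 * midpt n k by rewrite /midpt exprS; field.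
by rewrite rmorphM /= fmorphV rmorph_nat -[d / 2 * _]mulrA.
Qed.

Lemma seg_lin f g c p d n :
  seg (fun z => f z + c * g z) p d n = seg f p d n + c * seg g p d n.
Proof.
by rewrite /seg mulr_sumr -big_split /=; apply: eq_bigr => k _; ring.
Qed.

Lemma seg_bound f p d n M :
  (forall t : R, 0 <= t <= 1 -> md (f (p + d * t%:C)) <= M) ->
  md (seg f p d n) <= M * md d.
Proof.
move=> h; apply: le_trans (md_sum _ _ _) _.
rewrite big_nat; apply: (@le_trans _ _ (\sum_(0 <= k < 2 ^ n) (M * md d / 2 ^+ n))).
  rewrite [leRHS]big_nat; apply: ler_sum => k /andP[_ kn].
  rewrite !mdM mdV mdX -mulrA.
  rewrite md2 ler_wpM2r ?h ?midpt01 //.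
  by rewrite mulr_ge0 ?md_ge0 // invr_ge0 exprn_ge0.
rewrite sumr_const_nat subn0 -[leLHS]mulr_natr natrX.
by rewrite mulfVK // expf_neq0 // pnatr_eq0.
Qed.

Lemma seg_const c p d n : seg (fun=> c) p d n = c * d.
Proof.
have h2 := two_neq0.
elim: n p d => [|n IH] p d; first by rewrite seg0.
by rewrite segS !IH; field.
Qed.

Lemma seg_id p d n : seg id p d n = p * d + d ^+ 2 / 2.
Proof.
have h2 := two_neq0.
elim: n p d => [|n IH] p d; first by rewrite seg0; field.
by rewrite segS !IH; field.
Qed.

(** Midpoint sums for the contour integral of f around the square with lower left corner
    p and side l, counterclockwise. *)
Definition sq (f : C -> C) (p : C) (l : C) n : C :=
  seg f p l n + seg f (p + l) ('i * l) n - seg f (p + 'i * l) l n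
  - seg f p ('i * l) n.

Lemma sq_lin f g c p l n :
  sq (fun z => f z + c * g z) p l n = sq f p l n + c * sq g p l n.
Proof. by rewrite /sq !seg_lin; ring. Qed.

(** The sums over the inner sides of the four quarters cancel. *)
Lemma sqS f p l n : sq f p l n.+1 =
  sq f p (l / 2) n + sq f (p + l / 2) (l / 2) n
  + (sq f (p + 'i * (l / 2)) (l / 2) n + sq f (p + l / 2 + 'i * (l / 2)) (l / 2) n).
Proof.
have h2 := two_neq0.
rewrite /sq !segS -!mulrA.
have -> : p + l / 2 + l / 2 = p + l by field.
have -> : p + 'i * (l / 2) + 'i * (l / 2) = p + 'i * l by field.
have -> : p + l / 2 + 'i * (l / 2) + l / 2 = p + l + 'i * (l / 2) by field.
have -> : p + 'i * (l / 2) + l / 2 = p + l / 2 + 'i * (l / 2) by field.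
have -> : p + l / 2 + 'i * (l / 2) + 'i * (l / 2) = p + 'i * l + l / 2 by field.
by ring.
Qed.

Lemma sq_affine c b p l n : sq (fun z => c + b * z) p l n = 0.
Proof.
rewrite (sq_lin (fun=> c) id) /sq !seg_const !seg_id.
have h2 := two_neq0.
have hi : 'i * 'i = - 1 :> C by rewrite -expr2 sqr_i.
have -> : (p * l + l ^+ 2 / 2 + ((p + l) * ('i * l) + ('i * l) ^+ 2 / 2) -
   ((p + 'i * l) * l + l ^+ 2 / 2) - (p * ('i * l) + ('i * l) ^+ 2 / 2)) = 0 by field.
ring.
Qed.

End Segments.

(** * Goursat's theorem with an exceptional point *)

Section Goursat.
Variable R : realType.
Local Notation C := R[i].
Local Notation Re := (@complex.Re R).
Local Notation Im := (@complex.Im R).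

Definition insq (x y l : R) (z : C) := (x <= Re z <= x + l) && (y <= Im z <= y + l).

Definition onsq (x y l : R) (z : C) := insq x y l z &&
  [|| Re z == x, Re z == x + l, Im z == y | Im z == y + l].

Lemma sq_boundary_bound f x y l n M : 0 <= l -> (forall z, onsq x y l z -> md (f z) <= M) ->
  md (sq f (x +i* y) l%:C n) <= 4 * M * l.
Proof.
move=> l0 h; rewrite /sq.
have hl : md (l%:C : C) = l by rewrite md_real ger0_norm.
have hil : md ('i * l%:C : C) = l by rewrite mdM md_i mul1r.
have tl (t : R) : 0 <= t <= 1 -> 0 <= l * t <= l by move=> /andP[? ?]; apply/andP; nra.
have side p d : md d = l -> (forall t : R, 0 <= t <= 1 -> onsq x y l (p + d * t%:C)) ->
    md (seg f p d n) <= M * l.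
  by move=> dl hp; rewrite -dl; apply: seg_bound => t /hp; apply: h.
have -> : 4 * M * l = M * l + M * l + M * l + M * l by ring.
apply: le_trans (mdBD _ _) _; apply: lerD.
  apply: le_trans (mdBD _ _) _; apply: lerD.
    apply: le_trans (mdD _ _) _; apply: lerD.
all: apply: side => // t /tl /andP[? ?].
all: rewrite /onsq /insq /=; apply/andP; split; [by apply/andP; split; apply/andP; lra|].
all: rewrite ?(oppr0, mul0r, mulr0, addr0, subr0, add0r, mul1r, eqxx, orbT) //.
Qed.

Lemma sq_bound f x y l n M : 0 <= l -> (forall z, insq x y l z -> md (f z) <= M) ->
  md (sq f (x +i* y) l%:C n) <= 4 * M * l.
Proof.
by move=> l0 h; apply: sq_boundary_bound => // z /andP[/h].
Qed.

Lemma insq_dist x y l z w : insq x y l z -> insq x y l w -> md (z - w) <= 2 * l.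
Proof.
move=> /andP[/andP[? ?] /andP[? ?]] /andP[/andP[? ?] /andP[? ?]].
apply: le_trans (ler_ReIm _) _.
rewrite !raddfB /=.
have -> : 2 * l = l + l by ring.
by apply: lerD; rewrite ler_norml; apply/andP; lra.
Qed.

Definition contat (f : C -> C) a := forall e : R, 0 < e ->
  exists2 d : R, 0 < d & forall z, md (z - a) < d -> md (f z - f a) <= e.

(** Num.sqrt is 0 on negative numbers, so this is the increment over [x, x + l] of the
    increasing function t |-> t + sqrt (t - a) - sqrt (a - t). Being an increment it is
    additive under subdivision; the square roots make it at least sqrt l on an interval
    containing a. *)
Definition incr (a x l : R) : R :=
  (x + l + Num.sqrt (x + l - a) - Num.sqrt (a - (x + l)))
  - (x + Num.sqrt (x - a) - Num.sqrt (a - x)).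

Lemma incr_ge a x l : 0 <= l -> l <= incr a x l.
Proof.
move=> l0; rewrite /incr.
have h1 : Num.sqrt (x - a) <= Num.sqrt (x + l - a) by apply: ler_wsqrtr; lra.
have h2 : Num.sqrt (a - (x + l)) <= Num.sqrt (a - x) by apply: ler_wsqrtr; lra.
lra.
Qed.

Lemma incr_sqrt a x l : x <= a <= x + l -> Num.sqrt l <= incr a x l.
Proof.
move=> /andP[h1 h2]; rewrite /incr.
have -> : Num.sqrt (x - a) = 0 by apply: ler0_sqrtr; lra.
have -> : Num.sqrt (a - (x + l)) = 0 by apply: ler0_sqrtr; lra.
have l0 : 0 <= l by lra.
suff : Num.sqrt l <= Num.sqrt (x + l - a) + Num.sqrt (a - x) by lra.
rewrite -(@ler_pXn2r _ 2) ?nnegrE ?addr_ge0 ?sqrtr_ge0 //.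
rewrite sqrrD !sqr_sqrtr ?l0 //; try lra.
have := mulr_ge0 (sqrtr_ge0 (x + l - a)) (sqrtr_ge0 (a - x)); lra.
Qed.

Lemma incrS a x l : incr a x l = incr a x (l / 2) + incr a (x + l / 2) (l / 2).
Proof.
rewrite /incr.
have -> : x + l / 2 + l / 2 = x + l by field.
by ring.
Qed.

(** A gauge of the square, additive under subdivision like the area. It is at least the
    area l^2, and at least the side l when the square contains a: this is how Goursat's
    argument can tolerate a point where f is merely continuous. *)
Definition nu (a : C) x y l := incr (Re a) x l * incr (Im a) y l.

Lemma nested (u v : nat -> R) : (forall n, u n <= u n.+1) ->
  (forall n, v n.+1 <= v n) -> (forall n, u n <= v n) ->
  exists X, forall n, u n <= X <= v n.
Proof.
move=> hu hv huv.
have mu := homo_leq (@lexx _ R) (@le_trans _ R) hu.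
have mv := homo_leq (r := fun a b : R => b <= a) (@lexx _ R) (fun y x z h1 h2 => le_trans h2 h1) hv.
have huv' m n : u m <= v n.
  apply: (le_trans (mu _ _ (leq_maxl m n))); apply: le_trans (huv _) _.
  exact: mv (leq_maxr _ _).
exists (sup (range u)) => n; apply/andP; split.
  apply: ub_le_sup; last by exists n.
  by exists (v 0%N) => _ [m _ <-].
apply: ge_sup; first by exists (u 0%N); exists 0%N.
by move=> _ [m _ <-].
Qed.

Lemma exists_pow2 (x : R) : exists k, x < 2 ^+ k.
Proof.
have [x0|x0] := ltP x 0; first by exists 0%N; rewrite expr0 (lt_trans x0).
exists (Num.bound x); apply: lt_le_trans (archi_boundP x0) _.
by rewrite -natrX ler_nat ltnW // ltn_expl.
Qed.

(** Demanding failure at arbitrarily fine levels n makes the property hereditary,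
    although each subdivision of the square costs one level (sqS). *)
Definition badsq f a e (s : R * R * R) : Prop :=
  forall N, exists2 n, (N <= n)%N &
    e * nu a s.1.1 s.1.2 s.2 < md (sq f (s.1.1 +i* s.1.2) s.2%:C n).

Definition child (s s' : R * R * R) :=
  [/\ s'.2 = s.2 / 2, s'.1.1 = s.1.1 \/ s'.1.1 = s.1.1 + s.2 / 2
    & s'.1.2 = s.1.2 \/ s'.1.2 = s.1.2 + s.2 / 2].

(** The gauge is additive, so four good quarters would make a good square. *)
Lemma badsq_child f a e s : badsq f a e s -> exists2 s', child s s' & badsq f a e s'.
Proof.
case: s => [[x y] l] hb; apply: contrapT => hn.
have good x' y' : x' = x \/ x' = x + l / 2 -> y' = y \/ y' = y + l / 2 ->
    exists N, forall n, (N <= n)%N ->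
      md (sq f (x' +i* y') (l / 2)%:C n) <= e * nu a x' y' (l / 2).
  move=> hx hy; apply: contrapT => hN; apply: hn; exists (x', y', l / 2); first by split.
  move=> N; apply: contrapT => hn; apply: hN; exists N => n Nn.
  by rewrite leNgt; apply/negP => hlt; apply: hn; exists n.
have [N1 h1] := good x y (or_introl erefl) (or_introl erefl).
have [N2 h2] := good (x + l / 2) y (or_intror erefl) (or_introl erefl).
have [N3 h3] := good x (y + l / 2) (or_introl erefl) (or_intror erefl).
have [N4 h4] := good (x + l / 2) (y + l / 2) (or_intror erefl) (or_intror erefl).
have [n hn1] := hb (maxn (maxn N1 N2) (maxn N3 N4)).+1.
case: n hn1 => // n; rewrite ltnS !geq_max => /andP[/andP[n1 n2] /andP[n3 n4]] /=.
rewrite sqS.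
have -> : (l%:C / 2 : C) = (l / 2)%:C by rewrite rmorphM /= fmorphV rmorph_nat.
have -> : x +i* y + (l / 2)%:C = (x + l / 2) +i* y :> C.
  by apply/eqP; rewrite eq_complex /= addr0 !eqxx.
have ad u v : u +i* v + 'i * (l / 2)%:C = u +i* (v + l / 2) :> C.
  by apply/eqP; rewrite eq_complex /=; apply/andP; split; apply/eqP; ring.
rewrite !ad; apply/negP; rewrite -leNgt.
have -> : e * nu a x y l = e * nu a x y (l / 2) + e * nu a (x + l / 2) y (l / 2)
  + (e * nu a x (y + l / 2) (l / 2) + e * nu a (x + l / 2) (y + l / 2) (l / 2)).
  by rewrite /nu (incrS _ x) (incrS _ y); ring.
apply: le_trans (mdD _ _) _; apply: lerD; apply: le_trans (mdD _ _) _; apply: lerD.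
- exact: h1.
- exact: h2.
- exact: h3.
- exact: h4.
Qed.

(** Otherwise nested bad squares shrink to a point. If f is differentiable there,
    subtracting the affine approximation leaves sums that are small against the area; if
    the point is a, continuity makes them small against the side. Either contradicts
    badness, as nu dominates both. *)
Lemma goursat f a x y l : 0 < l ->
  (forall z, insq x y l z -> cdiff f z \/ z = a /\ contat f a) ->
  forall e, 0 < e -> exists N, forall n, (N <= n)%N ->
    md (sq f (x +i* y) l%:C n) <= e.
Proof.
move=> l0 hf e e0.
set e1 := e / nu a x y l.
have nu0 : 0 < nu a x y l.
  by rewrite mulr_gt0 //; apply: lt_le_trans l0 (incr_ge _ _ (ltW l0)).
have e10 : 0 < e1 by rewrite divr_gt0.
suff hnb : ~ badsq f a e1 (x, y, l).
  apply: contrapT => hN; apply: hnb => N; apply: contrapT => hn; apply: hN.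
  exists N => n Nn; rewrite leNgt; apply/negP => hlt; apply: hn; exists n => //=.
  by rewrite /e1 divfK // gt_eqF.
move=> hb.
(* the nested squares are chosen by iterating a choice function on squares *)
have [nxt hnxt] : {nxt | forall s, badsq f a e1 s ->
    child s (nxt s) /\ badsq f a e1 (nxt s)}.
  have H s : exists s', badsq f a e1 s -> child s s' /\ badsq f a e1 s'.
    case: (pselect (badsq f a e1 s)) => [/badsq_child [s' ? ?]|hs]; first by exists s'.
    by exists s => /hs.
  by have [nxt h] := choice H; exists nxt.
pose s k := iter k nxt (x, y, l).
have hs k : badsq f a e1 (s k) by elim: k => //= k /hnxt [].
have hc k : child (s k) (s k.+1) by have [] := hnxt _ (hs k).
have hl k : (s k).2 = l / 2 ^+ k.
  elim: k => [|k IH]; first by rewrite expr0 divr1.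
  by have [-> _ _] := hc k; rewrite IH exprS invfM mulrA mulrAC.
have hl0 k : 0 < (s k).2 by rewrite hl divr_gt0 // exprn_gt0.
have [X hX] : exists X, forall n, (s n).1.1 <= X <= (s n).1.1 + (s n).2.
  apply: nested => n; have := hl0 n.
  - by have [_ [->|->] _] := hc n; lra.
  - by have [-> [->|->] _] := hc n; lra.
  - by lra.
have [Y hY] : exists Y, forall n, (s n).1.2 <= Y <= (s n).1.2 + (s n).2.
  apply: nested => n; have := hl0 n.
  - by have [_ _ [->|->]] := hc n; lra.
  - by have [-> _ [->|->]] := hc n; lra.
  - by lra.
have hz : insq x y l (X +i* Y) by rewrite /insq /= (hX 0%N) (hY 0%N).
have small d : 0 < d -> exists k, 2 * (s k).2 < d.
  move=> d0; have [k hk] := exists_pow2 (2 * l / d); exists k.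
  by rewrite hl mulrA ltr_pdivrMr ?exprn_gt0 // [d * _]mulrC -ltr_pdivrMr.
have nuge k : (s k).2 ^+ 2 <= nu a (s k).1.1 (s k).1.2 (s k).2.
  have h0 := ltW (hl0 k); rewrite expr2 /nu.
  by apply: ler_pM => //; apply: incr_ge.
have inz k : insq (s k).1.1 (s k).1.2 (s k).2 (X +i* Y) by rewrite /insq /= hX hY.
have [[c hcd]|[za hca]] := hf _ hz.
- have e8 : 0 < e1 / 8 by rewrite divr_gt0.
  have [d d0 hd] := hcd _ e8; have [k hk] := small _ d0.
  have [n _] := hs k 0%N; apply/negP; rewrite -leNgt.
  set z0 := X +i* Y in hd inz.
  have -> : sq f ((s k).1.1 +i* (s k).1.2) (s k).2%:C n =
     sq (fun z => f z - f z0 - c * (z - z0)) ((s k).1.1 +i* (s k).1.2) (s k).2%:C n.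
    rewrite -[LHS]subr0 -(sq_affine (f z0 - c * z0) c ((s k).1.1 +i* (s k).1.2) (s k).2%:C n).
    rewrite -mulN1r -sq_lin; congr (sq _ _ _ _); apply/funext => z; ring.
  apply: (@le_trans _ _ (4 * (e1 / 8 * (2 * (s k).2)) * (s k).2)).
    apply: sq_bound; first exact: ltW.
    move=> z hzk; have hdz := insq_dist hzk (inz k).
    apply: le_trans (hd _ (le_lt_trans hdz hk)) _.
    by rewrite ler_wpM2l // ltW.
  have -> : 4 * (e1 / 8 * (2 * (s k).2)) * (s k).2 = e1 * (s k).2 ^+ 2 by field.
  by rewrite ler_wpM2l // ltW.
- have e4 : 0 < e1 / 4 by rewrite divr_gt0.
  have [d d0 hd] := hca _ e4; have [k hk] := small _ d0.
  have [n _] := hs k 0%N; apply/negP; rewrite -leNgt.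
  have -> : sq f ((s k).1.1 +i* (s k).1.2) (s k).2%:C n =
     sq (fun z => f z - f a) ((s k).1.1 +i* (s k).1.2) (s k).2%:C n.
    rewrite -[LHS]subr0 -(sq_affine (f a) 0 ((s k).1.1 +i* (s k).1.2) (s k).2%:C n).
    rewrite -mulN1r -sq_lin; congr (sq _ _ _ _); apply/funext => z; ring.
  apply: (@le_trans _ _ (4 * (e1 / 4) * (s k).2)).
    apply: sq_bound; first exact: ltW.
    move=> z hzk; apply: hd; rewrite -za.
    exact: le_lt_trans (insq_dist hzk (inz k)) hk.
  have -> : 4 * (e1 / 4) * (s k).2 = e1 * (s k).2 by field.
  rewrite ler_wpM2l ?(ltW e10) // -[leLHS]sqr_sqrtr ?(ltW (hl0 k)) //.
  have := inz k; rewrite za => /andP[h1 h2].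
  by rewrite expr2 /nu ler_pM ?sqrtr_ge0 // incr_sqrt.
Qed.
End Goursat.

(** * Limits of bounded sequences along an ultrafilter *)

Section UltraLimit.
Variable R : realType.
Local Notation C := R[i].

Lemma exists_ultra : exists U : set_system nat, UltraFilter U /\
  forall N, U [set n | (N <= n)%N].
Proof.
have [U [hU hs]] := ultraFilterLemma (F := \oo) _.
by exists U; split => // N; apply: hs; exists N.
Qed.

(** Boundary sums of a merely bounded function may fail to converge. Along one fixed
    ultrafilter every bounded sequence has a limit, and these limits are linear and
    monotone, which is all that the Cauchy functional requires. *)
Definition ultra : set_system nat := xget \oo [set U | UltraFilter U /\
  forall N, U [set n | (N <= n)%N]].

Lemma ultraP : UltraFilter ultra /\ forall N, ultra [set n | (N <= n)%N].
Proof. by rewrite /ultra; case: xgetP => // h; have [U /h] := exists_ultra. Qed.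

Instance ultra_ultra : UltraFilter ultra. Proof. by case: ultraP. Qed.
Instance ultra_properf : ProperFilter ultra. Proof. exact: ultra_proper. Qed.

Definition isulim (u : nat -> C) (l : C) :=
  forall e : R, 0 < e -> ultra [set n | md (u n - l) < e].

(** The limit is the supremum of the numbers x with x <= u n for almost all n. *)
Lemma real_ulim (u : nat -> R) M : (forall n, `|u n| <= M) ->
  exists l, forall e, 0 < e -> ultra [set n | `|u n - l| < e].
Proof.
move=> hM; pose S : set R := [set x | ultra [set n | x <= u n]].
have S0 : S (- M).
  by apply: filterS filterT => n _; have := hM n; rewrite ler_norml => /andP[].
have SM : ubound S M.
  move=> x hx; have [n hn] := filter_ex hx.
  by apply: le_trans hn _; have := hM n; rewrite ler_norml => /andP[].
have hS : has_sup S by split; [exists (- M)|exists M].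
exists (sup S) => e e0.
have [x Sx hx] := sup_adherent e0 hS.
have hn : ~ S (sup S + e / 2).
  by move=> h; have := ub_le_sup (ex_intro _ M SM) h; lra.
have hc : ultra (~` [set n | sup S + e / 2 <= u n]).
  by case: (in_ultra_setVsetC [set n | sup S + e / 2 <= u n] ultra_ultra).
apply: filterS (filterI Sx hc) => n [/= h1 /negP]; rewrite -ltNge => h2.
by rewrite ltr_norml; apply/andP; split; lra.
Qed.

Definition ulim u := xget 0 [set l | isulim u l].

Lemma ulimP u M : (forall n, md (u n) <= M) -> isulim u (ulim u).
Proof.
move=> hM; rewrite /ulim; case: xgetP => // hn; exfalso.
have [x hx] := @real_ulim (fun n => complex.Re (u n)) M (fun n => le_trans (Re_le_md _) (hM n)).
have [y hy] := @real_ulim (fun n => complex.Im (u n)) M (fun n => le_trans (Im_le_md _) (hM n)).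
apply: (hn (x +i* y)) => e e0.
have e2 : 0 < e / 2 by rewrite divr_gt0.
apply: filterS (filterI (hx _ e2) (hy _ e2)) => n /= [h1 h2].
apply: le_lt_trans (ler_ReIm _) _; rewrite !raddfB /=.
by rewrite [e](splitr e) ltrD.
Qed.

Lemma isulim_unique u l l' : isulim u l -> isulim u l' -> l = l'.
Proof.
move=> h h'; apply/eqP; rewrite -subr_eq0 -md_eq0 eq_le md_ge0 andbT.
apply/ler_addgt0Pl => e e0; rewrite addr0.
have e2 : 0 < e / 2 by rewrite divr_gt0.
have [n [/= h1 h2]] := filter_ex (filterI (h _ e2) (h' _ e2)).
have -> : l - l' = (u n - l') - (u n - l) by ring.
by apply: le_trans (mdBD _ _) _; rewrite [e]splitr lerD // ltW.
Qed.

Lemma isulim_eq u l : isulim u l -> ulim u = l.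
Proof.
move=> h; apply: isulim_unique (h); rewrite /ulim.
by case: xgetP => // /(_ l).
Qed.

Lemma isulim_lin u v c l m : isulim u l -> isulim v m ->
  isulim (fun n => u n + c * v n) (l + c * m).
Proof.
move=> hu hv e e0.
have c0 := md_ge0 c.
have e2 : 0 < e / 2 by rewrite divr_gt0.
have e3 : 0 < e / (2 * (md c + 1)) by rewrite divr_gt0 // mulr_gt0 //; lra.
apply: filterS (filterI (hu _ e2) (hv _ e3)) => n /= [h1 h2].
have -> : u n + c * v n - (l + c * m) = (u n - l) + c * (v n - m) by ring.
apply: le_lt_trans (mdD _ _) _; rewrite mdM [e]splitr.
have h3 : md c * md (v n - m) <= (md c + 1) * md (v n - m).
  by rewrite ler_wpM2r ?md_ge0 //; lra.
have h4 : (md c + 1) * md (v n - m) < e / 2.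
  rewrite mulrC -ltr_pdivlMr; last lra.
  by rewrite -mulrA -invfM.
lra.
Qed.

Lemma isulim_cvg0 u : (forall e, 0 < e -> exists N, forall n, (N <= n)%N -> md (u n) <= e) ->
  isulim u 0.
Proof.
move=> h e e0; have e2 : 0 < e / 2 by rewrite divr_gt0.
have [N hN] := h _ e2.
have [_ hu] := ultraP.
by apply: filterS (hu N) => n /= /hN; rewrite subr0; lra.
Qed.

Lemma isulim_cst c : isulim (fun=> c) c.
Proof. by move=> e e0; apply: filterS filterT => n _ /=; rewrite subrr md0. Qed.

Lemma isulim_bound u l M : (forall n, md (u n) <= M) -> isulim u l -> md l <= M.
Proof.
move=> hM h; apply/ler_addgt0Pl => e e0.
have [n /= hn] := filter_ex (h _ e0).
have -> : l = u n - (u n - l) by ring.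
apply: le_trans (mdBD _ _) _; rewrite addrC.
by apply: lerD; [exact: ltW|exact: hM].
Qed.

End UltraLimit.

(** * Cauchy's formula on a square *)

Section CauchyFunctional.
Variable R : realType.
Local Notation C := R[i].
Local Notation Re := (@complex.Re R).
Local Notation Im := (@complex.Im R).

(** The boundary of the square with corners -1 - i and 1 + i; bigsq below is the full
    square. *)
Definition gam : C -> bool := onsq (-1) (-1) 2.
Definition sqG (f : C -> C) n := sq f ((-1) +i* (-1)) 2%:C n.

Lemma gam_ge1 z : gam z -> 1 <= md z.
Proof.
case/andP => _ /or4P[] /eqP h.
- by apply: le_trans (Re_le_md _); rewrite h normrN normr1.
- by apply: le_trans (Re_le_md _); rewrite h (_ : -1 + 2 = 1) ?normr1 //; ring.
- by apply: le_trans (Im_le_md _); rewrite h normrN normr1.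
- by apply: le_trans (Im_le_md _); rewrite h (_ : -1 + 2 = 1) ?normr1 //; ring.
Qed.

Lemma sqG_bound f n M : (forall z, gam z -> md (f z) <= M) -> md (sqG f n) <= 8 * M.
Proof.
move=> h; have := @sq_boundary_bound _ f (-1) (-1) 2 n M (ler0n _ _) h.
by have -> : 4 * M * 2 = 8 * M by ring.
Qed.

Lemma eq_sqG f g n : (forall z, gam z -> f z = g z) -> sqG f n = sqG g n.
Proof.
move=> h; apply/eqP; rewrite -subr_eq0 -md_eq0 eq_le md_ge0 andbT -[_ - _]addr0.
rewrite -mulN1r addr0 /sqG -sq_lin.
have := @sqG_bound (fun z => f z + -1 * g z) n 0; rewrite mulr0; apply => z hz.
by rewrite h // mulN1r subrr md0.
Qed.

(** The sign s is the orientation with which the segment enters the boundary of the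
    square. *)
Lemma seg_Im f p d n (s c : R) :
  (forall t : R, 0 <= t <= 1 -> c <= s * Im (f (p + d * t%:C) * d)) ->
  c <= s * Im (seg f p d n).
Proof.
move=> h; rewrite /seg raddf_sum mulr_sumr.
have -> : c = \sum_(0 <= k < 2 ^ n) (c / 2 ^+ n).
  have e2 : (2 : R) ^+ n != 0 by rewrite expf_neq0 // pnatr_eq0.
  by rewrite sumr_const_nat subn0 -[RHS]mulr_natr natrX mulfVK.
rewrite big_nat [leRHS]big_nat; apply: ler_sum => k /andP[_ kn].
have -> : (d / 2 ^+ n) = d * (2 ^+ n)^-1%:C by rewrite fmorphV rmorphXn rmorph_nat.
rewrite mulrA.
have ImM (x : C) (r : R) : Im (x * r%:C) = Im x * r by case: x => a b /=; ring.
rewrite /= ImM mulrA ler_wpM2r ?h ?midpt01 //.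
Qed.

(** On each side the integrand of 1/z contributes 2 / (u^2 + 1) >= 1 to the imaginary
    part, u being the coordinate along the side. *)
Lemma Im_sqG_inv n : 4 <= Im (sqG (fun z => z^-1) n).
Proof.
have hs (u : R) : -1 <= u <= 1 -> 1 <= 2 / (u ^+ 2 + 1).
  move=> /andP[h1 h2]; rewrite ler_pdivlMr; first by nra.
  by rewrite ltr_wpDl ?sqr_ge0.
rewrite /sqG /sq !raddfB raddfD /=.
have h1 : 1 <= 1 * Im (seg (fun z : C => z^-1) (-1 +i* -1) 2%:C n).
  apply: seg_Im => t /andP[t0 t1].
  have := hs (-1 + 2 * t); have -> : 1 * Im ((-1 +i* -1 + 2%:C * t%:C)^-1 * 2%:C : C) =
    2 / ((-1 + 2 * t) ^+ 2 + 1).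
    rewrite /=; rewrite !(oppr0, mul0r, mulr0, addr0, subr0, add0r, sqrrN, expr1n); ring.
  by apply; apply/andP; lra.
have h2 : 1 <= 1 * Im (seg (fun z : C => z^-1) (-1 +i* -1 + 2%:C) ('i * 2%:C) n).
  apply: seg_Im => t /andP[t0 t1].
  have := hs (-1 + 2 * t).
  have -> : 1 * Im ((-1 +i* -1 + 2%:C + 'i * 2%:C * t%:C)^-1 * ('i * 2%:C) : C) =
    2 / ((-1 + 2 * t) ^+ 2 + 1).
    rewrite /= !(oppr0, mul0r, mulr0, addr0, subr0, add0r, mul1r, sqrrN, expr1n).
    have -> : (-1 + 2 : R) = 1 by ring.
    by rewrite !expr1n addrC; ring.
  by apply; apply/andP; lra.
have h3 : 1 <= -1 * Im (seg (fun z : C => z^-1) (-1 +i* -1 + 'i * 2%:C) 2%:C n).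
  apply: seg_Im => t /andP[t0 t1].
  have := hs (-1 + 2 * t).
  have -> : -1 * Im ((-1 +i* -1 + 'i * 2%:C + 2%:C * t%:C)^-1 * 2%:C : C) =
    2 / ((-1 + 2 * t) ^+ 2 + 1).
    rewrite /= !(oppr0, mul0r, mulr0, addr0, subr0, add0r, mul1r, sqrrN, expr1n).
    have -> : (-1 + 2 : R) = 1 by ring.
    by rewrite !expr1n; ring.
  by apply; apply/andP; lra.
have h4 : 1 <= -1 * Im (seg (fun z : C => z^-1) (-1 +i* -1) ('i * 2%:C) n).
  apply: seg_Im => t /andP[t0 t1].
  have := hs (-1 + 2 * t).
  have -> : -1 * Im ((-1 +i* -1 + 'i * 2%:C * t%:C)^-1 * ('i * 2%:C) : C) =
    2 / ((-1 + 2 * t) ^+ 2 + 1).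
    rewrite /= !(oppr0, mul0r, mulr0, addr0, subr0, add0r, mul1r, sqrrN, expr1n).
    by rewrite addrC; ring.
  by apply; apply/andP; lra.
lra.
Qed.

(** The hypothesis bounds the error of the midpoint rule on one segment by the square of
    its length; halving doubles the number of segments and divides each error by four. *)
Lemma seg_primitive (P : C -> Prop) f F K p d n :
  (forall p d, P p -> P (p + d / 2) -> P (p + d) ->
    md (f (p + d / 2) * d - (F (p + d) - F p)) <= K * md d ^+ 2) ->
  (forall t : R, 0 <= t <= 1 -> P (p + d * t%:C)) ->
  md (seg f p d n - (F (p + d) - F p)) <= K * md d ^+ 2 / 2 ^+ n.
Proof.
move=> hK; have h2 := two_neq0 R.
elim: n p d => [|n IH] p d hP.
  rewrite seg0 expr0 divr1; apply: hK.
  - by have := hP 0; rewrite lexx ler01 mulr0 addr0; apply.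
  - have := hP 2^-1; rewrite fmorphV rmorph_nat; apply.
    by apply/andP; lra.
  - by have := hP 1; rewrite lexx ler01 mulr1; apply.
have h1 : forall t : R, 0 <= t <= 1 -> P (p + d / 2 * t%:C).
  move=> t /andP[? ?]; have := hP (t / 2); rewrite rmorphM fmorphV rmorph_nat.
  have -> : d * (t%:C / 2) = d / 2 * t%:C by ring.
  by apply; apply/andP; lra.
have h3 : forall t : R, 0 <= t <= 1 -> P (p + d / 2 + d / 2 * t%:C).
  move=> t /andP[? ?]; have := hP (1 / 2 + t / 2).
  rewrite rmorphD !rmorphM fmorphV rmorph_nat rmorph1.
  have -> : p + d * (1 / 2 + t%:C / 2) = p + d / 2 + d / 2 * t%:C by ring.
  by apply; apply/andP; lra.
have := lerD (IH _ _ h1) (IH _ _ h3); rewrite segS => h.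
have -> : seg f p (d / 2) n + seg f (p + d / 2) (d / 2) n - (F (p + d) - F p) =
  (seg f p (d / 2) n - (F (p + d / 2) - F p)) +
  (seg f (p + d / 2) (d / 2) n - (F (p + d / 2 + d / 2) - F (p + d / 2))).
  have -> : p + d / 2 + d / 2 = p + d by field.
  by ring.
apply: le_trans (mdD _ _) _; apply: le_trans h _.
rewrite mdM mdV md2 [2 ^+ n.+1]exprS le_eqVlt; apply/orP; left; apply/eqP.
have e2 : (2 : R) ^+ n != 0 by rewrite expf_neq0 // pnatr_eq0.
by field.
Qed.

Lemma md_prod_sub (x y x' y' : C) : md y <= 1 -> md x' <= 1 ->
  md (x * y - x' * y') <= md (x - x') + md (y - y').
Proof.
move=> hy hx'.
have -> : x * y - x' * y' = (x - x') * y + x' * (y - y') by ring.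
apply: le_trans (mdD _ _) _; rewrite !mdM; apply: lerD.
  by rewrite ler_piMr ?md_ge0.
by rewrite ler_piMl ?md_ge0.
Qed.

Lemma mdX_le1 (x : C) n : md x <= 1 -> md (x ^+ n) <= 1.
Proof. by move=> h; rewrite mdX exprn_ile1 ?md_ge0. Qed.

Lemma md_pow_sub (x y : C) n : md x <= 1 -> md y <= 1 ->
  md (x ^+ n - y ^+ n) <= n%:R * md (x - y).
Proof.
move=> hx hy; elim: n => [|n IH]; first by rewrite !expr0 subrr md0 mul0r.
rewrite !exprS; apply: le_trans (md_prod_sub _ _ (mdX_le1 n hx) hy) _.
by rewrite -addn1 natrD mulrDl mul1r addrC lerD2r.
Qed.

Lemma inv_sub (x y : C) : x != 0 -> y != 0 -> x^-1 - y^-1 = (y - x) * (x^-1 * y^-1).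
Proof. by move=> x0 y0; field; rewrite ?x0 ?y0. Qed.

(** The differences of powers of the primitive -1 / ((m + 1) z^(m + 1)) factor into sums
    of m + 1 products of inverses, each of which is compared with its value at the
    midpoint. *)
Lemma inv_primitive m (p d : C) : 1 <= md p -> 1 <= md (p + d / 2) -> 1 <= md (p + d) ->
  md ((p + d / 2)^-1 ^+ m.+2 * d -
    (- ((p + d)^-1 ^+ m.+1 / m.+1%:R) - - (p^-1 ^+ m.+1 / m.+1%:R)))
  <= m.+2%:R * md d ^+ 2.
Proof.
move=> hp hc ha.
have nz (x : C) : 1 <= md x -> x != 0 by rewrite -md_gt0; lra.
have le1 (x : C) : 1 <= md x -> md (x^-1) <= 1 by move=> h; rewrite mdV invf_le1 //; lra.
have p0 := nz _ hp; have c0 := nz _ hc; have a0 := nz _ ha.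
set u := (p + d)^-1; set v := p^-1; set w := (p + d / 2)^-1.
have hu : md u <= 1 := le1 _ ha; have hv : md v <= 1 := le1 _ hp.
have hw : md w <= 1 := le1 _ hc.
have h2 := two_neq0 R.
have uv : u - v = - d * (u * v) by rewrite (inv_sub a0 p0); congr (_ * _); ring.
have uw : md (u - w) <= md d.
  have -> : u - w = - (d / 2) * (u * w).
    by rewrite (inv_sub a0 c0); congr (_ * _); field.
  rewrite !mdM mdN mdM mdV md2.
  have : md u * md w <= 1 by rewrite mulr_ile1 ?md_ge0.
  have := md_ge0 d; have := md_ge0 u; have := md_ge0 w; nra.
have vw : md (v - w) <= md d.
  have -> : v - w = (d / 2) * (v * w).
    by rewrite (inv_sub p0 c0); congr (_ * _); ring.
  rewrite !mdM mdV md2.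
  have : md v * md w <= 1 by rewrite mulr_ile1 ?md_ge0.
  have := md_ge0 d; have := md_ge0 v; have := md_ge0 w; nra.
have m0 : m.+1%:R != 0 :> C by rewrite pnatr_eq0.
have -> : w ^+ m.+2 * d - (- (u ^+ m.+1 / m.+1%:R) - - (v ^+ m.+1 / m.+1%:R)) =
  d / m.+1%:R * \sum_(i < m.+1) (w ^+ m.+2 - u ^+ (m - i).+1 * v ^+ i.+1).
  have -> : - (u ^+ m.+1 / m.+1%:R) - - (v ^+ m.+1 / m.+1%:R) =
     - (u ^+ m.+1 - v ^+ m.+1) / m.+1%:R by field.
  rewrite subrXX uv sumrB sumr_const card_ord -mulr_natl.
  have -> : \sum_(i < m.+1) u ^+ (m - i).+1 * v ^+ i.+1 =
     u * v * \sum_(i < m.+1) u ^+ (m.+1.-1 - i) * v ^+ i.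
    by rewrite mulr_sumr; apply: eq_bigr => i _; rewrite !exprS /=; ring.
  by field.
rewrite mdM mdM mdV.
rewrite md_nat.
have hs : md (\sum_(i < m.+1) (w ^+ m.+2 - u ^+ (m - i).+1 * v ^+ i.+1)) <=
    m.+1%:R * (m.+2%:R * md d).
  apply: le_trans (md_sum _ _ _) _.
  have -> : m.+1%:R * (m.+2%:R * md d) = \sum_(i < m.+1) (m.+2%:R * md d).
    by rewrite sumr_const card_ord mulr_natl.
  apply: ler_sum => i _.
  have -> : m.+2 = ((m - i).+1 + i.+1)%N by rewrite addSn addnS subnK // -ltnS ltn_ord.
  rewrite exprD; apply: le_trans (md_prod_sub _ _ (mdX_le1 _ hw) (mdX_le1 _ hu)) _.
  rewrite natrD mulrDl; apply: lerD.
    apply: le_trans (md_pow_sub _ hw hu) _; rewrite ler_wpM2l // mdB //.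
  by apply: le_trans (md_pow_sub _ hw hv) _; rewrite ler_wpM2l // mdB //.
have d0 := md_ge0 d.
have mr0 : m.+1%:R != 0 :> R by rewrite pnatr_eq0.
apply: le_trans (ler_wpM2l _ hs) _; first by rewrite divr_ge0.
by rewrite le_eqVlt; apply/orP; left; apply/eqP; field.
Qed.

(** The powers z^-(m + 2) have a primitive, so their boundary sums telescope. *)
Lemma sqG_invpow m e : 0 < e -> exists N, forall n, (N <= n)%N ->
  md (sqG (fun z => z^-1 ^+ m.+2) n) <= e.
Proof.
move=> e0; pose K : R := 16 * m.+2%:R.
have [N hN] := exists_pow2 (K / e); exists N => n Nn.
have K0 : 0 <= K by rewrite mulr_ge0.
have hle : K / 2 ^+ n <= e.
  rewrite ler_pdivrMr ?exprn_gt0 // mulrC -ler_pdivrMr //.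
  by apply: le_trans (ltW hN) _; rewrite ler_eXn2l // ltr1n.
apply: le_trans hle.
pose F (z : C) : C := - (z^-1 ^+ m.+1 / m.+1%:R).
pose q : C := (-1) +i* (-1); pose l : C := 2%:C.
have hl : md l = 2 by rewrite /l md_real normr_nat.
have hil : md ('i * l) = 2 by rewrite mdM md_i mul1r.
have side p d : md d = 2 -> (forall t : R, 0 <= t <= 1 -> 1 <= md (p + d * t%:C)) ->
    md (seg (fun z => z^-1 ^+ m.+2) p d n - (F (p + d) - F p)) <= m.+2%:R * 4 / 2 ^+ n.
  move=> hd hp; have := @seg_primitive (fun z => 1 <= md z) (fun z => z^-1 ^+ m.+2) F m.+2%:R p d n
    (fun p d => @inv_primitive m p d) hp.
  by rewrite hd; have -> : (2 : R) ^+ 2 = 4 by ring.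
have -> : sqG (fun z => z^-1 ^+ m.+2) n =
   (seg (fun z => z^-1 ^+ m.+2) q l n - (F (q + l) - F q))
 + (seg (fun z => z^-1 ^+ m.+2) (q + l) ('i * l) n - (F (q + l + 'i * l) - F (q + l)))
 - (seg (fun z => z^-1 ^+ m.+2) (q + 'i * l) l n - (F (q + 'i * l + l) - F (q + 'i * l)))
 - (seg (fun z => z^-1 ^+ m.+2) q ('i * l) n - (F (q + 'i * l) - F q)).
  rewrite /sqG /sq -/q -/l.
  have alg (x y z w f0 f1 f2 f3 : C) : x + y - z - w = (x - (f1 - f0)) +
    (y - (f2 - f1)) - (z - (f2 - f3)) - (w - (f3 - f0)) by ring.
  by rewrite (addrAC q ('i * l) l); apply: alg.
have -> : K / 2 ^+ n = m.+2%:R * 4 / 2 ^+ n + m.+2%:R * 4 / 2 ^+ n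
  + m.+2%:R * 4 / 2 ^+ n + m.+2%:R * 4 / 2 ^+ n by rewrite /K; ring.
apply: le_trans (mdBD _ _) _; apply: lerD.
  apply: le_trans (mdBD _ _) _; apply: lerD.
    apply: le_trans (mdD _ _) _; apply: lerD.
all: apply: side => // t /andP[t0 t1]; apply: gam_ge1.
all: rewrite /gam /onsq /insq /=; apply/andP; split;
  [by apply/andP; split; apply/andP; lra|].
all: rewrite ?(oppr0, mul0r, mulr0, addr0, subr0, add0r, mul1r, eqxx, orbT) //.
Qed.

(** Dividing by the sums for 1/z plays the role of the factor 1 / (2 i pi). *)
Definition Lq f n := sqG f n / sqG (fun z => z^-1) n.
(** For continuous f, (2 i pi)^-1 times the integral of f over the boundary of the
    square. *)
Definition L f := ulim (Lq f).

Lemma sqG_inv_ge n : 4 <= md (sqG (fun z => z^-1) n).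
Proof.
apply: le_trans (Im_le_md _).
by have := Im_sqG_inv n; have := ler_norm (Im (sqG (fun z : C => z^-1) n)); lra.
Qed.

Lemma sqG_inv_neq0 n : sqG (fun z => z^-1) n != 0.
Proof. by rewrite -md_gt0; have := sqG_inv_ge n; lra. Qed.

Definition bdG (f : C -> C) M := forall z, gam z -> md (f z) <= M.

Lemma Lq_bound f n M : bdG f M -> md (Lq f n) <= 2 * M.
Proof.
move=> h; rewrite mdM mdV ler_pdivrMr ?md_gt0 ?sqG_inv_neq0 //.
have M0 : 0 <= M.
  apply: le_trans (md_ge0 (f ((-1) +i* (-1)))) (h _ _).
  by rewrite /gam /onsq /insq /=; apply/andP; split; [apply/andP; split; apply/andP; lra|rewrite eqxx].
apply: le_trans (sqG_bound n h) _.
have := sqG_inv_ge n; nra.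
Qed.

Lemma LP f M : bdG f M -> isulim (Lq f) (L f).
Proof. by move=> h; apply: (@ulimP _ _ (2 * M)) => n; apply: Lq_bound. Qed.

Lemma L_bound f M : bdG f M -> md (L f) <= 2 * M.
Proof.
by move=> h; apply: (isulim_bound _ (LP h)) => n; apply: Lq_bound.
Qed.

Lemma eq_L f g : (forall z, gam z -> f z = g z) -> L f = L g.
Proof.
by move=> h; congr ulim; apply/funext => n; rewrite /Lq (eq_sqG n h).
Qed.

Lemma L_lin f g c M M' : bdG f M -> bdG g M' ->
  L (fun z => f z + c * g z) = L f + c * L g.
Proof.
move=> hf hg; apply: isulim_eq.
have -> : Lq (fun z => f z + c * g z) = (fun n => Lq f n + c * Lq g n).
  by apply/funext => n; rewrite /Lq /sqG sq_lin; ring.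
by apply: isulim_lin; apply: LP; eassumption.
Qed.

Lemma L0 : L (fun=> 0) = 0.
Proof.
apply: isulim_eq; have -> : Lq (fun=> 0) = (fun=> 0); last exact: isulim_cst.
apply/funext => n; rewrite /Lq; suff -> : sqG (fun=> 0) n = 0 by rewrite mul0r.
apply/eqP; rewrite -md_eq0 eq_le md_ge0 andbT.
have := @sqG_bound (fun=> 0) n 0; rewrite mulr0; by apply => z _; rewrite md0.
Qed.

Lemma L_scale c g M : bdG g M -> L (fun z => c * g z) = c * L g.
Proof.
move=> hg; have b0 : bdG (fun=> 0) 0 by move=> z _; rewrite md0.
rewrite -[RHS]add0r -L0 -(L_lin _ b0 hg).
by apply: eq_L => z _; rewrite add0r.
Qed.

Lemma L_cvg0 f : (forall e, 0 < e -> exists N, forall n, (N <= n)%N -> md (sqG f n) <= e) ->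
  L f = 0.
Proof.
move=> h; apply: isulim_eq; apply: isulim_cvg0 => e e0.
have [N hN] := h e e0; exists N => n /hN hn.
rewrite mdM mdV; apply: le_trans hn; rewrite ler_piMr ?md_ge0 // invf_le1 ?md_gt0 ?sqG_inv_neq0 //.
by have := sqG_inv_ge n; lra.
Qed.

Lemma L_inv : L (fun z => z^-1) = 1.
Proof.
apply: isulim_eq; have -> : Lq (fun z => z^-1) = (fun=> 1); last exact: isulim_cst.
by apply/funext => n; rewrite /Lq divff // sqG_inv_neq0.
Qed.

Lemma L_invpow m : L (fun z => z^-1 ^+ m.+2) = 0.
Proof. by apply: L_cvg0 => e e0; apply: sqG_invpow. Qed.

Definition bigsq : C -> bool := insq (-1) (-1) 2.

Lemma L_goursat f a : (forall z, bigsq z -> cdiff f z \/ z = a /\ contat f a) ->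
  L f = 0.
Proof.
move=> h; apply: L_cvg0 => e e0; exact: (goursat (ltr0n _ 2) h e0).
Qed.

Lemma gam_bigsq z : gam z -> bigsq z.
Proof. by case/andP. Qed.

Lemma bigsq_small a : md a <= 2^-1 -> bigsq a.
Proof.
move=> ha; have := Re_le_md a; have := Im_le_md a; rewrite /bigsq /insq !ler_norml.
by move=> /andP[? ?] /andP[? ?]; apply/andP; split; apply/andP; lra.
Qed.

Lemma gam_neq z a : gam z -> md a <= 2^-1 -> z - a != 0.
Proof.
move=> /gam_ge1 hz ha; rewrite -md_gt0.
by have := mdBB z a; lra.
Qed.

Lemma kernel_bound a : md a <= 2^-1 -> bdG (fun z => (z - a)^-1) 2.
Proof.
move=> ha z gz; have h := gam_ge1 gz; rewrite mdV.
have hm : 2^-1 <= md (z - a) by have := mdBB z a; lra.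
by rewrite -[leRHS]invrK lef_pV2 ?posrE ?invr_gt0 //; lra.
Qed.

(** Partial sums of the expansion of the Cauchy kernel (z - a)^-1 in powers of a / z. *)
Definition geom N (a z : C) := \sum_(m < N) a ^+ m * z^-1 ^+ m.+1.

Lemma kernel_geom N a z : md a <= 2^-1 -> gam z ->
  (z - a)^-1 = geom N a z + (a * z^-1) ^+ N * (z - a)^-1.
Proof.
move=> ha gz; have za := gam_neq gz ha.
have z0 : z != 0 by rewrite -md_gt0; have := gam_ge1 gz; lra.
rewrite /geom; elim: N => [|N IH]; first by rewrite big_ord0 add0r expr0 mul1r.
rewrite big_ord_recr /= [LHS]IH -addrA; congr (_ + _).
rewrite !exprS !exprMn.
by field; rewrite za z0.
Qed.

Lemma geom_rem N a z : md a <= 2^-1 -> gam z ->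
  md ((z - a)^-1 - geom N a z) <= 2 / 2 ^+ N.
Proof.
move=> ha gz; rewrite {1}(kernel_geom N ha gz) addrC addKr mdM mdX mdM mdV mulrC.
have hz := gam_ge1 gz.
apply: ler_pM; rewrite ?exprn_ge0 ?mulr_ge0 ?invr_ge0 ?md_ge0 //.
  exact: kernel_bound gz.
rewrite -exprVn; apply: lerXn2r; rewrite ?nnegrE ?mulr_ge0 ?invr_ge0 ?md_ge0 //.
apply: le_trans ha; rewrite ler_piMr ?md_ge0 // invf_le1 //; lra.
Qed.

Lemma geom_bound N a z : md a <= 2^-1 -> gam z -> md (geom N a z) <= 4.
Proof.
move=> ha gz; have := geom_rem N ha gz; have := kernel_bound ha gz.
have : 2 / 2 ^+ N <= 2 :> R by rewrite ler_pdivrMr ?exprn_gt0 // ler_peMr // exprn_ege1 // ler1n.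
by have := mdBB (geom N a z) (z - a)^-1; rewrite mdB; lra.
Qed.

Lemma bdG_sum n (c : 'I_n -> C) (g : 'I_n -> C -> C) (M : 'I_n -> R) :
  (forall i, bdG (g i) (M i)) ->
  bdG (fun z => \sum_(i < n) c i * g i z) (\sum_(i < n) md (c i) * M i).
Proof.
move=> h z gz; apply: le_trans (md_sum _ _ _) _; apply: ler_sum => i _.
by rewrite mdM ler_wpM2l ?md_ge0 ?h.
Qed.

Lemma L_sum n (c : 'I_n -> C) (g : 'I_n -> C -> C) (M : 'I_n -> R) :
  (forall i, bdG (g i) (M i)) ->
  L (fun z => \sum_(i < n) c i * g i z) = \sum_(i < n) c i * L (g i).
Proof.
elim: n c g M => [|n IH] c g M h.
  by rewrite big_ord0 -[RHS]L0; apply: eq_L => z _; rewrite big_ord0.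
rewrite big_ord_recr /= -(IH _ _ (fun i => M (widen_ord (leqnSn n) i))) //.
rewrite -(L_lin (c ord_max) (bdG_sum (M := fun i => M (widen_ord (leqnSn n) i)) (fun i => c (widen_ord (leqnSn n) i)) _) (h ord_max)) //.
by apply: eq_L => z _; rewrite big_ord_recr.
Qed.

Lemma invpow_bound m : bdG (fun z => z^-1 ^+ m) 1.
Proof.
by move=> z gz; apply: mdX_le1; rewrite mdV invf_le1; have := gam_ge1 gz; lra.
Qed.

Lemma L_geom N a : L (geom N.+1 a) = 1.
Proof.
rewrite (L_sum (fun m : 'I_N.+1 => a ^+ m) (M := fun=> 1)); last first.
  by move=> i; apply: invpow_bound.
rewrite big_ord_recl expr0 mul1r big1 ?addr0; last first.
  by move=> i _; rewrite lift0 L_invpow mulr0.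
by rewrite -L_inv; apply: eq_L => z _; rewrite expr1.
Qed.

Lemma le_geom0 (x K : R) : 0 <= x -> (forall N, x <= K / 2 ^+ N) -> x = 0.
Proof.
move=> x0 h; apply/eqP; rewrite eq_le x0 andbT leNgt; apply/negP => xp.
have [N hN] := exists_pow2 (K / x); have := h N.
rewrite ler_pdivlMr ?exprn_gt0 // mulrC -ler_pdivlMr //.
by rewrite leNgt hN.
Qed.

(** In the expansion of the kernel L kills every term except z^-1, and the remainder is
    small on the boundary. *)
Lemma L_kernel a : md a <= 2^-1 -> L (fun z => (z - a)^-1) = 1.
Proof.
move=> ha; apply/eqP; rewrite -subr_eq0 -md_eq0; apply/eqP.
apply: (@le_geom0 _ 4); first exact: md_ge0.
move=> N; rewrite -(L_geom N a).
have -> : L (fun z => (z - a)^-1) - L (geom N.+1 a) =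
   L (fun z => (z - a)^-1 + -1 * geom N.+1 a z).
  rewrite (@L_lin _ _ _ 2 4) ?mulN1r //; first exact: kernel_bound.
  by move=> z gz; apply: geom_bound.
apply: le_trans (@L_bound _ (2 / 2 ^+ N) _) _; last by rewrite le_eqVlt; apply/orP; left; apply/eqP; ring.
move=> z gz; rewrite mulN1r; apply: le_trans (geom_rem N.+1 ha gz) _.
rewrite ler_pM2l // lef_pV2 ?posrE ?exprn_gt0 // ler_eXn2l //; lra.
Qed.

Lemma cdiff_cont (f : C -> C) a : cdiff f a -> contat f a.
Proof.
move=> [l hl] e e0; have [d d0 hd] := hl 1 ltr01.
have l0 := md_ge0 l.
exists (Num.min d (e / (md l + 1))); first by rewrite lt_min d0 divr_gt0 //; lra.
move=> z; rewrite lt_min => /andP[/hd h1]; rewrite ltr_pdivlMr; last lra.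
move=> h2; have -> : f z - f a = (f z - f a - l * (z - a)) + l * (z - a) by ring.
apply: le_trans (mdD _ _) _; rewrite mdM; have := md_ge0 (z - a); nra.
Qed.

Lemma cdiff_lin (f g : C -> C) c a : cdiff f a -> cdiff g a -> cdiff (fun z => f z + c * g z) a.
Proof.
move=> [l hl] [k hk]; exists (l + c * k) => e e0; have c0 := md_ge0 c.
have e2 : 0 < e / 2 by rewrite divr_gt0.
have e3 : 0 < e / (2 * (md c + 1)) by rewrite divr_gt0 // mulr_gt0 //; lra.
have [d d0 hd] := hl _ e2; have [d' d'0 hd'] := hk _ e3.
exists (Num.min d d'); first by rewrite lt_min d0.
move=> z; rewrite lt_min => /andP[/hd h1 /hd' h2].
have -> : f z + c * g z - (f a + c * g a) - (l + c * k) * (z - a) =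
  (f z - f a - l * (z - a)) + c * (g z - g a - k * (z - a)) by ring.
apply: le_trans (mdD _ _) _; rewrite mdM.
have h3 : md c * md (g z - g a - k * (z - a)) <= (md c + 1) * (e / (2 * (md c + 1)) * md (z - a)).
  by apply: ler_pM; rewrite ?md_ge0 //; lra.
have h4 : (md c + 1) * (e / (2 * (md c + 1)) * md (z - a)) = e / 2 * md (z - a).
  by field; lra.
have : e * md (z - a) = e / 2 * md (z - a) + e / 2 * md (z - a) by field.
lra.
Qed.

Lemma cdiff_quot (f : C -> C) a w : cdiff f w -> w != a -> cdiff (fun z => (f z - f a) / (z - a)) w.
Proof.
move=> hf wa; have wa0 : w - a != 0 by rewrite subr_eq0.
have hc := cdiff_cont hf; case: hf => [l hl].
have r0 : 0 < md (w - a) by rewrite md_gt0.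
set r := md (w - a) in r0.
exists (l / (w - a) - (f w - f a) / (w - a) ^+ 2) => e e0.
pose e1 := e * r / 4; have e10 : 0 < e1 by rewrite divr_gt0 // mulr_gt0.
pose B := md (f w - f a); have B0 : 0 <= B by apply: md_ge0.
have [d d0 hd] := hl _ e10.
pose e2 := e * r ^+ 2 / 4; have e20 : 0 < e2 by rewrite divr_gt0 // mulr_gt0 // exprn_gt0.
pose k := l * (w - a) - (f w - f a); have k0 := md_ge0 k.
pose d2 := e * r ^+ 3 / (4 * (md k + 1)).
have d20 : 0 < d2 by rewrite divr_gt0 ?mulr_gt0 ?exprn_gt0 //; lra.
exists (Num.min d (Num.min d2 (r / 2))); first by rewrite !lt_min d0 d20 divr_gt0.
move=> z; rewrite !lt_min => /andP[/hd h1 /andP[h2 h3]].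
have rz : r / 2 <= md (z - a).
  have -> : z - a = (w - a) - (w - z) by ring.
  by have := mdBB (w - a) (w - z); rewrite (mdB w z) -/r; lra.
have za0 : z - a != 0 by rewrite -md_gt0; lra.
have -> : (f z - f a) / (z - a) - (f w - f a) / (w - a) -
  (l / (w - a) - (f w - f a) / (w - a) ^+ 2) * (z - w) =
  (f z - f w - l * (z - w)) / (z - a) - k * (z - w) ^+ 2 / ((w - a) ^+ 2 * (z - a)).
  by rewrite /k; field; rewrite wa0 za0.
set t := md (z - w) in h1 h2 h3 *.
have t0 : 0 <= t by apply: md_ge0.
apply: le_trans (mdBD _ _) _.
have -> : e * t = e / 2 * t + e / 2 * t by field.
apply: lerD.
  rewrite mdM mdV ler_pdivrMr; last lra.
  apply: le_trans h1 _; rewrite /e1.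
  have : e / 2 * t * (r / 2) <= e / 2 * t * md (z - a) by rewrite ler_wpM2l // mulr_ge0 // ltW // divr_gt0.
  by have -> : e / 2 * t * (r / 2) = e * r / 4 * t by field.
rewrite !mdM mdV mdM !mdX -/r -/t ler_pdivrMr; last by rewrite mulr_gt0 ?exprn_gt0 //; lra.
have hk : md k * t <= e * r ^+ 3 / 4.
  apply: (@le_trans _ _ ((md k + 1) * d2)); first by apply: ler_pM => //; lra.
  by rewrite /d2 le_eqVlt; apply/orP; left; apply/eqP; field; lra.
have -> : md k * t ^+ 2 = (md k * t) * t by ring.
apply: (@le_trans _ _ (e * r ^+ 3 / 4 * t)); first by rewrite ler_wpM2r.
have -> : e * r ^+ 3 / 4 * t = e / 2 * t * (r ^+ 2 * (r / 2)) by field.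
rewrite ler_wpM2l //; first by rewrite mulr_ge0 // ltW // divr_gt0.
by rewrite ler_wpM2l // exprn_ge0 // ltW.
Qed.

Lemma cdiff_near (f g : C -> C) w (d : R) : 0 < d ->
  (forall z, md (z - w) < d -> f z = g z) -> cdiff f w -> cdiff g w.
Proof.
move=> d0 h [l hl]; exists l => e e0; have [d' d'0 hd] := hl e e0.
exists (Num.min d d'); first by rewrite lt_min d0.
move=> z; rewrite lt_min => /andP[h1 h2].
by rewrite -!h ?subrr ?md0 //; apply: hd.
Qed.

Lemma cdiff_mulid (f : C -> C) a : cdiff f a -> cdiff (fun z => f z * z) a.
Proof.
move=> hf; have hc := cdiff_cont hf; case: hf => l hl.
exists (l * a + f a) => e e0.
have a0 := md_ge0 a.
have e1 : 0 < e / (2 * (md a + 1)) by rewrite divr_gt0 // mulr_gt0 //; lra.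
have e2 : 0 < e / 2 by rewrite divr_gt0.
have [d d0 hd] := hl _ e1; have [d' d'0 hd'] := hc _ e2.
exists (Num.min d d'); first by rewrite lt_min d0.
move=> z; rewrite lt_min => /andP[/hd h1 /hd' h2].
have -> : f z * z - f a * a - (l * a + f a) * (z - a) =
  (f z - f a - l * (z - a)) * a + (f z - f a) * (z - a) by ring.
have t0 := md_ge0 (z - a).
apply: le_trans (mdD _ _) _; rewrite !mdM.
have -> : e * md (z - a) = e / (2 * (md a + 1)) * md (z - a) * (md a + 1) + e / 2 * md (z - a).
  by field; lra.
apply: lerD; last by rewrite ler_wpM2r.
by apply: ler_pM; rewrite ?md_ge0 //; lra.
Qed.

Lemma cdiff_cst (c a : C) : cdiff (fun=> c) a.
Proof.
exists 0 => e e0; exists 1 => // z _.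
by rewrite subrr mul0r subr0 md0 mulr_ge0 ?md_ge0 // ltW.
Qed.

Lemma cdiff_horner (p : {poly C}) a : cdiff (fun z => p.[z]) a.
Proof.
elim/poly_ind: p => [|p c IH].
  by have -> : (fun z : C => (0 : {poly C}).[z]) = (fun=> 0); [apply/funext => z; rewrite horner0|exact: cdiff_cst].
have -> : (fun z : C => (p * 'X + c%:P).[z]) = (fun z => p.[z] * z + 1 * c).
  by apply/funext => z; rewrite hornerMXaddC mul1r.
by apply: cdiff_lin; [exact: cdiff_mulid|exact: cdiff_cst].
Qed.

(** Goursat's theorem applies to the difference quotient of f at a, extended by the
    derivative: at a itself it is only known to be continuous, which is the exceptional
    point allowed there. *)
Lemma cauchy1 f a M : (forall z, bigsq z -> cdiff f z) -> md a <= 2^-1 -> bdG f M ->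
  f a = L (fun z => f z * (z - a)^-1).
Proof.
move=> hf ha hM.
have ba := bigsq_small ha.
have [l hl] := hf a ba.
(* the difference quotient of f at a, extended by f' (a) = l *)
pose g z := if z == a then l else (f z - f a) / (z - a).
have Lg : L g = 0.
  apply: (@L_goursat _ a) => z bz.
  have [->|za] := eqVneq z a; [right; split=> // e e0|left].
    have [d d0 hd] := hl e e0; exists d => // x xd; rewrite /g eqxx.
    have [_|xa] := eqVneq x a; first by rewrite subrr md0 ltW.
    have xa0 : x - a != 0 by rewrite subr_eq0.
    have -> : (f x - f a) / (x - a) - l = (f x - f a - l * (x - a)) / (x - a) by field.
    by rewrite mdM mdV ler_pdivrMr ?md_gt0 // hd.
  apply: (@cdiff_near (fun z => (f z - f a) / (z - a)) g _ (md (z - a))).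
  - by rewrite md_gt0 subr_eq0.
  - move=> x xd; rewrite /g; case: eqVneq xd => // ->.
    by rewrite mdB ltxx.
  - exact: cdiff_quot (hf _ bz) za.
have kb := kernel_bound ha.
have fkb : bdG (fun z => f z * (z - a)^-1) (M * 2).
  by move=> z gz; rewrite mdM ler_pM ?md_ge0 ?hM ?kb.
apply/eqP; rewrite eq_sym -subr_eq0; apply/eqP; rewrite -Lg.
transitivity (L (fun z => f z * (z - a)^-1 + - f a * (z - a)^-1)).
  by rewrite (L_lin _ fkb kb) L_kernel // mulr1.
apply: eq_L => z gz; rewrite /g; have := gam_neq gz ha.
by rewrite subr_eq0 => /negbTE ->; ring.
Qed.

Lemma L_monomial k m : L (fun z => z ^+ k * z^-1 ^+ m.+1) = (k == m)%:R.
Proof.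
have nz z : gam z -> z != 0 by move=> /gam_ge1 h; rewrite -md_gt0; lra.
have [km|km|->] := ltngtP k m.
- rewrite -[RHS](L_invpow (m - k.+1)); apply: eq_L => z /nz z0.
  have -> : m.+1 = (k + (m - k.+1).+2)%N by rewrite subnSK // addnS subnKC // ltnW.
  by rewrite exprD mulrA -exprMn divff // expr1n mul1r.
- transitivity (L (fun z => ('X^(k - m.+1)).[z])).
    apply: eq_L => z /nz z0; rewrite hornerXn.
    rewrite -{1}(subnK km) exprD -mulrA -exprMn divff // expr1n mulr1 //.
  by apply: (@L_goursat _ 0) => z _; left; apply: cdiff_horner.
- rewrite -[RHS]L_inv; apply: eq_L => z /nz z0.
  by rewrite exprSr mulrA -exprMn divff // expr1n mul1r.
Qed.

Definition LL (g : C -> C -> C) := L (fun w => L (fun z => g z w)).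
Definition bd2 (g : C -> C -> C) M := forall z w, gam z -> gam w -> md (g z w) <= M.

Lemma bd2_L g M : bd2 g M -> bdG (fun w => L (fun z => g z w)) (2 * M).
Proof. by move=> h w gw; apply: L_bound => z gz; apply: h. Qed.

Lemma LL_bound g M : bd2 g M -> md (LL g) <= 4 * M.
Proof.
move=> h; have -> : 4 * M = 2 * (2 * M) by ring.
exact: L_bound (bd2_L h).
Qed.

Lemma eq_LL g h : (forall z w, gam z -> gam w -> g z w = h z w) -> LL g = LL h.
Proof. by move=> e; apply: eq_L => w gw; apply: eq_L => z gz; apply: e. Qed.

Lemma LL_lin g h c M M' : bd2 g M -> bd2 h M' ->
  LL (fun z w => g z w + c * h z w) = LL g + c * LL h.
Proof.
move=> hg hh; rewrite -(L_lin c (bd2_L hg) (bd2_L hh)); apply: eq_L => w gw.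
by apply: (@L_lin _ _ _ M M') => z gz; [apply: hg|apply: hh].
Qed.

Lemma LL_sum n (c : 'I_n -> C) (g : 'I_n -> C -> C -> C) (M : R) :
  (forall i, bd2 (g i) M) ->
  LL (fun z w => \sum_(i < n) c i * g i z w) = \sum_(i < n) c i * LL (g i).
Proof.
move=> h; rewrite -(L_sum c (fun i => bd2_L (h i))); apply: eq_L => w gw.
by apply: (@L_sum _ c _ (fun=> M)) => i z gz; apply: h.
Qed.

Definition kern a b (z w : C) := (z - a)^-1 * (w - b)^-1.

Lemma kern_bound a b : md a <= 2^-1 -> md b <= 2^-1 -> bd2 (kern a b) 4.
Proof.
move=> ha hb z w gz gw; rewrite mdM; have -> : (4 : R) = 2 * 2 by ring.
by apply: ler_pM; rewrite ?md_ge0 ?kernel_bound.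
Qed.

Lemma bd2M g h M M' : bd2 g M -> bd2 h M' -> bd2 (fun z w => g z w * h z w) (M * M').
Proof. by move=> hg hh z w gz gw; rewrite mdM ler_pM ?md_ge0 ?hg ?hh. Qed.

Lemma cauchy2 (f : C -> C -> C) M a b :
  (forall z w, bigsq z -> bigsq w -> cdiff (fun z => f z w) z) ->
  (forall z w, bigsq z -> bigsq w -> cdiff (fun w => f z w) w) ->
  (forall z w, bigsq z -> bigsq w -> md (f z w) <= M) ->
  md a <= 2^-1 -> md b <= 2^-1 ->
  f a b = LL (fun z w => f z w * kern a b z w).
Proof.
move=> h1 h2 hM ha hb; have ba := bigsq_small ha.
rewrite (@cauchy1 (fun w => f a w) b M) //; last 2 first.
- by move=> w bw; apply: h2.
- by move=> w gw; apply: hM => //; apply: gam_bigsq.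
apply: eq_L => w gw; have bw := gam_bigsq gw.
rewrite (@cauchy1 (fun z => f z w) a M) //; last 2 first.
- by move=> z bz; apply: h1.
- by move=> z gz; apply: hM => //; apply: gam_bigsq.
rewrite mulrC -(@L_scale _ _ (M * 2)); last first.
  by move=> z gz; rewrite mdM ler_pM ?md_ge0 ?hM ?kernel_bound //; apply: gam_bigsq.
by apply: eq_L => z gz; rewrite /kern; ring.
Qed.

(** The Taylor coefficient at 0, in the form given by Cauchy's formula. *)
Definition coef (f : C -> C -> C) m n :=
  LL (fun z w => f z w * (z^-1 ^+ m.+1 * w^-1 ^+ n.+1)).

Lemma invpow2_bound m n : bd2 (fun z w => z^-1 ^+ m * w^-1 ^+ n) 1.
Proof.
by move=> z w gz gw; rewrite mdM mulr_ile1 ?md_ge0 ?invpow_bound.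
Qed.

Lemma coef_bound f m n M : bd2 f M -> md (coef f m n) <= 4 * M.
Proof.
by move=> h; apply: LL_bound; rewrite -[M]mulr1; apply: bd2M => //; apply: invpow2_bound.
Qed.

Definition psum (c : nat -> nat -> C) N a b :=
  \sum_(m < N) \sum_(n < N) c m n * (a ^+ m * b ^+ n).

Lemma bd2_ge0 g M : bd2 g M -> 0 <= M.
Proof.
move=> h; apply: le_trans (md_ge0 _) (h (-1 +i* -1) (-1 +i* -1) _ _);
by rewrite /gam /onsq /insq /=; apply/andP; split; [apply/andP; split; apply/andP; lra|rewrite eqxx].
Qed.

Lemma psum_LL f N M a b : bd2 f M ->
  psum (coef f) N a b = LL (fun z w => f z w * (geom N a z * geom N b w)).
Proof.
move=> hf.
have hb m n : bd2 (fun z w => f z w * (z^-1 ^+ m.+1 * w^-1 ^+ n.+1)) M.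
  by rewrite -[M]mulr1; apply: bd2M => //; apply: invpow2_bound.
transitivity (LL (fun z w => \sum_(m < N) 1 * \sum_(n < N) (a ^+ m * b ^+ n) *
    (f z w * (z^-1 ^+ m.+1 * w^-1 ^+ n.+1)))).
  pose B := \sum_(m < N) \sum_(n < N) md (a ^+ m * b ^+ n) * M.
  have M0 := bd2_ge0 hf.
  rewrite (@LL_sum N (fun=> 1) (fun m z w => \sum_(n < N) (a ^+ m * b ^+ n) *
    (f z w * (z^-1 ^+ m.+1 * w^-1 ^+ n.+1))) B).
    apply: eq_bigr => m _; rewrite mul1r.
    rewrite (@LL_sum N (fun n : 'I_N => a ^+ m * b ^+ n) (fun n z w => f z w * (z^-1 ^+ m.+1 * w^-1 ^+ n.+1)) M) //.
    by apply: eq_bigr => n _; rewrite mulrC.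
  move=> m z w gz gw.
  apply: (@le_trans _ _ (\sum_(n < N) md (a ^+ m * b ^+ n) * M)); last first.
    rewrite /B [leRHS](bigD1 m) //= lerDl; apply: sumr_ge0 => i _; apply: sumr_ge0 => j _.
    by rewrite mulr_ge0 ?md_ge0.
  apply: le_trans (md_sum _ _ _) _; apply: ler_sum => n _.
  by rewrite mdM ler_wpM2l ?md_ge0 ?hb.
apply: eq_LL => z w gz gw; rewrite /geom mulr_suml mulr_sumr; apply: eq_bigr => m _.
rewrite mul1r !mulr_sumr; apply: eq_bigr => n _; ring.
Qed.

(** Replacing both kernels by their geometric sums turns Cauchy's formula into the
    Taylor polynomial, at a cost of order 2^-N since |a / z| and |b / w| are at most
    1/2. *)
Lemma taylor_rem f N M a b : bd2 f M -> md a <= 2^-1 -> md b <= 2^-1 ->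
  f a b = LL (fun z w => f z w * kern a b z w) ->
  md (f a b - psum (coef f) N a b) <= 48 * M / 2 ^+ N.
Proof.
move=> hf ha hb ->; rewrite (psum_LL N a b hf).
have hg : bd2 (fun z w => geom N a z * geom N b w) 16.
  move=> z w gz gw; rewrite mdM; have -> : (16 : R) = 4 * 4 by ring.
  by apply: ler_pM; rewrite ?md_ge0 ?geom_bound.
rewrite -mulN1r -(LL_lin _ (bd2M hf (kern_bound ha hb)) (bd2M hf hg)).
have -> : 48 * M / 2 ^+ N = 4 * (M * (12 / 2 ^+ N)) by ring.
apply: LL_bound => z w gz gw.
have -> : f z w * kern a b z w + -1 * (f z w * (geom N a z * geom N b w)) =
  f z w * (((z - a)^-1 - geom N a z) * (w - b)^-1 + geom N a z * ((w - b)^-1 - geom N b w)).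
  by rewrite /kern; ring.
rewrite mdM ler_pM ?md_ge0 ?hf //.
apply: le_trans (mdD _ _) _; rewrite !mdM.
have h1 := geom_rem N ha gz; have h2 := geom_rem N hb gw.
have h3 := kernel_bound hb gw; have h4 := geom_bound N ha gz.
have -> : 12 / 2 ^+ N = 2 / 2 ^+ N * 2 + 4 * (2 / 2 ^+ N) :> R by ring.
by apply: lerD; apply: ler_pM; rewrite ?md_ge0.
Qed.

(** The kernel is differentiable in (a, b) with a quadratic remainder, uniformly on the
    boundary; LL carries this over to f. *)
Lemma cauchy_rep_diff (phi f : C -> C -> C) M : bd2 phi M ->
  (forall a b, md a <= 2^-1 -> md b <= 2^-1 ->
     f a b = LL (fun z w => phi z w * kern a b z w)) ->
  forall a b, md a <= 2^-1 -> md b <= 2^-1 -> exists u v, forall s t,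
    md (a + s) <= 2^-1 -> md (b + t) <= 2^-1 ->
    md (f (a + s) (b + t) - f a b - (u * s + v * t)) <= 64 * M * (md s + md t) ^+ 2.
Proof.
move=> hphi hf a b ha hb.
have h1 : bd2 (fun z w => phi z w * ((z - a)^-1 ^+ 2 * (w - b)^-1)) (M * (2 ^+ 2 * 2)).
  apply: bd2M => // z w gz gw; rewrite mdM mdX.
  by apply: ler_pM; rewrite ?exprn_ge0 ?md_ge0 ?kernel_bound ?lerXn2r ?nnegrE ?md_ge0 ?kernel_bound.
have h2 : bd2 (fun z w => phi z w * ((z - a)^-1 * (w - b)^-1 ^+ 2)) (M * (2 * 2 ^+ 2)).
  apply: bd2M => // z w gz gw; rewrite mdM mdX.
  by apply: ler_pM; rewrite ?exprn_ge0 ?md_ge0 ?kernel_bound ?lerXn2r ?nnegrE ?md_ge0 ?kernel_bound.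
exists (LL (fun z w => phi z w * ((z - a)^-1 ^+ 2 * (w - b)^-1))).
exists (LL (fun z w => phi z w * ((z - a)^-1 * (w - b)^-1 ^+ 2))).
move=> s t has hbt; rewrite !hf //.
(* phi times the remainder of the first order expansion of the kernel in (s, t) *)
pose r z w := phi z w * (s ^+ 2 * ((z - a)^-1 ^+ 2 * (z - (a + s))^-1 * (w - (b + t))^-1)
   + t ^+ 2 * ((z - a)^-1 * (w - b)^-1 ^+ 2 * (w - (b + t))^-1)
   + s * t * ((z - a)^-1 ^+ 2 * (w - b)^-1 * (w - (b + t))^-1)).
have hk1 := bd2M hphi (kern_bound has hbt).
have hk0 := bd2M hphi (kern_bound ha hb).
set M1 := M * _ in h1; set M2 := M * _ in h2; set M3 := M * _ in hk0.
have hr : bd2 r (16 * M * (md s + md t) ^+ 2).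
  move=> z w gz gw; rewrite /r mdM.
  have -> : 16 * M * (md s + md t) ^+ 2 = M * (16 * (md s + md t) ^+ 2) by ring.
  apply: ler_pM; rewrite ?md_ge0 ?hphi //.
  have k1 := kernel_bound ha gz; have k2 := kernel_bound has gz.
  have k3 := kernel_bound hb gw; have k4 := kernel_bound hbt gw.
  have q4 (x y u v : C) : md x <= 2 -> md y <= 2 -> md u <= 2 -> md v <= 2 -> md (x * y * u * v) <= 16.
    move=> ? ? ? ?; rewrite !mdM; have -> : (16 : R) = 2 * 2 * 2 * 2 by ring.
    by do ![apply: ler_pM; rewrite ?mulr_ge0 ?md_ge0 //].
  have q1 := q4 _ _ _ _ k1 k1 k2 k4; have q2 := q4 _ _ _ _ k1 k3 k3 k4.
  have q3 := q4 _ _ _ _ k1 k1 k3 k4.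
  have s0 := md_ge0 s; have t0 := md_ge0 t.
  apply: (@le_trans _ _ (md s ^+ 2 * 16 + md t ^+ 2 * 16 + md s * md t * 16)); last by nra.
  rewrite !expr2 -!mdM.
  apply: le_trans (mdD _ _) _; apply: lerD; first (apply: le_trans (mdD _ _) _; apply: lerD).
  - by rewrite mdM ler_wpM2l ?md_ge0 //; move: q1; rewrite !mulrA.
  - by rewrite mdM ler_wpM2l ?md_ge0 //; move: q2; rewrite !mulrA.
  - by rewrite [leLHS]mdM ler_wpM2l ?md_ge0 //; move: q3; rewrite !mulrA.
have -> : 64 * M * (md s + md t) ^+ 2 = 4 * (16 * M * (md s + md t) ^+ 2) by ring.
apply: le_trans (LL_bound hr); rewrite le_eqVlt; apply/orP; left; apply/eqP; congr md.
have e1 : LL (fun z w => r z w + s * (phi z w * ((z - a)^-1 ^+ 2 * (w - b)^-1))) =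
  LL r + s * LL (fun z w => phi z w * ((z - a)^-1 ^+ 2 * (w - b)^-1)) by exact: (LL_lin s hr h1).
have b1 : bd2 (fun z w => r z w + s * (phi z w * ((z - a)^-1 ^+ 2 * (w - b)^-1)))
   (16 * M * (md s + md t) ^+ 2 + md s * M1).
  move=> z w gz gw; apply: le_trans (mdD _ _) _; apply: lerD; first exact: hr.
  by rewrite mdM ler_wpM2l ?md_ge0 ?h1.
have e2 := LL_lin t b1 h2; have b2 : bd2 (fun z w => r z w + s * (phi z w * ((z - a)^-1 ^+ 2 * (w - b)^-1)) + t * (phi z w * ((z - a)^-1 * (w - b)^-1 ^+ 2)))
   (16 * M * (md s + md t) ^+ 2 + md s * M1 + md t * M2).
  move=> z w gz gw; apply: le_trans (mdD _ _) _; apply: lerD; first exact: b1.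
  by rewrite mdM ler_wpM2l ?md_ge0 ?h2.
have e3 := LL_lin 1 b2 hk0.
have -> : LL (fun z w => phi z w * kern (a + s) (b + t) z w) =
  LL (fun z w => r z w + s * (phi z w * ((z - a)^-1 ^+ 2 * (w - b)^-1)) + t * (phi z w * ((z - a)^-1 * (w - b)^-1 ^+ 2)) + 1 * (phi z w * kern a b z w)).
  apply: eq_LL => z w gz gw; rewrite /r /kern.
  have := gam_neq gz ha; have := gam_neq gz has; have := gam_neq gw hb; have := gam_neq gw hbt.
  move: (phi z w) => p n1 n2 n3 n4.
  have e5 : (z - (a + s))^-1 = (z - a)^-1 + s * ((z - a)^-1 * (z - (a + s))^-1) by field; rewrite n3 n4.
  have e6 : (w - (b + t))^-1 = (w - b)^-1 + t * ((w - b)^-1 * (w - (b + t))^-1) by field; rewrite n1 n2.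
  move: e5 e6; move: (z - (a + s))^-1 (z - a)^-1 (w - (b + t))^-1 (w - b)^-1 => k' k l' l e5 e6.
  have d1 : k' - k - s * k ^+ 2 = s ^+ 2 * k ^+ 2 * k' by rewrite {1}e5 {1}e5; ring.
  have d2 : l' - l - t * l ^+ 2 = t ^+ 2 * l ^+ 2 * l' by rewrite {1}e6 {1}e6; ring.
  have d3 : l' - l = t * (l * l') by rewrite {1}e6; ring.
  have -> : k' * l' = (k' - k - s * k ^+ 2) * l' + k * (l' - l - t * l ^+ 2) + s * k ^+ 2 * (l' - l)
    + s * (k ^+ 2 * l) + t * (k * l ^+ 2) + k * l by ring.
  by rewrite d1 d2 d3; ring.
have alg (x y z v : C) : x + s * y + t * z + 1 * v - v - (y * s + z * t) = x by ring.
by rewrite e3 e2 e1; apply: alg.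
Qed.
End CauchyFunctional.

(** * Vectors and derivatives in dimension two *)

Lemma ord2P (P : 'I_2 -> Prop) : P 0 -> P 1 -> forall k, P k.
Proof.
move=> h0 h1; case=> [[|[|//]] hk].
- by rewrite (_ : Ordinal hk = 0) //; apply: val_inj.
- by rewrite (_ : Ordinal hk = 1) //; apply: val_inj.
Qed.

Section Vectors.
Variable R : realType.
Local Notation C := R[i].
Local Notation K2 := 'cV[C]_2.
Local Notation KV := 'cV[(R[i] : numFieldType)]_2.
Implicit Types (v w : K2) (F : K2 -> K2) (A : 'M[C]_2).

(** The sup norm, which norm_mdv identifies with the norm of column vectors. *)
Definition mdv v : R := Num.max (md (v 0 0)) (md (v 1 0)).

Definition vec (a b : C) : K2 := \col_(i < 2) (if i == 0 then a else b).

Lemma vec0E a b : vec a b 0 0 = a. Proof. by rewrite mxE. Qed.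
Lemma vec1E a b : vec a b 1 0 = b. Proof. by rewrite mxE. Qed.

Lemma vecP v w : v 0 0 = w 0 0 -> v 1 0 = w 1 0 -> v = w.
Proof. by move=> h0 h1; apply/matrixP => i j; rewrite (ord1 j); move: i; apply: ord2P. Qed.

Lemma vec_eta v : v = vec (v 0 0) (v 1 0).
Proof. by apply: vecP; rewrite ?vec0E ?vec1E. Qed.

Lemma coordE v k : (if k == 0 then v 0 0 else v 1 0) = v k 0.
Proof. by move: k; apply: ord2P. Qed.

Lemma mdv_ge0 v : 0 <= mdv v. Proof. by rewrite le_max md_ge0. Qed.
Lemma mdv_le v e : (mdv v <= e) = (md (v 0 0) <= e) && (md (v 1 0) <= e).
Proof. by rewrite ge_max. Qed.
Lemma mdv_lt v e : (mdv v < e) = (md (v 0 0) < e) && (md (v 1 0) < e).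
Proof. by rewrite gt_max. Qed.
Lemma mdv_entry v i : md (v i 0) <= mdv v.
Proof. by move: i; apply: ord2P; rewrite le_max lexx ?orbT. Qed.
Lemma mdv0 : mdv 0 = 0. Proof. by rewrite /mdv !mxE md0 maxxx. Qed.
Lemma mdvD v w : mdv (v + w) <= mdv v + mdv w.
Proof.
by rewrite mdv_le !mxE; apply/andP; split; apply: le_trans (mdD _ _) _;
  rewrite lerD ?mdv_entry.
Qed.
Lemma mdvN v : mdv (- v) = mdv v. Proof. by rewrite /mdv !mxE !mdN. Qed.
Lemma mdvZ c v : mdv (c *: v) = md c * mdv v.
Proof. by rewrite /mdv !mxE !mdM maxr_pMr ?md_ge0. Qed.
Lemma mdv_eq0 v : mdv v <= 0 -> v = 0.
Proof.
rewrite mdv_le => /andP[h0 h1].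
by apply: vecP; rewrite mxE; apply/eqP; rewrite -md_eq0 eq_le md_ge0 andbT.
Qed.

(** Larger than the operator norm for mdv, and simpler to handle. *)
Definition opn A : R := md (A 0 0) + md (A 0 1) + md (A 1 0) + md (A 1 1).

Lemma opn_ge0 A : 0 <= opn A. Proof. by rewrite !addr_ge0 ?md_ge0. Qed.

Lemma mul2E A v i : (A *m v) i 0 = A i 0 * v 0 0 + A i 1 * v 1 0.
Proof.
rewrite mxE !big_ord_recl big_ord0 addr0.
by congr (_ + A i _ * v _ 0); apply: val_inj.
Qed.

Lemma vecBE v w i : (v - w) i 0 = v i 0 - w i 0. Proof. by rewrite !mxE. Qed.
Lemma vecDE v w i : (v + w) i 0 = v i 0 + w i 0. Proof. by rewrite !mxE. Qed.

Lemma mdv_mul A v : mdv (A *m v) <= opn A * mdv v.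
Proof.
rewrite mdv_le !mul2E /opn.
have h0 := mdv_entry v 0; have h1 := mdv_entry v 1.
have := md_ge0 (A 0 0); have := md_ge0 (A 0 1); have := md_ge0 (A 1 0); have := md_ge0 (A 1 1).
move=> ? ? ? ?; have v0 := mdv_ge0 v; have := md_ge0 (v 0 0); have := md_ge0 (v 1 0) => ? ?.
apply/andP; split; apply: le_trans (mdD _ _) _; rewrite !mdM.
- apply: (@le_trans _ _ (md (A 0 0) * mdv v + md (A 0 1) * mdv v)); last nra.
  by apply: lerD; rewrite ler_wpM2l.
- apply: (@le_trans _ _ (md (A 1 0) * mdv v + md (A 1 1) * mdv v)); last nra.
  by apply: lerD; rewrite ler_wpM2l.
Qed.

Lemma norm_entry v i : `|v i 0| <= `|v|.
Proof.
rewrite {2}/Num.Def.normr /= mx_normE.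
rewrite -[leLHS]nngE num_le.
exact: (@le_bigmax _ _ _ _ _ (i, ord0)).
Qed.

Lemma norm_mdv v : `|v| = (mdv v)%:C.
Proof.
have [->|v0] := eqVneq v 0; first by rewrite normr0 mdv0.
have nv0 : mx_norm v != 0 by apply: contra v0 => /eqP/mx_norm_eq0 ->.
have [[i j] /=] := mx_norm_neq0 nv0; rewrite (ord1 j) => e.
have e' : `|v| = (md (v i 0))%:C by rewrite -normC_md -e.
rewrite e'; congr (_%:C); apply/eqP; rewrite eq_le mdv_entry mdv_le.
by rewrite -!lecR -e' -!normC_md !norm_entry.
Qed.

Lemma nearP (x : K2) (P : K2 -> Prop) :
  (\forall z \near (x : KV), P z) <-> exists2 e : R, 0 < e & forall z, mdv (z - x) < e -> P z.
Proof.
split.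
  move=> /nbhs_normP [e /= e0 he]; exists (complex.Re e).
    by move: e0; rewrite ltcE => /andP[].
  move=> z hz; apply: he => /=; rewrite distrC norm_mdv ltcE /=.
  move: e0; rewrite ltcE => /andP[/eqP h _].
  by rewrite hz andbT h.
move=> [e e0 he]; apply/nbhs_normP; exists (e%:C); first by rewrite /= ltcR.
by move=> z /=; rewrite distrC norm_mdv ltcR => /he.
Qed.

Lemma near0P (P : K2 -> Prop) :
  (\forall z \near (0 : KV), P z) <-> exists2 e : R, 0 < e & forall z, mdv z < e -> P z.
Proof. by rewrite nearP; split=> -[e e0 h]; exists e => // z; have := h z; rewrite subr0. Qed.

(** Differentiability at x with derivative A, spelled out; frechet_diff and diff_frechet
    relate it to differentiable. *)
Definition frechet F (x : K2) (A : 'M[C]_2) := forall e : R, 0 < e ->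
  exists2 d : R, 0 < d & forall h, mdv h < d ->
    mdv (F (h + x) - F x - A *m h) <= e * mdv h.

Lemma mulmx_continuous (A : 'M[C]_2) : continuous (mulmx A : KV -> KV).
Proof.
move=> x P /(nearP (A *m x) P).1 [e e0 he].
have hA := opn_ge0 A.
apply/(nearP x _).2; exists (e / (opn A + 1)); first by rewrite divr_gt0 //; lra.
move=> z; rewrite ltr_pdivlMr; last lra.
move=> hz; apply: he; rewrite -mulmxBr; apply: le_lt_trans (mdv_mul _ _) _.
by have := mdv_ge0 (z - x); nra.
Qed.

Lemma frechet_littleo F x A : frechet F x A <->
  F \o shift x = cst (F x) + (mulmx A : K2 -> K2) +o_ (0 : KV) id.
Proof.
split.
- move=> h; apply/eqaddoP => e e0.
  have er : e = (complex.Re e)%:C by rewrite RRe_real // gtr0_real.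
  have re0 : 0 < complex.Re e by rewrite -ltcR -er.
  have [d d0 hd] := h _ re0; apply/near0P; exists d => // z /hd hz.
  rewrite norm_mdv er; have -> : `|id z| = (mdv z)%:C by exact: norm_mdv.
  rewrite -rmorphM /= lecR; move: hz.
  by rewrite -[X in _ -> mdv X <= _]/(F (z + x) - (F x + A *m z)) opprD addrA.
- move=> /eqaddoP h e e0.
  have eC : 0 < e%:C by rewrite ltcR.
  have [d d0 hd] := (near0P _).1 (h _ eC).
  exists d => // z /hd.
  rewrite norm_mdv; have -> : `|id z| = (mdv z)%:C by exact: norm_mdv.
  rewrite -rmorphM /= lecR.
  by rewrite -[X in mdv X <= _ -> _]/(F (z + x) - (F x + A *m z)) opprD addrA.
Qed.

Lemma frechet_diff F x A : frechet F x A ->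
  differentiable (F : KV -> KV) (x : KV) /\
  forall v, 'd (F : KV -> KV) (x : KV) v = A *m v :> K2.
Proof.
move=> /frechet_littleo h.
have hd := diff_unique (@mulmx_continuous A) h.
split; last by move=> v; rewrite hd.
apply/diff_locallyP; rewrite hd; split=> //.
exact: mulmx_continuous.
Qed.

(** The same formula as jac, at an arbitrary point. *)
Definition diffmx F x : 'M[C]_2 :=
  \matrix_(i < 2, j < 2) ('d (F : KV -> KV) (x : KV) (delta_mx j 0 : KV) : KV) i 0.

Lemma diff_frechet F x : differentiable (F : KV -> KV) (x : KV) -> frechet F x (diffmx F x).
Proof.
move=> hF; apply/frechet_littleo; have := diff_locally hF.
suff -> : 'd (F : KV -> KV) (x : KV) = (mulmx (diffmx F x) : KV -> KV) :> (KV -> KV) by [].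
apply/funext => v.
have ev : v = v 0 0 *: delta_mx 0 0 + v 1 0 *: delta_mx 1 0.
  by apply: vecP; rewrite !mxE /= ?(mulr1, mulr0, addr0, add0r).
have lin : 'd (F : KV -> KV) (x : KV) v = v 0 0 *: 'd (F : KV -> KV) (x : KV) (delta_mx 0 0) +
    v 1 0 *: 'd (F : KV -> KV) (x : KV) (delta_mx 1 0).
  by rewrite {1}ev linearD !linearZ.
by rewrite lin; apply: vecP; rewrite mul2E !mxE mulrC; congr (_ + _); rewrite mulrC.
Qed.

Lemma frechet_unique F x A B : frechet F x A -> frechet F x B -> A = B.
Proof.
move=> /frechet_diff [_ hA] /frechet_diff [_ hB].
apply/matrixP => i j.
have E (M : 'M[C]_2) : M i j = (M *m (delta_mx j 0 : K2)) i 0.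
  by rewrite -colE mxE.
by rewrite (E A) (E B) -hA -hB.
Qed.

Lemma frechet_jac F A : frechet F 0 A -> jac F = A.
Proof.
move=> h; have [hd _] := frechet_diff h.
exact: frechet_unique (diff_frechet hd) h.
Qed.

End Vectors.

(** * Taylor expansions of holomorphic maps *)

Section Expansion.
Variable R : realType.
Local Notation C := R[i].
Local Notation K2 := 'cV[C]_2.
Local Notation KV := 'cV[(R[i] : numFieldType)]_2.
Implicit Types (F : K2 -> K2).

Lemma cdiff_scale (f : C -> C) r a : cdiff f (r * a) -> cdiff (fun z => f (r * z)) a.
Proof.
move=> [l hl]; have [->|r0] := eqVneq r 0.
  exists 0 => e e0; exists 1 => // z _.
  by rewrite !mul0r subrr subr0 md0 mulr_ge0 ?md_ge0 // ltW.
have mr : 0 < md r by rewrite md_gt0.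
exists (l * r) => e e0; have e1 : 0 < e / md r by rewrite divr_gt0.
have [d d0 hd] := hl _ e1; exists (d / md r); first by rewrite divr_gt0.
move=> z; rewrite ltr_pdivlMr // mulrC -mdM mulrBr => /hd.
have -> : e * md (z - a) = e / md r * md (r * z - r * a).
  by rewrite -mulrBr mdM; field; rewrite gt_eqF.
by rewrite -mulrBr -[l * r * _]mulrA.
Qed.

Lemma frechet_cdiff1 F a b A i : frechet F (vec a b) A ->
  cdiff (fun z => F (vec z b) i 0) a.
Proof.
move=> h; exists (A i 0) => e e0; have [d d0 hd] := h e e0; exists d => // z zd.
have hm : mdv (vec (z - a) 0) = md (z - a).
  by rewrite /mdv vec0E vec1E md0 max_l ?md_ge0.
have := hd (vec (z - a) 0); rewrite hm => /(_ zd).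
have -> : vec (z - a) 0 + vec a b = vec z b.
  by apply: vecP; rewrite mxE !(vec0E, vec1E) ?subrK ?add0r.
move=> h1; apply: le_trans h1; apply: le_trans (mdv_entry _ i).
by rewrite !vecBE mul2E vec0E vec1E mulr0 addr0.
Qed.

Lemma frechet_cdiff2 F a b A i : frechet F (vec a b) A ->
  cdiff (fun w => F (vec a w) i 0) b.
Proof.
move=> h; exists (A i 1) => e e0; have [d d0 hd] := h e e0; exists d => // z zd.
have hm : mdv (vec 0 (z - b)) = md (z - b).
  by rewrite /mdv vec0E vec1E md0 max_r ?md_ge0.
have := hd (vec 0 (z - b)); rewrite hm => /(_ zd).
have -> : vec 0 (z - b) + vec a b = vec a z.
  by apply: vecP; rewrite mxE !(vec0E, vec1E) ?subrK ?add0r.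
move=> h1; apply: le_trans h1; apply: le_trans (mdv_entry _ i).
by rewrite !vecBE mul2E vec0E vec1E mulr0 add0r.
Qed.

Lemma bigsq_md z : bigsq z -> md (z : C) <= 2.
Proof.
move=> /andP[/andP[h1 h2] /andP[h3 h4]]; apply: le_trans (ler_ReIm _) _.
have -> : (2 : R) = 1 + 1 by ring.
by apply: lerD; rewrite ler_norml; apply/andP; lra.
Qed.

Lemma frechet_bounded F A : frechet F 0 A -> exists2 d, 0 < d &
  forall z, mdv z < d -> mdv (F z) <= mdv (F 0) + (opn A + 1) * d.
Proof.
move=> h; have [d d0 hd] := h 1 ltr01; exists d => // z zd.
have := hd z zd; rewrite addr0 mul1r => h1.
have -> : F z = F 0 + (A *m z + (F z - F 0 - A *m z)).
  by apply/matrixP => i j; rewrite !mxE; ring.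
apply: le_trans (mdvD _ _) _; rewrite lerD2l; apply: le_trans (mdvD _ _) _.
have := mdv_mul A z; have := opn_ge0 A; have := mdv_ge0 z; nra.
Qed.

(** Cauchy's estimates together with geometric convergence of the square partial sums on
    half the radius: what is retained of a holomorphic function of two variables. *)
Definition expansion (rho M : R) (c : nat -> nat -> C) (f : C -> C -> C) :=
  (forall m n, md (c m n) <= M / rho ^+ (m + n)) /\
  forall a b N, md a <= rho / 2 -> md b <= rho / 2 ->
    md (f a b - psum c N a b) <= M / 2 ^+ N.

(** After rescaling, Cauchy's formula holds on the square [-1, 1]^2, which lies in the
    disc of radius 2. *)
Lemma expand_bounded (f : C -> C -> C) rho M : 0 < rho ->
  (forall a b, md a <= 2 * rho -> md b <= 2 * rho ->
    [/\ cdiff (fun z => f z b) a, cdiff (fun w => f a w) b & md (f a b) <= M]) ->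
  exists c, expansion rho (48 * M) c f.
Proof.
move=> r0 hf.
have rC : rho%:C != 0 :> C by rewrite -md_gt0 md_real normr_gt0 gt_eqF.
have mr : md (rho%:C : C) = rho by rewrite md_real gtr0_norm.
pose g z w := f (rho%:C * z) (rho%:C * w).
have sc z : bigsq z -> md (rho%:C * z) <= 2 * rho.
  by move=> /bigsq_md h; rewrite mdM mr mulrC ler_wpM2r // ltW.
have hM z w : bigsq z -> bigsq w -> md (g z w) <= M.
  by move=> /sc hz /sc hw; have [] := hf _ _ hz hw.
have gM : bd2 g M by move=> z w /gam_bigsq hz /gam_bigsq hw; apply: hM.
have M0 := bd2_ge0 gM.
exists (fun m n => coef g m n / rho%:C ^+ (m + n)); split.
  move=> m n; rewrite mdM mdV mdX mr ler_wpM2r ?invr_ge0 ?exprn_ge0 ?(ltW r0) //.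
  by apply: le_trans (coef_bound m n gM) _; lra.
move=> a b N ha hb.
have ha' : md (a / rho%:C) <= 2^-1.
  by rewrite mdM mdV mr ler_pdivrMr // mulrC.
have hb' : md (b / rho%:C) <= 2^-1.
  by rewrite mdM mdV mr ler_pdivrMr // mulrC.
have e (x : C) : rho%:C * (x / rho%:C) = x by field.
have -> : f a b = g (a / rho%:C) (b / rho%:C) by rewrite /g !e.
have -> : psum (fun m n => coef g m n / rho%:C ^+ (m + n)) N a b =
  psum (coef g) N (a / rho%:C) (b / rho%:C).
  apply: eq_bigr => m _; apply: eq_bigr => n _.
  by rewrite !expr_div_n exprD invfM; ring.
apply: (@taylor_rem _ g N M _ _ gM ha' hb').
apply: (@cauchy2 _ g M) => //.
- by move=> z w /sc hz /sc hw; apply: (@cdiff_scale (fun z => f z (rho%:C * w))); have [] := hf _ _ hz hw.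
- by move=> z w /sc hz /sc hw; apply: (@cdiff_scale (fun w => f (rho%:C * z) w)); have [] := hf _ _ hz hw.
Qed.

Lemma holo_expand F e0 : 0 < e0 ->
  (forall z, mdv z < e0 -> exists A, frechet F z A) ->
  exists rho M (c : 'I_2 -> nat -> nat -> C), [/\ 0 < rho, rho <= e0, 0 < M &
    forall i, expansion rho M (c i) (fun a b => F (vec a b) i 0)].
Proof.
move=> e00 hF; have [|A hA] := hF 0; first by rewrite mdv0.
have [d d0 hd] := frechet_bounded hA.
set M := mdv (F 0) + _ in hd.
have M0 : 0 <= M by apply: le_trans (mdv_ge0 (F 0)) (hd 0 _); rewrite mdv0.
(* expansions are read off on the disc of radius 2 rho, hence the factor 4 *)
pose rho := Num.min e0 d / 4.
have r0 : 0 < rho by rewrite divr_gt0 // lt_min e00.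
have small a b : md a <= 2 * rho -> md b <= 2 * rho -> mdv (vec a b) < Num.min e0 d.
  move=> ha hb; rewrite mdv_lt vec0E vec1E.
  by apply/andP; split; rewrite /rho in r0 ha hb *; lra.
have h i : exists c, expansion rho (48 * M) c (fun a b => F (vec a b) i 0).
  apply: expand_bounded => // a b ha hb; have := small a b ha hb.
  rewrite lt_min => /andP[/hF [B hB] /hd hd']; split.
  - exact: frechet_cdiff1 hB.
  - exact: frechet_cdiff2 hB.
  - exact: le_trans (mdv_entry _ _) hd'.
have [c0 hc0] := h 0; have [c1 hc1] := h 1.
have grow c f : expansion rho (48 * M) c f -> expansion rho (48 * M + 1) c f.
  move=> [h1 h2]; split=> [m n|a b N ha hb].
    by apply: le_trans (h1 m n) _; rewrite ler_wpM2r ?invr_ge0 ?exprn_ge0 ?(ltW r0) // lerDl.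
  by apply: le_trans (h2 a b N ha hb) _; rewrite ler_wpM2r ?invr_ge0 ?exprn_ge0 // lerDl.
exists rho, (48 * M + 1), (fun i => if i == 0 then c0 else c1); split=> //.
- have : Num.min e0 d <= e0 by rewrite ge_min lexx.
  by rewrite /rho in r0 *; lra.
- by lra.
by apply: ord2P; apply: grow.
Qed.

(** Cauchy's formula passes to uniform limits, and functions given by it are
    differentiable (Weierstrass). The remainder is uniform, so that partial
    differentiability of the p N yields a total derivative of f. *)
Lemma limit_diff (p : nat -> C -> C -> C) f rho K M : 0 < rho ->
  (forall N a b, cdiff (fun z => p N z b) a /\ cdiff (fun w => p N a w) b) ->
  (forall N a b, md a <= 2 * rho -> md b <= 2 * rho -> md (f a b - p N a b) <= K / 2 ^+ N) ->
  (forall a b, md a <= 2 * rho -> md b <= 2 * rho -> md (f a b) <= M) ->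
  exists K', forall a b, md a <= rho / 4 -> md b <= rho / 4 -> exists u v, forall s t,
    md s <= rho / 4 -> md t <= rho / 4 ->
    md (f (a + s) (b + t) - f a b - (u * s + v * t)) <= K' * (md s + md t) ^+ 2.
Proof.
move=> r0 hp hK hM.
have rC : rho%:C != 0 :> C by rewrite -md_gt0 md_real normr_gt0 gt_eqF.
have mr : md (rho%:C : C) = rho by rewrite md_real gtr0_norm.
pose g z w := f (rho%:C * z) (rho%:C * w).
have sc z : bigsq z -> md (rho%:C * z) <= 2 * rho.
  by move=> /bigsq_md h; rewrite mdM mr mulrC ler_wpM2r // ltW.
have gM : bd2 g M by move=> z w /gam_bigsq /sc hz /gam_bigsq /sc hw; apply: hM.
have rep a b : md a <= 2^-1 -> md b <= 2^-1 ->
    g a b = LL (fun z w => g z w * kern a b z w).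
  move=> ha hb; apply/eqP; rewrite -subr_eq0 -md_eq0; apply/eqP.
  apply: (@le_geom0 _ _ (17 * K)); first exact: md_ge0.
  move=> N; pose q z w := p N (rho%:C * z) (rho%:C * w).
  have qg z w : bigsq z -> bigsq w -> md (g z w - q z w) <= K / 2 ^+ N.
    by move=> /sc hz /sc hw; apply: hK.
  have qM z w : bigsq z -> bigsq w -> md (q z w) <= M + K / 2 ^+ N.
    move=> hz hw; have -> : q z w = g z w - (g z w - q z w) by ring.
    by apply: le_trans (mdBD _ _) _; apply: lerD; [apply: hM; apply: sc|apply: qg].
  have qrep : q a b = LL (fun z w => q z w * kern a b z w).
    apply: (@cauchy2 _ q (M + K / 2 ^+ N)) => //.
    - by move=> z w _ _; apply: (@cdiff_scale (fun z => p N z (rho%:C * w))); have [] := hp N (rho%:C * z) (rho%:C * w).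
    - by move=> z w _ _; apply: (@cdiff_scale (fun w => p N (rho%:C * z) w)); have [] := hp N (rho%:C * z) (rho%:C * w).
  have kb := kern_bound ha hb.
  have qM' : bd2 q (M + K / 2 ^+ N) by move=> z w /gam_bigsq hz /gam_bigsq hw; apply: qM.
  have -> : g a b - LL (fun z w => g z w * kern a b z w) = (g a b - q a b) +
     LL (fun z w => q z w * kern a b z w + -1 * (g z w * kern a b z w)).
    by rewrite (LL_lin _ (bd2M qM' kb) (bd2M gM kb)) -qrep; ring.
  have -> : 17 * K / 2 ^+ N = K / 2 ^+ N + 4 * (K / 2 ^+ N * 4) by ring.
  apply: le_trans (mdD _ _) _; apply: lerD.
    by apply: qg; apply: bigsq_small.
  apply: LL_bound => z w gz gw.
  have -> : q z w * kern a b z w + -1 * (g z w * kern a b z w) =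
    - (g z w - q z w) * kern a b z w by ring.
  by rewrite mdM mdN ler_pM ?md_ge0 ?qg ?kb // gam_bigsq.
exists (64 * M / rho ^+ 2) => a b ha hb.
have sm x y : md x <= rho / 4 -> md y <= rho / 4 -> md (x / rho%:C + y / rho%:C) <= 2^-1.
  move=> hx hy; rewrite -mulrDl mdM mdV mr ler_pdivrMr //.
  by apply: le_trans (mdD _ _) _; lra.
have sm1 x : md x <= rho / 4 -> md (x / rho%:C) <= 2^-1.
  by move=> hx; rewrite mdM mdV mr ler_pdivrMr //; lra.
have [u [v huv]] := cauchy_rep_diff gM rep (sm1 _ ha) (sm1 _ hb).
exists (u / rho%:C), (v / rho%:C) => s t hs ht.
have := huv (s / rho%:C) (t / rho%:C) (sm _ _ ha hs) (sm _ _ hb ht).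
have e (x : C) : rho%:C * (x / rho%:C) = x by field.
rewrite /g !mulrDr !e !mdM !mdV mr.
have -> : (md s / rho + md t / rho) ^+ 2 = (md s + md t) ^+ 2 / rho ^+ 2.
  by rewrite -mulrDl expr_div_n.
have -> : u / rho%:C * s + v / rho%:C * t = u * (s / rho%:C) + v * (t / rho%:C) by ring.
have -> : 64 * M * ((md s + md t) ^+ 2 / rho ^+ 2) = 64 * M / rho ^+ 2 * (md s + md t) ^+ 2.
  by rewrite mulrA [RHS]mulrAC.
by [].
Qed.

End Expansion.

(** * Weighted norms of bivariate polynomials *)

Section BivariatePolynomials.
Variable R : realType.
Local Notation C := R[i].
Local Notation P2 := {poly {poly C}}.
Implicit Types (p q : P2) (w : nat -> nat -> R).

(** Polynomials in two variables are polynomials in the first variable whose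
    coefficients are polynomials in the second. *)
Definition cf p i j : C := p`_i`_j.
Definition ev p (a b : C) : C := p.[a%:P].[b].

Lemma cf_inj p q : (forall i j, cf p i j = cf q i j) -> p = q.
Proof. by move=> h; apply/polyP => i; apply/polyP => j; apply: h. Qed.
Lemma cfD p q i j : cf (p + q) i j = cf p i j + cf q i j.
Proof. by rewrite /cf !coefD. Qed.
Lemma cfB p q i j : cf (p - q) i j = cf p i j - cf q i j.
Proof. by rewrite /cf !coefB. Qed.
Lemma cf0 i j : cf 0 i j = 0. Proof. by rewrite /cf !coef0. Qed.
Lemma cfZ c p i j : cf (c%:P%:P * p) i j = c * cf p i j.
Proof. by rewrite /cf !coefCM. Qed.
Lemma cf_sum I (r : seq I) (P : pred I) (F : I -> P2) i j :
  cf (\sum_(k <- r | P k) F k) i j = \sum_(k <- r | P k) cf (F k) i j.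
Proof. by rewrite /cf !coef_sum. Qed.
Lemma cfM p q i j : cf (p * q) i j =
  \sum_(k < i.+1) \sum_(l < j.+1) cf p k l * cf q (i - k) (j - l).
Proof. by rewrite /cf coefM coef_sum; apply: eq_bigr => k _; rewrite coefM. Qed.
Lemma evD p q a b : ev (p + q) a b = ev p a b + ev q a b.
Proof. by rewrite /ev !hornerD. Qed.
Lemma evM p q a b : ev (p * q) a b = ev p a b * ev q a b.
Proof. by rewrite /ev !hornerM. Qed.
Lemma evX p n a b : ev (p ^+ n) a b = ev p a b ^+ n.
Proof. by rewrite /ev !horner_exp. Qed.
Lemma evC c a b : ev c%:P%:P a b = c. Proof. by rewrite /ev !hornerC. Qed.
Lemma evB p q a b : ev (p - q) a b = ev p a b - ev q a b.
Proof. by rewrite /ev !hornerD !hornerN. Qed.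
Lemma ev_sum I (r : seq I) (P : pred I) (F : I -> P2) a b :
  ev (\sum_(k <- r | P k) F k) a b = \sum_(k <- r | P k) ev (F k) a b.
Proof. by rewrite /ev !horner_sum. Qed.

Lemma cdiff_ev1 p b a : cdiff (fun z => ev p z b) a.
Proof.
have -> : (fun z => ev p z b) = (fun z => (map_poly (horner_eval b) p).[z]).
  apply/funext => z; rewrite /ev -[X in _ = _.[X]](hornerC z b).
  by rewrite -[_.[b]]/(horner_eval b (z%:P)) horner_map.
exact: cdiff_horner.
Qed.

Lemma cdiff_ev2 p a b : cdiff (fun z => ev p a z) b.
Proof. exact: cdiff_horner. Qed.

(** A common bound for the exponents of both variables. *)
Definition deg2 p := maxn (size p) (\max_(i < size p) size (p`_i)%R).

Lemma ev_coefs p N a b : (deg2 p <= N)%N ->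
  ev p a b = \sum_(i < N) \sum_(j < N) cf p i j * (a ^+ i * b ^+ j).
Proof.
move=> hN; have hs : (size p <= N)%N by apply: leq_trans hN; rewrite leq_maxl.
rewrite /ev (horner_coef_wide _ hs) horner_sum; apply: eq_bigr => i _.
rewrite hornerM -rmorphXn /= hornerC.
have hi : (size (p`_i)%R <= N)%N.
  have [hi|hi] := leqP (size p) i; first by rewrite (nth_default 0 hi) size_poly0.
  apply: leq_trans hN; rewrite leq_max; apply/orP; right.
  exact: (leq_bigmax (F := fun i : 'I_(size p) => size (p`_i)%R) (Ordinal hi)).
rewrite (horner_coef_wide _ hi) mulr_suml; apply: eq_bigr => j _.
by rewrite /cf; ring.
Qed.

(** The weighted l^1 norm of p is at most B. Quantifying over all N spares the choice of
    a box containing the support. *)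
Definition nle w p B := forall N, \sum_(i < N) \sum_(j < N) md (cf p i j) * w i j <= B.

Definition cfree p := cf p 0 0 = 0.

Lemma nle_le w p B B' : nle w p B -> B <= B' -> nle w p B'.
Proof. by move=> h hB N; apply: le_trans (h N) hB. Qed.

Lemma nleD w p q A B : (forall i j, 0 <= w i j) -> nle w p A -> nle w q B -> nle w (p + q) (A + B).
Proof.
move=> w0 hp hq N; apply: le_trans (lerD (hp N) (hq N)).
rewrite -big_split; apply: ler_sum => i _; rewrite -big_split; apply: ler_sum => j _ /=.
by rewrite cfD -mulrDl ler_wpM2r // mdD.
Qed.

Lemma nleB w p q A B : (forall i j, 0 <= w i j) -> nle w p A -> nle w q B -> nle w (p - q) (A + B).
Proof.
move=> w0 hp hq N; apply: le_trans (lerD (hp N) (hq N)).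
rewrite -big_split; apply: ler_sum => i _; rewrite -big_split; apply: ler_sum => j _ /=.
by rewrite cfB -mulrDl ler_wpM2r // mdBD.
Qed.

Lemma nleZ w c p A : nle w p A -> nle w (c%:P%:P * p) (md c * A).
Proof.
move=> hp N; apply: le_trans (ler_wpM2l (md_ge0 c) (hp N)).
rewrite mulr_sumr; apply: ler_sum => i _; rewrite mulr_sumr; apply: ler_sum => j _.
by rewrite cfZ mdM mulrA.
Qed.

Lemma nle0 w : nle w 0 0.
Proof. by move=> N; rewrite big1 // => i _; rewrite big1 // => j _; rewrite cf0 md0 mul0r. Qed.

Lemma nle_sum w n (F : 'I_n -> P2) (B : 'I_n -> R) : (forall i j, 0 <= w i j) ->
  (forall i, nle w (F i) (B i)) -> nle w (\sum_(i < n) F i) (\sum_(i < n) B i).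
Proof.
move=> w0 h; elim: n F B h => [|n IH] F B h; first by rewrite !big_ord0; apply: nle0.
by rewrite !big_ord_recr /=; apply: nleD => //; apply: IH.
Qed.

(** The constant terms are left out, because a small divisor is attached to products of
    factors of positive degree only. *)
Definition submul w (w' : nat -> nat -> R) := forall i j k l, (0 < i + j)%N -> (0 < k + l)%N ->
  w' (i + k)%N (j + l)%N <= w i j * w k l.

Lemma big_triangle (N : nat) (F : nat -> nat -> R) : (forall i k, 0 <= F i k) ->
  \sum_(i < N) \sum_(k < i.+1) F k (i - k)%N <= \sum_(k < N) \sum_(l < N) F k l.
Proof.
move=> F0.
have -> : \sum_(i < N) \sum_(k < i.+1) F k (i - k)%N =
    \sum_(i < N) \sum_(k < N | (k <= i)%N) F k (i - k)%N.
  apply: eq_bigr => i _; rewrite (big_ord_widen N (fun k => F k (i - k)%N)) //.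
rewrite (exchange_big_dep predT) //=; apply: ler_sum => k _.
have h : \sum_(i < N | (k <= i)%N) F k (i - k)%N = \sum_(0 <= l < N - k) F k l.
  rewrite -(big_mkord (fun i => (k <= i)%N) (fun i => F k (i - k)%N)).
  rewrite (big_cat_nat (n := k)) ?leq0n ?(ltnW (ltn_ord k)) //=.
  rewrite big_nat_cond big1 ?add0r; last by move=> i /andP[/andP[_ h1] h2]; move: h1; rewrite ltnNge h2.
  rewrite -{1}[nat_of_ord k]add0n big_addn.
  rewrite big_mkcond; apply: eq_bigr => i _; rewrite leq_addl addnK //.
rewrite h -(big_mkord predT (fun l => F k l)) [leRHS](big_cat_nat (n := (N - k)%N)) ?leq_subr //=.
by rewrite lerDl; apply: sumr_ge0.
Qed.

(** For submultiplicative weights the weighted l^1 norm is an algebra norm, on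
    polynomials without constant term. *)
Lemma nle_mul w w' p q A B : (forall i j, 0 <= w i j) -> (forall i j, 0 <= w' i j) ->
  submul w w' -> cfree p -> cfree q ->
  nle w p A -> nle w q B -> nle w' (p * q) (A * B).
Proof.
move=> w0 w'0 hw hp hq hA hB N.
pose P i j := md (cf p i j) * w i j; pose Q i j := md (cf q i j) * w i j.
have P0 i j : 0 <= P i j by rewrite mulr_ge0 ?md_ge0.
have Q0 i j : 0 <= Q i j by rewrite mulr_ge0 ?md_ge0.
apply: (@le_trans _ _ (\sum_(i < N) \sum_(j < N) \sum_(k < i.+1) \sum_(l < j.+1)
    P k l * Q (i - k)%N (j - l)%N)).
  apply: ler_sum => i _; apply: ler_sum => j _; rewrite cfM.
  apply: (@le_trans _ _ ((\sum_(k < i.+1) \sum_(l < j.+1) md (cf p k l * cf q (i - k) (j - l))) * w' i j)).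
    rewrite ler_wpM2r //; apply: le_trans (md_sum _ _ _) _; apply: ler_sum => k _.
    exact: md_sum.
  rewrite mulr_suml; apply: ler_sum => k _; rewrite mulr_suml; apply: ler_sum => l _.
  have [kl|kl] := posnP (k + l)%N.
    move: kl => /eqP; rewrite addn_eq0 => /andP[/eqP -> /eqP ->].
    by rewrite hp mul0r md0 mul0r mulr_ge0.
  have [kl'|kl'] := posnP ((i - k) + (j - l))%N.
    move: kl' => /eqP; rewrite addn_eq0 => /andP[/eqP -> /eqP ->].
    by rewrite hq mulr0 md0 mul0r mulr_ge0.
  have hk : (k <= i)%N by rewrite -ltnS ltn_ord.
  have hl : (l <= j)%N by rewrite -ltnS ltn_ord.
  have := hw _ _ _ _ kl kl'; rewrite (subnKC hk) (subnKC hl) => h.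
  rewrite mdM /P /Q mulrACA ler_wpM2l // mulr_ge0 ?md_ge0 //.
apply: (@le_trans _ _ (\sum_(k < N) \sum_(k' < N) \sum_(j < N) \sum_(l < j.+1) P k l * Q k' (j - l)%N)).
  pose F k k' := \sum_(j < N) \sum_(l < j.+1) P k l * Q k' (j - l)%N.
  have F0 k k' : 0 <= F k k' by apply: sumr_ge0 => j _; apply: sumr_ge0 => l _; rewrite mulr_ge0.
  apply: le_trans (big_triangle N F0); apply: ler_sum => i _.
  by rewrite exchange_big /=.
apply: (@le_trans _ _ ((\sum_(i < N) \sum_(j < N) P i j) * (\sum_(i < N) \sum_(j < N) Q i j))); last first.
  by apply: ler_pM; [| |exact: hA|exact: hB]; apply: sumr_ge0 => i _; apply: sumr_ge0 => j _.
rewrite mulr_suml; apply: ler_sum => k _; rewrite mulr_sumr; apply: ler_sum => k' _.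
apply: le_trans (@big_triangle N (fun l l' => P k l * Q k' l') _) _.
  by move=> l l'; rewrite mulr_ge0.
rewrite mulr_suml; apply: ler_sum => l _; rewrite mulr_sumr; apply: ler_sum => l' _ //.
Qed.

End BivariatePolynomials.

(** * Order of contact of polynomials *)

Section OrderOfVanishing.
Variable R : realType.
Local Notation C := R[i].
Local Notation P2 := {poly {poly C}}.
Implicit Types (p q : P2).

Lemma cfreeM p q : cfree p -> cfree (p * q).
Proof. by rewrite /cfree cfM !big_ord_recl !big_ord0 /= !subn0 => ->; rewrite mul0r !addr0. Qed.

Definition agree d p q := forall i j, (i + j < d)%N -> cf p i j = cf q i j.

Lemma agree_le d d' p q : (d' <= d)%N -> agree d p q -> agree d' p q.
Proof. by move=> h ha i j hij; apply: ha; apply: leq_trans h. Qed.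

Lemma agree_refl d p : agree d p p. Proof. by []. Qed.

Lemma agreeD d p q p' q' : agree d p p' -> agree d q q' -> agree d (p + q) (p' + q').
Proof. by move=> h1 h2 i j hij; rewrite !cfD h1 ?h2. Qed.

(** A factor of positive degree multiplies a difference of order d, which gains one
    order. *)
Lemma agreeM d p q p' q' : cfree p -> cfree q -> cfree p' -> cfree q' ->
  agree d p p' -> agree d q q' -> agree d.+1 (p * q) (p' * q').
Proof.
move=> hp hq hp' hq' h1 h2 i j hij; rewrite !cfM.
apply: eq_bigr => k _; apply: eq_bigr => l _.
have hk : (k <= i)%N by rewrite -ltnS ltn_ord.
have hl : (l <= j)%N by rewrite -ltnS ltn_ord.
have [kl|kl] := posnP (k + l)%N.
  move: kl => /eqP; rewrite addn_eq0 => /andP[/eqP -> /eqP ->].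
  by rewrite hp hp' !mul0r.
have [kl'|kl'] := posnP ((i - k) + (j - l))%N.
  move: kl' => /eqP; rewrite addn_eq0 => /andP[/eqP -> /eqP ->].
  by rewrite hq hq' !mulr0.
have e : ((k + l) + ((i - k) + (j - l)) = i + j)%N by rewrite addnACA !subnKC.
by rewrite h1 ?h2 //; rewrite -ltnS; apply: leq_trans hij; rewrite -e !ltnS;
  [rewrite -[X in (X < _)%N]add0n ltn_add2r | rewrite -[X in (X < _)%N]addn0 ltn_add2l].
Qed.

Definition mono (g : 'I_2 -> P2) m n := g 0 ^+ m * g 1 ^+ n.

Lemma monoSl g m n : mono g m.+1 n = g 0 * mono g m n.
Proof. by rewrite /mono exprS mulrA. Qed.

Lemma monoSr g m n : mono g m n.+1 = g 1 * mono g m n.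
Proof. by rewrite /mono exprS mulrCA. Qed.

(** Induction over the factors of a monomial of positive degree, for properties graded
    by the degree. *)
Lemma mono_split (Q : P2 -> nat -> Prop) (g : 'I_2 -> P2) : (forall j, Q (g j) 1%N) ->
  (forall p q d d', Q p d.+1 -> Q q d'.+1 -> Q (p * q) (d.+1 + d'.+1)%N) ->
  forall m n, (0 < m + n)%N -> Q (mono g m n) (m + n)%N.
Proof.
move=> h1 h2; elim=> [|m IH] n.
  elim: n => // n IH _; case: n IH => [|n] IH.
    by rewrite monoSr /mono !expr0 !mulr1; apply: h1.
  rewrite monoSr -[X in Q _ X]/(1 + (0 + n).+1)%N; apply: (h2 _ _ 0%N) => //; exact: IH.
move=> _; case: (posnP (m + n)) => [/eqP|hmn].
  rewrite addn_eq0 => /andP[/eqP -> /eqP ->].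
  by rewrite monoSl /mono !expr0 !mulr1; apply: h1.
have := IH _ hmn; rewrite monoSl addSn -(prednK hmn).
by move=> h; apply: (h2 _ _ 0%N).
Qed.

Lemma cfree_mono g m n : (forall j, cfree (g j)) -> (0 < m + n)%N -> cfree (mono g m n).
Proof.
move=> h; apply: (mono_split (Q := fun p _ => cfree p)) => //.
by move=> p q _ _ hp _; apply: cfreeM.
Qed.

(** Beyond degree one each variation is multiplied by a further factor without constant
    term. *)
Lemma agree_mono d g g' m n : (forall j, cfree (g j)) -> (forall j, cfree (g' j)) ->
  (forall j, agree d (g j) (g' j)) -> (1 < m + n)%N -> agree d.+1 (mono g m n) (mono g' m n).
Proof.
move=> hg hg' ha.
(* without the gain of one order, valid from degree one on; one more factor gives the gain *)
have weak m' n' : (0 < m' + n')%N -> agree d (mono g m' n') (mono g' m' n').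
  elim: m' => [|m' IH]; last first.
    move=> _; rewrite !monoSl; case: (posnP (m' + n')%N) => [/eqP|h].
      by rewrite addn_eq0 => /andP[/eqP -> /eqP ->]; rewrite /mono !expr0 !mulr1.
    apply: (@agree_le d.+1) => //; apply: agreeM => //; try exact: cfree_mono; exact: IH.
  elim: n' => // n' IH _; rewrite !monoSr; case: (posnP (0 + n')%N) => [/eqP|h].
    by rewrite addn_eq0 => /andP[_ /eqP ->]; rewrite /mono !expr0 !mulr1.
  by apply: (@agree_le d.+1) => //; apply: agreeM => //; try exact: cfree_mono; exact: IH.
case: m => [|m]; last first.
  by rewrite addSn ltnS !monoSl => h; apply: agreeM => //; try exact: cfree_mono; exact: weak.
case: n => // n; rewrite addnS ltnS !monoSr => h.
by apply: agreeM => //; try exact: cfree_mono; exact: weak.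
Qed.

Lemma order_mono g m n i j : (forall j, cfree (g j)) -> (i + j < m + n)%N ->
  cf (mono g m n) i j = 0.
Proof.
move=> hg h; have mn0 : (0 < m + n)%N by apply: leq_ltn_trans h.
move: i j h; apply: (mono_split (Q := fun p d => forall i j, (i + j < d)%N -> cf p i j = 0)) mn0.
  by move=> k i j; rewrite ltnS leqn0 addn_eq0 => /andP[/eqP -> /eqP ->]; apply: hg.
move=> p q d d' hp hq i j hij; rewrite cfM big1 // => k _; rewrite big1 // => l _.
have hk : (k <= i)%N by rewrite -ltnS ltn_ord.
have hl : (l <= j)%N by rewrite -ltnS ltn_ord.
have [h|h] := ltnP (k + l) d.+1; first by rewrite hp ?mul0r.
rewrite hq ?mulr0 //.
have e : ((k + l) + ((i - k) + (j - l)) = i + j)%N by rewrite addnACA !subnKC.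
rewrite -(ltn_add2l (k + l)) e; apply: leq_trans hij _.
by rewrite leq_add2r.
Qed.

(** The substitution of g into the series c truncated to the box [0, N[ x [0, N[. *)
Definition compo (c : nat -> nat -> C) N (g : 'I_2 -> P2) : P2 :=
  \sum_(m < N) \sum_(n < N) (c m n)%:P%:P * mono g m n.

Lemma ev_compo c N g a b : ev (compo c N g) a b = psum c N (ev (g 0) a b) (ev (g 1) a b).
Proof.
rewrite /compo /psum ev_sum; apply: eq_bigr => m _; rewrite ev_sum; apply: eq_bigr => n _.
by rewrite evM evC /mono evM !evX.
Qed.

Lemma cf_compo c N g i j : cf (compo c N g) i j =
  \sum_(m < N) \sum_(n < N) c m n * cf (mono g m n) i j.
Proof.
rewrite /compo cf_sum; apply: eq_bigr => m _; rewrite cf_sum; apply: eq_bigr => n _.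
by rewrite cfZ.
Qed.

Lemma order_compo c N g i j : (forall m n, (m + n < 2)%N -> c m n = 0) ->
  (forall j, cfree (g j)) -> (i + j < 2)%N -> cf (compo c N g) i j = 0.
Proof.
move=> hc hg hij; rewrite cf_compo big1 // => m _; rewrite big1 // => n _.
have [h|h] := ltnP (m + n) 2; first by rewrite hc ?mul0r.
by rewrite order_mono ?mulr0 //; apply: leq_trans h.
Qed.

(** The additional terms of the longer truncation have order at least N > d. *)
Lemma agree_compo c N d g g' : (forall m n, (m + n < 2)%N -> c m n = 0) ->
  (forall j, cfree (g j)) -> (forall j, cfree (g' j)) ->
  (forall j, agree d (g j) (g' j)) -> (d < N)%N ->
  agree d.+1 (compo c N g) (compo c N.+1 g').
Proof.
move=> hc hg hg' ha hd i j hij; rewrite !cf_compo.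
have van m n : ((m == N) || (n == N)) -> c m n * cf (mono g' m n) i j = 0.
  move=> h; rewrite order_mono ?mulr0 //; apply: leq_trans hij _; apply: leq_trans hd _.
  by case/orP: h => /eqP ->; rewrite ?leq_addr ?leq_addl.
rewrite [RHS]big_ord_recr /= [X in _ + X]big1 ?addr0; last first.
  by move=> n _; apply: van; rewrite eqxx.
apply: eq_bigr => m _; rewrite [RHS]big_ord_recr /= van ?eqxx ?orbT // addr0.
apply: eq_bigr => n _.
have [h|h] := ltnP (m + n) 2; first by rewrite hc ?mul0r.
by congr (_ * _); apply: (@agree_mono d).
Qed.

Definition Tmul (t : nat -> nat -> C) p : P2 :=
  \poly_(i < size p) \poly_(j < size (p`_i)%R) (t i j * cf p i j).

Lemma cfT t p i j : cf (Tmul t p) i j = t i j * cf p i j.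
Proof.
rewrite /cf coef_poly; case: ltnP => hi; last first.
  by rewrite (nth_default 0 hi) !coef0 mulr0.
rewrite coef_poly; case: ltnP => hj //.
by rewrite (nth_default 0 hj) mulr0.
Qed.

Lemma agreeT d t p q : agree d p q -> agree d (Tmul t p) (Tmul t q).
Proof. by move=> h i j hij; rewrite !cfT h. Qed.

End OrderOfVanishing.

(** * Picard iteration with small divisors *)

Section FormalSolution.
Variable R : realType.
Local Notation C := R[i].
Local Notation P2 := {poly {poly C}}.
Implicit Types (p q : P2).

Lemma sum_quarter N : \sum_(m < N) (4^-1 : R) ^+ m <= 4 / 3.
Proof.
have -> : \sum_(m < N) (4^-1 : R) ^+ m = 4 / 3 * (1 - 4^-1 ^+ N).
  elim: N => [|N IH]; first by rewrite big_ord0 expr0 subrr mulr0.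
  by rewrite big_ord_recr /= IH exprSr; field.
have : 0 <= (4^-1 : R) ^+ N by rewrite exprn_ge0 // invr_ge0.
lra.
Qed.

Lemma sum_geo2 N (x : R) : 0 <= x -> x <= 4^-1 ->
  \sum_(m < N) \sum_(n < N) (if (m + n < 2)%N then 0 else x ^+ (m + n)) <= 32 * x ^+ 2.
Proof.
move=> x0 x4; pose S := \sum_(m < N) (4^-1 : R) ^+ m.
have S0 : 0 <= S by apply: sumr_ge0 => m _; rewrite exprn_ge0 // invr_ge0.
apply: (@le_trans _ _ (16 * x ^+ 2 * (S * S))); last first.
  have := sum_quarter N; rewrite -/S => hS; have hx := sqr_ge0 x.
  have hSS : S * S <= 2 by nra.
  have -> : 32 * x ^+ 2 = 16 * x ^+ 2 * 2 by ring.
  by rewrite ler_wpM2l // mulr_ge0.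
rewrite /S mulr_suml mulr_sumr; apply: ler_sum => m _.
rewrite mulr_sumr mulr_sumr; apply: ler_sum => n _.
case: ltnP => h.
  by rewrite !mulr_ge0 ?sqr_ge0 ?exprn_ge0 ?invr_ge0.
rewrite -exprD -(subnKC h) !exprD.
have h1 : x ^+ (m + n - 2) <= 4^-1 ^+ (m + n - 2).
  by apply: lerXn2r; rewrite ?nnegrE ?invr_ge0.
have h2 := sqr_ge0 x.
apply: (@le_trans _ _ (x ^+ 2 * 4^-1 ^+ (m + n - 2))); first by rewrite ler_wpM2l.
by rewrite le_eqVlt; apply/orP; left; apply/eqP; field.
Qed.

(* c holds the Taylor coefficients of the nonlinearity, t the factors of the operator T;
   tsub says that the weights absorb t *)
Variables (c t : 'I_2 -> nat -> nat -> C) (w : nat -> nat -> R) (rho M kappa : R).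
Hypotheses (rho0 : 0 < rho) (M0 : 0 < M) (kappa0 : 0 < kappa).
Hypothesis cM : forall k m n, md (c k m n) <= M / rho ^+ (m + n).
Hypothesis c2 : forall k m n, (m + n < 2)%N -> c k m n = 0.
Hypothesis wk : forall i j, kappa ^+ (i + j) <= w i j.
Hypothesis wsub : submul w w.
Hypothesis tsub : forall k, submul w (fun i j => md (t k i j) * w i j).

(** Shrinking s makes the nonlinearity as small as desired while keeping the weights
    submultiplicative. *)
Definition scale_w (s : R) i j := s ^+ (i + j) * w i j.

Lemma scale_w_submul s w' : 0 < s -> submul w w' ->
  submul (scale_w s) (fun i j => s ^+ (i + j) * w' i j).
Proof.
move=> s0 h i j k l hij hkl; rewrite /scale_w.
have -> : (i + k + (j + l) = (i + j) + (k + l))%N by rewrite addnACA.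
rewrite exprD mulrACA ler_wpM2l ?h // mulr_ge0 ?exprn_ge0 // ltW //.
Qed.

Definition coord (k : 'I_2) : P2 := if k == 0 then 'X else ('X)%:P.

Lemma cf_coord k i j : cf (coord k) i j =
  if k == 0 then ((i == 1) && (j == 0))%N%:R else ((i == 0) && (j == 1))%N%:R.
Proof.
rewrite /coord; case: ifP => _; rewrite /cf.
  rewrite coefX; case: eqP => // _; last by rewrite coef0.
  by rewrite -polyC1 coefC; case: eqP.
rewrite coefC; case: eqP => //= _; last by rewrite coef0.
by rewrite coefX.
Qed.

Lemma ev_coord k a b : ev (coord k) a b = if k == 0 then a else b.
Proof. by rewrite /coord /ev; case: ifP => _; rewrite ?hornerX ?hornerC ?hornerX. Qed.

(** Picard iteration for h = id + T (f o h) where f has coefficients c and T multiplies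
    coefficients by t. The truncation at N.+2 makes every iterate a polynomial and is
    long enough for the step to agree with the next one to order N.+3. *)
Fixpoint iter_sol N (k : 'I_2) : P2 :=
  if N is N'.+1 then coord k + Tmul (t k) (compo (c k) N.+2 (iter_sol N'))
  else coord k.

Lemma cfree_iter N k : cfree (iter_sol N k).
Proof.
elim: N k => [|N IH] k /=.
  by rewrite /cfree cf_coord; case: ifP.
rewrite /cfree cfD cfT order_compo //; last exact: c2.
by rewrite mulr0 addr0 cf_coord; case: ifP.
Qed.

(** Since f has order two, substituting into it gains one order of contact. *)
Lemma agree_iter N k : agree N.+2 (iter_sol N k) (iter_sol N.+1 k).
Proof.
elim: N k => [|N IH] k.
  move=> i j hij; rewrite /= cfD cfT order_compo ?mulr0 ?addr0 //; first exact: c2.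
  by move=> k'; exact: (cfree_iter 0).
rewrite [iter_sol N.+1 k]/= [iter_sol N.+2 k]/=.
apply: agreeD; first exact: agree_refl.
apply: agreeT; apply: agree_compo => //.
- exact: c2.
- exact: cfree_iter.
- exact: (cfree_iter N.+1).
Qed.

Section Bounds.
Variable s : R.
Hypothesis s0 : 0 < s.
Let sigma := s * (w 1 0 + w 0 1).
(* sigma bounds the norm of the coordinates; the two conditions make the ball of radius
   2 sigma lie in the domain of f and stable under the iteration *)
Hypothesis hs1 : 2 * sigma / rho <= 4^-1.
Hypothesis hs2 : 128 * M * sigma <= rho ^+ 2.

Lemma w_ge0 i j : 0 <= w i j.
Proof. by apply: le_trans (wk i j); rewrite exprn_ge0 // ltW. Qed.

Lemma scale_w_ge0 i j : 0 <= scale_w s i j.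
Proof. by rewrite mulr_ge0 ?exprn_ge0 ?w_ge0 // ltW. Qed.

Lemma sigma_gt0 : 0 < sigma.
Proof.
have h1 : kappa <= w 1 0 := wk 1 0; have h2 : kappa <= w 0 1 := wk 0 1.
by rewrite /sigma mulr_gt0 //; have := kappa0; lra.
Qed.

Lemma nle_coord k : nle (scale_w s) (coord k) sigma.
Proof.
move=> N; pose k1 := (k == 0) : nat; pose k2 := (k != 0) : nat.
have e (i j : nat) : md (cf (coord k) i j) * scale_w s i j =
    if (i == k1) && (j == k2) then scale_w s i j else 0.
  rewrite cf_coord /k1 /k2; case: (k == 0) => /=.
    by case: (_ && _); rewrite ?md1 ?mul1r ?md0 ?mul0r.
  by case: (_ && _); rewrite ?md1 ?mul1r ?md0 ?mul0r.
have hk : scale_w s k1 k2 <= sigma.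
  have := w_ge0 1 0; have := w_ge0 0 1; have := s0 => ? ? ?.
  rewrite /scale_w /sigma /k1 /k2; case: (k == 0) => /=; rewrite expr1; nra.
have sg := sigma_gt0.
under eq_bigr do under eq_bigr do rewrite e.
have [h1|h1] := ltnP k1 N; last first.
  rewrite big1 ?(ltW sg) // => i _; rewrite big1 // => j _.
  by rewrite ltn_eqF //; apply: leq_trans h1.
have [h2|h2] := ltnP k2 N; last first.
  rewrite big1 ?(ltW sg) // => i _; rewrite big1 // => j _.
  by rewrite andbC ltn_eqF //; apply: leq_trans h2.
rewrite (bigD1 (Ordinal h1)) //= [X in _ + X]big1 ?addr0; last first.
  move=> i hi; rewrite big1 // => j _; case: eqP => // ei.
  by move: hi; rewrite -val_eqE /= ei eqxx.
rewrite (bigD1 (Ordinal h2)) //= [X in _ + X]big1 ?addr0 ?eqxx //.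
move=> j hj; case: (_ =P k2) => ej; rewrite ?andbF //.
by move: hj; rewrite -val_eqE /= ej eqxx.
Qed.

Lemma nle_mono (g : 'I_2 -> P2) B m n : (forall k, cfree (g k)) ->
  (forall k, nle (scale_w s) (g k) B) -> (0 < m + n)%N ->
  nle (scale_w s) (mono g m n) (B ^+ (m + n)).
Proof.
move=> hg hB hmn.
suff [] : cfree (mono g m n) /\ nle (scale_w s) (mono g m n) (B ^+ (m + n)) by [].
apply: (mono_split (Q := fun p d => cfree p /\ nle (scale_w s) p (B ^+ d))) => //.
move=> p q d d' [hp hpn] [hq hqn]; split; first exact: cfreeM.
rewrite exprD; apply: (nle_mul (w := scale_w s)) => //; try exact: scale_w_ge0.
exact: scale_w_submul.
Qed.

(** One factor of the monomial is split off: the hypothesis on t is about a product of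
    two factors. *)
Lemma nle_mono2 k (g : 'I_2 -> P2) B m n : (forall k, cfree (g k)) ->
  (forall k, nle (scale_w s) (g k) B) -> (1 < m + n)%N ->
  nle (fun i j => s ^+ (i + j) * (md (t k i j) * w i j)) (mono g m n) (B ^+ (m + n)).
Proof.
move=> hg hB hmn.
have prod p q A A' : cfree p -> cfree q -> nle (scale_w s) p A -> nle (scale_w s) q A' ->
    nle (fun i j => s ^+ (i + j) * (md (t k i j) * w i j)) (p * q) (A * A').
  move=> hp hq hA hA'; apply: (nle_mul (w := scale_w s)) => //; try exact: scale_w_ge0.
    by move=> i j; rewrite !mulr_ge0 ?exprn_ge0 ?md_ge0 ?w_ge0 // ltW.
  by apply: scale_w_submul => //.
case: m hmn => [|m]; last first.
  rewrite addSn ltnS => h; rewrite monoSl exprS; apply: prod => //.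
    exact: cfree_mono.
  exact: nle_mono.
case: n => // n; rewrite addnS ltnS => h; rewrite monoSr exprS; apply: prod => //.
  exact: cfree_mono.
exact: nle_mono.
Qed.

Lemma nle_T k w0 p B : nle (fun i j => s ^+ (i + j) * (md (t k i j) * w0 i j)) p B ->
  nle (fun i j => s ^+ (i + j) * w0 i j) (Tmul (t k) p) B.
Proof.
move=> h N; apply: le_trans (h N); apply: ler_sum => i _; apply: ler_sum => j _.
by rewrite cfT mdM le_eqVlt; apply/orP; left; apply/eqP; ring.
Qed.

(** The terms of f of degree d contribute M (2 sigma / rho)^d; as d >= 2 their sum is
    quadratic in sigma, and below sigma for s small. *)
Lemma nle_Tcompo k N (g : 'I_2 -> P2) : (forall k, cfree (g k)) ->
  (forall k, nle (scale_w s) (g k) (2 * sigma)) ->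
  nle (scale_w s) (Tmul (t k) (compo (c k) N g)) sigma.
Proof.
move=> hg hB; apply: nle_T.
have sg := sigma_gt0.
pose x := 2 * sigma / rho.
have sg2 : 0 <= 2 * sigma by lra.
have x0 : 0 <= x by rewrite /x divr_ge0 // ltW.
apply: (@nle_le _ _ _ (\sum_(m < N) \sum_(n < N) (if (m + n < 2)%N then 0 else M * x ^+ (m + n)))).
  have tw i j : 0 <= s ^+ (i + j) * (md (t k i j) * w i j).
    by rewrite !mulr_ge0 ?exprn_ge0 ?md_ge0 ?w_ge0 // ltW.
  apply: nle_sum => // m; apply: nle_sum => // n.
  case: ltnP => h.
    by rewrite c2 // !polyC0 mul0r; apply: nle0.
  apply: nle_le (nleZ _ (nle_mono2 k hg hB h)) _.
  have := cM k m n => hc.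
  have -> : M * x ^+ (m + n) = M / rho ^+ (m + n) * (2 * sigma) ^+ (m + n).
    by rewrite /x [(_ / rho) ^+ _]exprMn exprVn; ring.
  by rewrite ler_wpM2r // exprn_ge0.
have -> : \sum_(m < N) \sum_(n < N) (if (m + n < 2)%N then 0 else M * x ^+ (m + n)) =
   M * \sum_(m < N) \sum_(n < N) (if (m + n < 2)%N then 0 else x ^+ (m + n)).
  rewrite mulr_sumr; apply: eq_bigr => m _; rewrite mulr_sumr; apply: eq_bigr => n _.
  by case: ifP; rewrite ?mulr0.
apply: le_trans (ler_wpM2l (ltW M0) (sum_geo2 N x0 hs1)) _.
have -> : M * (32 * x ^+ 2) = (128 * M * sigma) * (sigma / rho ^+ 2).
  by rewrite /x; field; rewrite gt_eqF.
apply: le_trans (ler_wpM2r _ hs2) _; first by rewrite divr_ge0 ?exprn_ge0 // ltW.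
by rewrite le_eqVlt; apply/orP; left; apply/eqP; field; rewrite gt_eqF.
Qed.

(** The ball of radius 2 sigma around 0 is stable under the iteration. *)
Lemma nle_iter N k : nle (scale_w s) (iter_sol N k) (2 * sigma).
Proof.
have sg := sigma_gt0.
elim: N k => [|N IH] k; first by apply: nle_le (nle_coord k) _; lra.
have -> : 2 * sigma = sigma + sigma by ring.
apply: nleD; [exact: scale_w_ge0|exact: nle_coord|].
apply: nle_Tcompo; [exact: cfree_iter|exact: IH].
Qed.

(** The lower bound of the weights by kappa^(i + j) makes the norm dominate the sup norm
    on the polydisc of radius kappa s, and order d at 0 yields x^d on the polydisc
    contracted by x. *)
Lemma ev_bound p B d a b (x : R) : nle (scale_w s) p B ->
  (forall i j, (i + j < d)%N -> cf p i j = 0) ->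
  0 <= x <= 1 -> md a <= x * (kappa * s) -> md b <= x * (kappa * s) ->
  md (ev p a b) <= B * x ^+ d.
Proof.
move=> hp hd /andP[x0 x1] ha hb.
rewrite (ev_coefs a b (leqnn (deg2 p))).
apply: le_trans (md_sum _ _ _) _.
apply: (@le_trans _ _ (x ^+ d * (\sum_(i < deg2 p) \sum_(j < deg2 p) md (cf p i j) * scale_w s i j))).
  rewrite mulr_sumr; apply: ler_sum => i _; apply: le_trans (md_sum _ _ _) _.
  rewrite mulr_sumr; apply: ler_sum => j _.
  rewrite !mdM !mdX.
  have [h|h] := ltnP (i + j) d; first by rewrite hd // md0 !mul0r mulr0.
  rewrite [leRHS]mulrCA ler_wpM2l ?md_ge0 //.
  have xks : 0 <= x * (kappa * s) by rewrite !mulr_ge0 // ltW.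
  have h1 : md a ^+ i * md b ^+ j <= (x * (kappa * s)) ^+ (i + j).
    rewrite exprD; apply: ler_pM; rewrite ?exprn_ge0 ?md_ge0 //.
      by apply: lerXn2r; rewrite ?nnegrE ?md_ge0.
    by apply: lerXn2r; rewrite ?nnegrE ?md_ge0.
  apply: le_trans h1 _; rewrite exprMn; apply: ler_pM; rewrite ?exprn_ge0 //.
    by rewrite mulr_ge0 // ltW.
    by rewrite -(subnK h) exprD ler_piMl ?exprn_ge0 // exprn_ile1.
  rewrite /scale_w exprMn mulrC ler_wpM2l ?exprn_ge0 ?wk // ltW //.
by rewrite mulrC ler_wpM2r ?exprn_ge0 // hp.
Qed.

Lemma ev_iter_bound N k a b : md a <= kappa * s -> md b <= kappa * s ->
  md (ev (iter_sol N k) a b) <= 2 * sigma.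
Proof.
move=> ha hb; have := @ev_bound (iter_sol N k) (2 * sigma) 0 a b 1 (nle_iter N k).
by rewrite expr0 mulr1 mul1r; apply => //; rewrite ler01 lexx.
Qed.

(** Consecutive iterates agree below order N.+2, so on half the radius their difference
    decays like 2^-N. *)
Lemma ev_iter_cauchy N k a b : md a <= kappa * s / 2 -> md b <= kappa * s / 2 ->
  md (ev (iter_sol N.+1 k) a b - ev (iter_sol N k) a b) <= 4 * sigma / 2 ^+ N.
Proof.
move=> ha hb; rewrite -evB.
have sg := sigma_gt0.
have h1 : nle (scale_w s) (iter_sol N.+1 k - iter_sol N k) (4 * sigma).
  have -> : 4 * sigma = 2 * sigma + 2 * sigma by ring.
  by apply: nleB; [exact: scale_w_ge0|exact: nle_iter|exact: nle_iter].
apply: le_trans (@ev_bound _ _ N _ _ 2^-1 h1 _ _ _ _) _.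
- move=> i j hij; rewrite cfB (@agree_iter N k i j) ?subrr //.
  by apply: leq_trans hij _; rewrite -addn2 leq_addr.
- by apply/andP; lra.
- by rewrite mulrC.
- by rewrite mulrC.
- by rewrite exprVn.
Qed.

Lemma ev_iter_order2 N k a b x : 0 <= x <= 1 -> md a <= x * (kappa * s) ->
  md b <= x * (kappa * s) ->
  md (ev (iter_sol N k) a b - (if k == 0 then a else b)) <= sigma * x ^+ 2.
Proof.
move=> hx ha hb; rewrite -ev_coord -evB; have sg := sigma_gt0.
case: N => [|N].
  by rewrite subrr /ev !horner0 md0 mulr_ge0 ?sqr_ge0 // ltW.
rewrite [iter_sol _ _]/= addrC addrA addNr add0r.
apply: ev_bound hx ha hb.
  apply: nle_Tcompo; [exact: cfree_iter|exact: nle_iter].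
move=> i j hij; rewrite cfT order_compo ?mulr0 //; [exact: c2|exact: cfree_iter].
Qed.

End Bounds.
End FormalSolution.

(** * Convergence of the iteration *)

Section AnalyticSolution.
Variable R : realType.
Local Notation C := R[i].
Local Notation K2 := 'cV[C]_2.

Lemma pow2_gt0 n : 0 < (2 : R) ^+ n. Proof. by rewrite exprn_gt0. Qed.

Lemma ulim_geo (u : nat -> C) K : (forall N, md (u N.+1 - u N) <= K / 2 ^+ N) ->
  forall N, md (ulim u - u N) <= 2 * K / 2 ^+ N.
Proof.
move=> hu.
have K0 : 0 <= K by have := le_trans (md_ge0 _) (hu 0%N); rewrite expr0 divr1.
have step N m : md (u (N + m)%N - u N) <= 2 * K / 2 ^+ N * (1 - 2^-1 ^+ m).
  elim: m => [|m IH]; first by rewrite addn0 subrr md0 expr0 subrr mulr0.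
  have -> : u (N + m.+1)%N - u N = (u (N + m).+1 - u (N + m)%N) + (u (N + m)%N - u N).
    by rewrite addnS; ring.
  apply: le_trans (mdD _ _) _; apply: le_trans (lerD (hu _) IH) _.
  rewrite le_eqVlt; apply/orP; left; apply/eqP.
  by rewrite exprD exprS exprVn; field; rewrite !gt_eqF ?pow2_gt0.
have far N n : (N <= n)%N -> md (u n - u N) <= 2 * K / 2 ^+ N.
  move=> h; rewrite -(subnKC h); apply: le_trans (step _ _) _.
  rewrite ler_piMr ?divr_ge0 ?mulr_ge0 ?(ltW (pow2_gt0 _)) //.
have hl : isulim u (ulim u).
  apply: (@ulimP _ _ (md (u 0%N) + 2 * K)) => n.
  have -> : u n = u 0%N + (u n - u 0%N) by ring.
  apply: le_trans (mdD _ _) _; rewrite lerD2l.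
  by have := far 0%N n (leq0n _); rewrite expr0 divr1.
move=> N; apply/ler_addgt0Pl => e e0.
have [_ hN] := ultraP; have pf := ultra_properf.
have [n [/= h1 h2]] := filter_ex (filterI (hl e e0) (hN N)).
have -> : ulim u - u N = - (u n - ulim u) + (u n - u N) by ring.
by apply: le_trans (mdD _ _) _; rewrite mdN lerD ?far // ltW.
Qed.

Lemma le_limit (x y K : R) : (forall N, x <= y + K / 2 ^+ N) -> x <= y.
Proof.
move=> h; rewrite leNgt; apply/negP => yx.
have xy : 0 < x - y by lra.
have [N hN] := exists_pow2 (K / (x - y)); have := h N.
move: hN; rewrite ltr_pdivrMr // => hN.
have : K / 2 ^+ N < x - y by rewrite ltr_pdivrMr ?pow2_gt0 // mulrC.
lra.
Qed.

(** H is the limit of the iterates; it is holomorphic by limit_diff, and tangent to the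
    identity since all iterates differ from it by a quadratic term, uniformly. *)
Lemma solve_limit (c t : 'I_2 -> nat -> nat -> C) (w : nat -> nat -> R) (rho M kappa : R) :
  0 < rho -> 0 < M -> 0 < kappa ->
  (forall k m n, md (c k m n) <= M / rho ^+ (m + n)) ->
  (forall k m n, (m + n < 2)%N -> c k m n = 0) ->
  (forall i j, kappa ^+ (i + j) <= w i j) ->
  submul w w -> (forall k, submul w (fun i j => md (t k i j) * w i j)) ->
  exists (H : K2 -> K2) (r K : R), [/\ 0 < r, H 0 = 0, frechet H 0 1%:M,
    (forall z, mdv z < r -> exists A, frechet H z A) &
    forall z N k, mdv z <= r ->
      [/\ md (ev (iter_sol c t N k) (z 0 0) (z 1 0)) <= rho / 4,
          md (H z k 0) <= rho / 4 &
          md (H z k 0 - ev (iter_sol c t N k) (z 0 0) (z 1 0)) <= K / 2 ^+ N]].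
Proof.
move=> r0 M0 k0 hc hc2 wk wsub tsub.
have w10 : 0 < w 1%N 0%N by apply: lt_le_trans (wk 1%N 0%N); rewrite exprn_gt0.
have w01 : 0 < w 0%N 1%N by apply: lt_le_trans (wk 0%N 1%N); rewrite exprn_gt0.
set w1 := w 1%N 0%N + w 0%N 1%N; have w1p : 0 < w1 by rewrite addr_gt0.
(* the two bounds on s are the smallness conditions on sigma = s * w1 of the iteration *)
pose s := Num.min (rho / (8 * w1)) (rho ^+ 2 / (128 * M * w1)).
have s0 : 0 < s by rewrite lt_min !divr_gt0 ?mulr_gt0 ?exprn_gt0.
pose sigma := s * w1.
have sg0 : 0 < sigma by rewrite mulr_gt0.
have sg1 : sigma <= rho / 8.
  have : s <= rho / (8 * w1) by rewrite ge_min lexx.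
  rewrite ler_pdivlMr ?mulr_gt0 // /sigma => h; rewrite ler_pdivlMr //.
  by move: h; have -> : s * (8 * w1) = s * w1 * 8 by ring.
have sg2 : 128 * M * sigma <= rho ^+ 2.
  have : s <= rho ^+ 2 / (128 * M * w1) by rewrite ge_min lexx orbT.
  rewrite ler_pdivlMr ?mulr_gt0 // /sigma.
  by have -> : s * (128 * M * w1) = 128 * M * (s * w1) by ring.
have hs1 : 2 * sigma / rho <= 4^-1 by rewrite ler_pdivrMr //; lra.
have evB := ev_iter_bound r0 M0 k0 hc hc2 wk wsub tsub s0 hs1 sg2.
have evC := ev_iter_cauchy r0 M0 k0 hc hc2 wk wsub tsub s0 hs1 sg2.
have ev2 := ev_iter_order2 r0 M0 k0 hc hc2 wk wsub tsub s0 hs1 sg2.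
pose ks := kappa * s; have ks0 : 0 < ks by rewrite mulr_gt0.
have half x : x <= ks / 2 -> x <= kappa * s.
  by rewrite -/ks; move: ks0; clear; lra.
have sg4 : 2 * sigma <= rho / 4 by move: sg1; clear; lra.
pose h k a b := ulim (fun N => ev (iter_sol c t N k) a b).
have hh k a b N : md a <= ks / 2 -> md b <= ks / 2 ->
    md (h k a b - ev (iter_sol c t N k) a b) <= 8 * sigma / 2 ^+ N.
  move=> ha hb; have -> : 8 * sigma = 2 * (4 * sigma) by ring.
  by apply: (@ulim_geo (fun N => ev (iter_sol c t N k) a b)) => {}N; apply: evC.
have hB k a b : md a <= ks / 2 -> md b <= ks / 2 -> md (h k a b) <= 2 * sigma.
  move=> ha hb; apply: (@le_limit _ _ (8 * sigma)) => N.
  have -> : h k a b = ev (iter_sol c t N k) a b + (h k a b - ev (iter_sol c t N k) a b) by ring.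
  apply: le_trans (mdD _ _) _; apply: lerD; last exact: hh.
  by apply: evB; apply: half.
have h2 k a b x : 0 <= x <= 2^-1 -> md a <= x * ks -> md b <= x * ks ->
    md (h k a b - (if k == 0 then a else b)) <= sigma * x ^+ 2.
  move=> /andP[x0 x1] ha hb; have hx : x * ks <= ks / 2 by rewrite mulrC ler_wpM2l // ltW.
  apply: (@le_limit _ _ (8 * sigma)) => N.
  have -> : h k a b - (if k == 0 then a else b) =
    (ev (iter_sol c t N k) a b - (if k == 0 then a else b)) + (h k a b - ev (iter_sol c t N k) a b) by ring.
  apply: le_trans (mdD _ _) _; apply: lerD; last by apply: hh; [exact: le_trans hx|exact: le_trans hx].
  by apply: ev2 => //; apply/andP; lra.
pose H (z : K2) : K2 := vec (h 0 (z 0 0) (z 1 0)) (h 1 (z 0 0) (z 1 0)).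
have HE z k : H z k 0 = h k (z 0 0) (z 1 0).
  by move: k; apply: ord2P; rewrite ?vec0E ?vec1E.
have near z : mdv z <= ks / 2 -> md (z 0 0) <= ks / 2 /\ md (z 1 0) <= ks / 2.
  by move=> hz; split; apply: le_trans (mdv_entry _ _) hz.
have h00 k : h k 0 0 = 0.
  have := h2 k 0 0 0; rewrite !mul0r md0 expr0n /= mulr0 if_same subr0 => h3.
  apply/eqP; rewrite -md_eq0 eq_le md_ge0 andbT; apply: h3 => //.
  by apply/andP; lra.
have H0 : H 0 = 0 by apply: vecP; rewrite HE !mxE h00.
exists H, (ks / 16), (8 * sigma); split.
- by rewrite divr_gt0.
- exact: H0.
- move=> e e0; pose d := Num.min (ks / 2) (e * ks ^+ 2 / sigma).
  exists d; first by rewrite lt_min !divr_gt0 ?mulr_gt0 ?exprn_gt0.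
  move=> z; rewrite lt_min => /andP[z1 z2]; rewrite addr0 H0 subr0 mul1mx.
  pose x := mdv z / ks; have x0 : 0 <= x by rewrite divr_ge0 ?mdv_ge0 // ltW.
  have xk : x * ks = mdv z by rewrite /x mulfVK // gt_eqF.
  have x1 : x <= 2^-1 by rewrite ler_pdivrMr //; lra.
  have hx : 0 <= x <= 2^-1 by rewrite x0.
  have b k : md ((H z - z) k 0) <= sigma * x ^+ 2.
    rewrite vecBE HE; have := @h2 k _ _ x hx; rewrite xk => /(_ _ _ (mdv_entry z 0) (mdv_entry z 1)).
    by rewrite coordE.
  apply: (@le_trans _ _ (sigma * x ^+ 2)); first by rewrite mdv_le !b.
  move: z2; rewrite ltr_pdivlMr // => z2.
  have -> : sigma * x ^+ 2 = (mdv z * sigma) * mdv z / ks ^+ 2.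
    by rewrite /x expr_div_n; ring.
  rewrite ler_pdivrMr ?exprn_gt0 //.
  by rewrite [leRHS]mulrAC ler_wpM2r ?mdv_ge0 // ltW.
- have [Kd hKd] : exists K', forall k a b, md a <= ks / 16 -> md b <= ks / 16 ->
      exists u v, forall s t, md s <= ks / 16 -> md t <= ks / 16 ->
      md (h k (a + s) (b + t) - h k a b - (u * s + v * t)) <= K' * (md s + md t) ^+ 2.
    have lim k : exists K', forall a b, md a <= ks / 16 -> md b <= ks / 16 ->
      exists u v, forall s t, md s <= ks / 16 -> md t <= ks / 16 ->
      md (h k (a + s) (b + t) - h k a b - (u * s + v * t)) <= K' * (md s + md t) ^+ 2.
      have e1 : 2 * (ks / 4) = ks / 2 by field.
      have e2 : ks / 4 / 4 = ks / 16 by field.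
      have := @limit_diff _ (fun N => ev (iter_sol c t N k)) (h k) (ks / 4) (8 * sigma) (2 * sigma).
      rewrite e1 e2; apply.
      + by rewrite divr_gt0.
      + by move=> N a b; split; [exact: cdiff_ev1|exact: cdiff_ev2].
      + by move=> N a b ha hb; apply: hh.
      + by move=> a b ha hb; apply: hB.
    have [A0 hA0] := lim 0; have [A1 hA1] := lim 1.
    exists (Num.max A0 A1) => k a b ha hb; move: k; apply: ord2P.
      have [u [v huv]] := hA0 a b ha hb; exists u, v => s' t' hs' ht'.
      by apply: le_trans (huv _ _ hs' ht') _; rewrite ler_wpM2r ?sqr_ge0 // le_max lexx.
    have [u [v huv]] := hA1 a b ha hb; exists u, v => s' t' hs' ht'.
    by apply: le_trans (huv _ _ hs' ht') _; rewrite ler_wpM2r ?sqr_ge0 // le_max lexx orbT.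
  move=> z hz.
  have z0 : md (z 0 0) <= ks / 16 by apply: le_trans (mdv_entry _ _) (ltW hz).
  have z1 : md (z 1 0) <= ks / 16 by apply: le_trans (mdv_entry _ _) (ltW hz).
  have [u0 [v0 h0]] := hKd 0 _ _ z0 z1; have [u1 [v1 h1]] := hKd 1 _ _ z0 z1.
  pose A : 'M[C]_2 := \matrix_(i, j) (if i == 0 then (if j == 0 then u0 else v0) else (if j == 0 then u1 else v1)).
  exists A => e e0; pose K1 := Num.max Kd 0 + 1.
  have K10 : 0 < K1 by rewrite ltr_wpDl // le_max lexx orbT.
  exists (Num.min (ks / 16) (e / (4 * K1))); first by rewrite lt_min !divr_gt0 ?mulr_gt0.
  move=> d; rewrite lt_min => /andP[d1 d2].
  have d0' : md (d 0 0) <= ks / 16 by apply: le_trans (mdv_entry _ _) (ltW d1).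
  have d1' : md (d 1 0) <= ks / 16 by apply: le_trans (mdv_entry _ _) (ltW d1).
  have fin : Kd * (md (d 0 0) + md (d 1 0)) ^+ 2 <= e * mdv d.
    have e1 : Kd <= K1 by apply: (@le_trans _ _ (Num.max Kd 0)); rewrite ?le_max ?lexx // /K1 lerDl.
    have e2 := mdv_entry d 0; have e3 := mdv_entry d 1; have e4 := mdv_ge0 d.
    have e5 := md_ge0 (d 0 0); have e6 := md_ge0 (d 1 0).
    move: d2; rewrite ltr_pdivlMr ?mulr_gt0 // => d2.
    apply: (@le_trans _ _ (K1 * (2 * mdv d) ^+ 2)); last first.
      have -> : K1 * (2 * mdv d) ^+ 2 = mdv d * (4 * K1) * mdv d by ring.
      by rewrite ler_wpM2r // ltW.
    apply: (@le_trans _ _ (K1 * (md (d 0 0) + md (d 1 0)) ^+ 2)).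
      by rewrite ler_wpM2r ?sqr_ge0.
    rewrite ler_wpM2l ?(ltW K10) //; apply: lerXn2r; rewrite ?nnegrE ?addr_ge0 ?mulr_ge0 //.
    have -> : 2 * mdv d = mdv d + mdv d by ring.
    exact: lerD.
  rewrite mdv_le !vecBE !HE !mul2E !vecDE !mxE /=; apply/andP; split.
    by rewrite (addrC (d 0 0)) (addrC (d 1 0)); apply: le_trans (h0 _ _ d0' d1') fin.
  by rewrite (addrC (d 0 0)) (addrC (d 1 0)); apply: le_trans (h1 _ _ d0' d1') fin.
- move=> z N k hz; have [z0 z1] : md (z 0 0) <= ks / 2 /\ md (z 1 0) <= ks / 2.
    by apply: near; move: hz ks0; clear; lra.
  split.
  + by apply: (@le_trans _ _ (2 * sigma)); [apply: evB; apply: half|].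
  + by rewrite HE; apply: (@le_trans _ _ (2 * sigma)); first exact: hB.
  + by rewrite HE; apply: hh.
Qed.

End AnalyticSolution.

(** * Holomorphic germs, inverse functions and conjugacies *)

Section Conjugation.
Variable R : realType.
Local Notation C := R[i].
Local Notation K2 := 'cV[C]_2.
Implicit Types F : K2 -> K2.

Definition holo F := F 0 = 0 /\
  exists2 e : R, 0 < e & forall z, mdv z < e -> exists A, frechet F z A.

Lemma frechet_cont F z A : frechet F z A -> forall e, 0 < e ->
  exists2 d : R, 0 < d & forall h, mdv h < d -> mdv (F (h + z) - F z) <= e.
Proof.
move=> hF e e0; have [d d0 hd] := hF 1 ltr01; have hA := opn_ge0 A.
exists (Num.min d (e / (opn A + 1))); first by rewrite lt_min d0 divr_gt0 //; lra.
move=> h; rewrite lt_min => /andP[/hd h1]; rewrite ltr_pdivlMr; last lra.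
move=> h2; have -> : F (h + z) - F z = (F (h + z) - F z - A *m h) + A *m h by rewrite subrK.
apply: le_trans (mdvD _ _) _; have := mdv_mul A h; have := mdv_ge0 h; nra.
Qed.

Lemma frechet_lin (A : 'M[C]_2) z : frechet (mulmx A) z A.
Proof.
move=> e e0; exists 1 => // h _.
by rewrite mulmxDr addrK subrr mdv0 mulr_ge0 ?mdv_ge0 // ltW.
Qed.

Lemma frechet_near F G z A (d : R) : 0 < d -> (forall h, mdv h < d -> F (h + z) = G (h + z)) ->
  frechet F z A -> frechet G z A.
Proof.
move=> d0 h hF e e0; have [d' d'0 hd] := hF e e0.
exists (Num.min d d'); first by rewrite lt_min d0.
move=> y; rewrite lt_min => /andP[y1 y2].
by rewrite -[G z](congr1 G (add0r z)) -!h ?mdv0 // add0r; apply: hd.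
Qed.

Lemma frechetB F G z A B : frechet F z A -> frechet G z B ->
  frechet (fun z => F z - G z) z (A - B).
Proof.
move=> hF hG e e0; have e2 : 0 < e / 2 by rewrite divr_gt0.
have [d d0 hd] := hF _ e2; have [d' d'0 hd'] := hG _ e2.
exists (Num.min d d'); first by rewrite lt_min d0.
move=> h; rewrite lt_min => /andP[/hd h1 /hd' h2].
have -> : F (h + z) - G (h + z) - (F z - G z) - (A - B) *m h =
  (F (h + z) - F z - A *m h) - (G (h + z) - G z - B *m h).
  by rewrite mulmxBl; apply/matrixP => i j; rewrite !mxE; ring.
apply: le_trans (mdvD _ _) _; rewrite mdvN.
by have -> : e * mdv h = e / 2 * mdv h + e / 2 * mdv h; [field|exact: lerD].
Qed.

Lemma psum_split (c c1 c2 : nat -> nat -> C) N a b :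
  (forall m n, c m n = c1 m n + c2 m n) -> psum c N a b = psum c1 N a b + psum c2 N a b.
Proof.
move=> h; rewrite /psum -big_split; apply: eq_bigr => m _; rewrite -big_split; apply: eq_bigr => n _ /=.
by rewrite h mulrDl.
Qed.

Lemma psum_low (c : nat -> nat -> C) N a b :
  psum (fun m n => if (m + n < 2)%N then c m n else 0) N.+2 a b =
  c 0%N 0%N + c 1%N 0%N * a + c 0%N 1%N * b.
Proof.
rewrite /psum big_ord_recl big_ord_recl big_ord_recl big_ord_recl /=.
rewrite [\sum_(i < N) _]big1 ?addr0; last by move=> n _; rewrite /= mul0r.
rewrite big_ord_recl /= big1 ?addr0; last by move=> n _; rewrite /= mul0r.
rewrite big1 ?addr0; last by move=> m _; rewrite big1 // => n _; rewrite /= mul0r.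
by rewrite /bump /= !expr0 !expr1 !mulr1 mul1r addrAC.
Qed.

Lemma psum_high (c : nat -> nat -> C) rho M N a b x : 0 < rho -> 0 <= M ->
  (forall m n, md (c m n) <= M / rho ^+ (m + n)) ->
  md a <= x -> md b <= x -> x <= rho / 4 ->
  md (psum (fun m n => if (m + n < 2)%N then 0 else c m n) N a b) <= 32 * M * (x / rho) ^+ 2.
Proof.
move=> r0 M0 hc ha hb hx; have x0 : 0 <= x by apply: le_trans (md_ge0 a) ha.
have y0 : 0 <= x / rho by rewrite divr_ge0 // ltW.
have y4 : x / rho <= 4^-1 by rewrite ler_pdivrMr //; lra.
have -> : 32 * M * (x / rho) ^+ 2 = M * (32 * (x / rho) ^+ 2) by ring.
apply: le_trans (ler_wpM2l M0 (sum_geo2 N y0 y4)).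
rewrite mulr_sumr; apply: le_trans (md_sum _ _ _) _; apply: ler_sum => m _.
rewrite mulr_sumr; apply: le_trans (md_sum _ _ _) _; apply: ler_sum => n _.
case: ifP => _; first by rewrite mul0r md0 mulr0.
rewrite mdM (mdM (a ^+ m)) !mdX.
apply: (@le_trans _ _ (M / rho ^+ (m + n) * (x ^+ (m + n)))).
  apply: ler_pM; rewrite ?md_ge0 ?mulr_ge0 ?exprn_ge0 ?md_ge0 //.
  rewrite exprD; apply: ler_pM; rewrite ?exprn_ge0 ?md_ge0 //; apply: lerXn2r;
    by rewrite ?nnegrE ?md_ge0.
by rewrite expr_div_n mulrA mulrAC.
Qed.

Lemma psum_order2 (c : nat -> nat -> C) rho M N a b x : 0 < rho -> 0 <= M ->
  (forall m n, md (c m n) <= M / rho ^+ (m + n)) ->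
  md a <= x -> md b <= x -> x <= rho / 4 ->
  md (psum c N.+2 a b - (c 0%N 0%N + c 1%N 0%N * a + c 0%N 1%N * b)) <= 32 * M * (x / rho) ^+ 2.
Proof.
move=> r0 M0 hc ha hb hx; rewrite -(psum_low c N).
rewrite (@psum_split c (fun m n => if (m + n < 2)%N then 0 else c m n)
  (fun m n => if (m + n < 2)%N then c m n else 0)); last first.
  by move=> m n; case: ifP; rewrite ?add0r ?addr0.
by rewrite addrK; apply: psum_high.
Qed.

(** Compare at scale x: the terms of degree at least two contribute O(x^2), so the
    affine part would have to be o(x). *)
Lemma low_order rho M c (f : C -> C -> C) : 0 < rho -> 0 < M -> expansion rho M c f ->
  (forall e, 0 < e -> exists2 d, 0 < d & forall a b x, md a <= x -> md b <= x -> x < d ->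
     md (f a b) <= e * x) ->
  forall m n, (m + n < 2)%N -> c m n = 0.
Proof.
move=> r0 M0 [hc hf] hsmall.
have est a b x : md a <= x -> md b <= x -> x <= rho / 4 ->
    md (f a b - (c 0%N 0%N + c 1%N 0%N * a + c 0%N 1%N * b)) <= 32 * M * (x / rho) ^+ 2.
  move=> ha hb hx; apply: (@le_limit _ _ _ M) => N.
  have -> : f a b - (c 0%N 0%N + c 1%N 0%N * a + c 0%N 1%N * b) =
    (psum c N.+2 a b - (c 0%N 0%N + c 1%N 0%N * a + c 0%N 1%N * b)) + (f a b - psum c N.+2 a b) by ring.
  apply: le_trans (mdD _ _) _; apply: lerD; first exact: (psum_order2 N r0 (ltW M0) hc ha hb hx).
  have := md_ge0 a => a0.
  have h2 : M / 2 ^+ N.+2 <= M / 2 ^+ N.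
    by rewrite ler_wpM2l ?(ltW M0) // lef_pV2 ?posrE ?pow2_gt0 // ler_eXn2l ?ltr1n // -addn2 leq_addr.
  by apply: le_trans h2; apply: hf; lra.
have c00 : c 0%N 0%N = 0.
  have h0 : f 0 0 = 0.
    have [d d0 hd] := hsmall 1 ltr01; have := hd 0 0 0.
    by rewrite md0 mulr0 => /(_ (lexx _) (lexx _) d0) h; apply/eqP; rewrite -md_eq0 eq_le md_ge0 andbT.
  have := est 0 0 0; rewrite md0 h0 !mulr0 !addr0 mul0r expr0n /= mulr0 sub0r mdN => h.
  apply/eqP; rewrite -md_eq0 eq_le md_ge0 andbT; apply: h => //; rewrite divr_ge0 ?(ltW r0) //.
(* a linear form within O(x^2) of a function that is o(x) vanishes *)
have lin (l : C) (g : C -> C) : (forall e, 0 < e -> exists2 d, 0 < d & forall a x, md a <= x -> x < d ->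
     md (g a) <= e * x) -> (forall a x, md a <= x -> x <= rho / 4 -> md (g a - l * a) <= 32 * M * (x / rho) ^+ 2) -> l = 0.
  move=> h1 h2; apply/eqP; rewrite -md_eq0 eq_le md_ge0 andbT; apply/ler_addgt0Pl => e e0.
  rewrite addr0; have e2 : 0 < e / 2 by rewrite divr_gt0.
  have [d d0 hd] := h1 _ e2.
  pose x := Num.min (d / 2) (Num.min (rho / 4) (e / 2 * rho ^+ 2 / (32 * M))).
  have x0 : 0 < x by rewrite !lt_min !divr_gt0 ?mulr_gt0 ?exprn_gt0.
  have xd : x < d by rewrite /x gt_min; apply/orP; left; lra.
  have xr : x <= rho / 4 by rewrite /x !ge_min lexx orbT.
  have xe : x <= e / 2 * rho ^+ 2 / (32 * M) by rewrite /x !ge_min lexx !orbT.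
  have mx : md (x%:C : C) = x by rewrite md_real gtr0_norm.
  have := hd x%:C x; have := h2 x%:C x; rewrite mx => /(_ (lexx _) xr) e3 /(_ (lexx _) xd) e4.
  have e5 : md l * x <= e / 2 * x + 32 * M * (x / rho) ^+ 2.
    rewrite -{1}mx -mdM; have -> : l * x%:C = g x%:C - (g x%:C - l * x%:C) by ring.
    by apply: le_trans (mdBD _ _) _; apply: lerD.
  have e6 : 32 * M * (x / rho) ^+ 2 <= e / 2 * x.
    rewrite expr_div_n mulrA ler_pdivrMr ?exprn_gt0 //.
    move: xe; rewrite ler_pdivlMr ?mulr_gt0 // => xe.
    have -> : 32 * M * x ^+ 2 = x * (32 * M) * x by ring.
    have -> : e / 2 * x * rho ^+ 2 = e / 2 * rho ^+ 2 * x by ring.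
    by rewrite ler_wpM2r // ltW.
  rewrite -(ler_pM2r x0); apply: le_trans e5 _.
  by have -> : e * x = e / 2 * x + e / 2 * x; [field|rewrite lerD2l].
have c10 : c 1%N 0%N = 0.
  apply: (lin _ (fun a => f a 0)).
    move=> e e0; have [d d0 hd] := hsmall e e0; exists d => // a x ha xd; apply: hd => //.
    by rewrite md0; apply: le_trans (md_ge0 a) ha.
  move=> a x ha hx; have := est a 0 x ha; rewrite md0 c00 add0r mulr0 addr0; apply => //.
  by apply: le_trans (md_ge0 a) ha.
have c01 : c 0%N 1%N = 0.
  apply: (lin _ (fun b => f 0 b)).
    move=> e e0; have [d d0 hd] := hsmall e e0; exists d => // a x ha xd; apply: hd => //.
    by rewrite md0; apply: le_trans (md_ge0 a) ha.
  move=> a x ha hx; have := est 0 a x; rewrite md0 c00 add0r mulr0 add0r; apply => //.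
  by apply: le_trans (md_ge0 a) ha.
by case=> [|[|m]] [|[|n]].
Qed.

Lemma nonlinear_expansion F A : holo F -> frechet F 0 A ->
  exists rho M (c : 'I_2 -> nat -> nat -> C), [/\ 0 < rho, 0 < M,
    (forall z, mdv z < rho -> exists B, frechet (fun z => F z - A *m z) z B),
    (forall k m n, (m + n < 2)%N -> c k m n = 0) &
    forall k, expansion rho M (c k) (fun a b => (F (vec a b) - A *m vec a b) k 0)].
Proof.
move=> [F0 [e e0 hF]] hA; pose f z := F z - A *m z.
have hf z : mdv z < e -> exists B, frechet f z B.
  by move=> /hF [B hB]; exists (B - A); apply: frechetB hB (frechet_lin A z).
have [rho [M [c [r0 re M0 hc]]]] := holo_expand e0 hf.
exists rho, M, c; split=> //.
  by move=> z hz; apply: hf; apply: lt_le_trans re.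
move=> k; apply: (low_order r0 M0 (hc k)) => e1 e10.
have := frechetB hA (frechet_lin A 0); rewrite subrr => hf0.
have [d d0 hd] := hf0 _ e10; exists d => // a b x ha hb xd.
have hx : mdv (vec a b) <= x by rewrite mdv_le vec0E vec1E ha.
have := hd (vec a b) (le_lt_trans hx xd).
rewrite mulmx0 F0 subrr addr0 mul0mx !subr0 => h.
apply: le_trans (mdv_entry _ k) _; apply: le_trans h _.
by rewrite ler_wpM2l // ltW.
Qed.

(** Both errors tend to 0: that of truncating the series of f, and that of replacing H z
    by its approximation, by continuity of f at H z. *)
Lemma compo_limit (f : K2 -> K2) (c t : 'I_2 -> nat -> nat -> C) (rho M : R) (H : K2 -> K2) (K : R) (z : K2) (k : 'I_2) :
  0 < rho -> 0 <= M ->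
  (forall z, mdv z < rho -> exists B, frechet f z B) ->
  (forall k, expansion rho M (c k) (fun a b => f (vec a b) k 0)) ->
  (forall N k, [/\ md (ev (iter_sol c t N k) (z 0 0) (z 1 0)) <= rho / 4,
          md (H z k 0) <= rho / 4 &
          md (H z k 0 - ev (iter_sol c t N k) (z 0 0) (z 1 0)) <= K / 2 ^+ N]) ->
  forall e, 0 < e -> exists N0, forall N, (N0 <= N)%N ->
    md (f (H z) k 0 - ev (compo (c k) N.+3 (iter_sol c t N)) (z 0 0) (z 1 0)) <= e.
Proof.
move=> r0 M0 hf hc happ e e0; have e2 : 0 < e / 2 by rewrite divr_gt0.
have Hz : mdv (H z) < rho.
  by rewrite mdv_lt; have [_ h1 _] := happ 0%N 0; have [_ h2 _] := happ 0%N 1; apply/andP; lra.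
have [B hB] := hf _ Hz; have [d d0 hd] := frechet_cont hB e2.
have [N1 hN1] := exists_pow2 (K / d); have [N2 hN2] := exists_pow2 (M / (e / 2)).
have mono N n (X Y : R) : 0 < Y -> X / Y < 2 ^+ n -> (n <= N)%N -> X / 2 ^+ N < Y.
  move=> Y0 h hn; rewrite ltr_pdivrMr ?pow2_gt0 // mulrC -ltr_pdivrMr //.
  by apply: lt_le_trans h _; rewrite ler_eXn2l // ltr1n.
exists (maxn N1 N2) => N; rewrite geq_max => /andP[n1 n2].
pose g := vec (ev (iter_sol c t N 0) (z 0 0) (z 1 0)) (ev (iter_sol c t N 1) (z 0 0) (z 1 0)).
rewrite ev_compo.
have [g0 _ d0'] := happ N 0; have [g1 _ d1'] := happ N 1.
have hgH : mdv (g - H z) < d.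
  rewrite mdv_lt !vecBE vec0E vec1E mdB (mdB _ (H z 1 0)).
  by apply/andP; split; [apply: le_lt_trans d0' _|apply: le_lt_trans d1' _]; apply: mono hN1 n1.
have := hd _ hgH; rewrite subrK => h1.
have -> : f (H z) k 0 - psum (c k) N.+3 (ev (iter_sol c t N 0) (z 0 0) (z 1 0))
   (ev (iter_sol c t N 1) (z 0 0) (z 1 0)) =
  - ((f g - f (H z)) k 0) + (f g k 0 - psum (c k) N.+3 (ev (iter_sol c t N 0) (z 0 0) (z 1 0))
   (ev (iter_sol c t N 1) (z 0 0) (z 1 0))) by rewrite vecBE; ring.
apply: le_trans (mdD _ _) _; rewrite mdN [e]splitr; apply: lerD.
  exact: le_trans (mdv_entry _ k) h1.
apply: le_trans ((hc k).2 _ _ N.+3 _ _) _; [lra|lra|].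
by apply: ltW; apply: mono e2 hN2 _; rewrite -addn3 (leq_trans n2) // leq_addr.
Qed.

(** With all divisors equal to -1, the fixed point equation reads h = id - f (h), that
    is F (h) = id for F = id + f. *)
Lemma right_inverse F : holo F -> frechet F 0 1%:M ->
  exists H, [/\ holo H, frechet H 0 1%:M & exists2 r : R, 0 < r & forall z, mdv z < r -> F (H z) = z].
Proof.
move=> hF hF1; have [rho [M [c [r0 M0 hf hc2 hc]]]] := nonlinear_expansion hF hF1.
pose t : 'I_2 -> nat -> nat -> C := fun _ _ _ => -1.
pose w : nat -> nat -> R := fun _ _ => 1.
have wk i j : 1 ^+ (i + j) <= w i j by rewrite expr1n.
have wsub : submul w w by move=> i j k l _ _; rewrite mulr1.
have tsub k : submul w (fun i j => md (t k i j) * w i j).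
  by move=> i j i' j' _ _; rewrite /t mdN md1 !mulr1.
have [H [r [K [rp H0 H1 hH happ]]]] :=
  solve_limit r0 M0 ltr01 (fun k => (hc k).1) hc2 wk wsub tsub.
exists H; split=> //; first by split=> //; exists r.
exists r => // z hz.
suff h k : (F (H z) - z) k 0 = 0.
  by apply/eqP; rewrite -subr_eq0; apply/eqP; apply: vecP; rewrite h mxE.
apply/eqP; rewrite -md_eq0 eq_le md_ge0 andbT; apply/ler_addgt0Pl => e e0; rewrite addr0.
have e2 : 0 < e / 2 by rewrite divr_gt0.
have hz' := fun N k => happ z N k (ltW hz).
have [N0 hN0] := compo_limit k r0 (ltW M0) hf hc hz' e2.
have [N1 hN1] := exists_pow2 (K / (e / 2)).
pose N := maxn N0 N1; have := hN0 N (leq_maxl _ _) => h1.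
have [_ _ h2] := hz' N.+1 k.
have eqn : ev (iter_sol c t N.+1 k) (z 0 0) (z 1 0) =
    z k 0 - ev (compo (c k) N.+3 (iter_sol c t N)) (z 0 0) (z 1 0).
  have -> : iter_sol c t N.+1 k = coord _ k - compo (c k) N.+3 (iter_sol c t N).
    apply: cf_inj => i j; rewrite /= cfD cfT cfB; congr (_ + _).
    by rewrite /t mulN1r.
  by rewrite evB ev_coord coordE.
have -> : (F (H z) - z) k 0 = (H z k 0 - ev (iter_sol c t N.+1 k) (z 0 0) (z 1 0)) +
   ((F (H z) - 1%:M *m H z) k 0 - ev (compo (c k) N.+3 (iter_sol c t N)) (z 0 0) (z 1 0)).
  by rewrite eqn mul1mx !vecBE; ring.
apply: le_trans (mdD _ _) _; rewrite [e]splitr; apply: lerD => //.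
apply: le_trans h2 _; apply: ltW.
rewrite ltr_pdivrMr ?pow2_gt0 // mulrC -ltr_pdivrMr //.
apply: lt_le_trans hN1 _; rewrite ler_eXn2l ?ltr1n //.
by rewrite (leq_trans (leq_maxr N0 N1)).
Qed.

(** Zero below order two, where f has no coefficients. *)
Definition divisor (al : 'I_2 -> C) (k : 'I_2) i j : C :=
  if (i + j < 2)%N then 0 else (al 0 ^+ i * al 1 ^+ j - al k)^-1.

Definition diag2 (al : 'I_2 -> C) : 'M[C]_2 := \matrix_(i, j) (if i == j then al i else 0).

Lemma diag2E al (z : K2) k : (diag2 al *m z) k 0 = al k * z k 0.
Proof.
by rewrite mul2E !mxE; move: k; apply: ord2P; rewrite /= mul0r ?addr0 ?add0r.
Qed.

(** Multiplication by the divisors inverts the homological operator q |-> q o D - a_k q,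
    D being the diagonal matrix of al. *)
Lemma ev_divisor al k (q : {poly {poly C}}) a b :
  (forall i j, (2 <= i + j)%N -> al 0 ^+ i * al 1 ^+ j != al k) ->
  (forall i j, (i + j < 2)%N -> cf q i j = 0) ->
  ev (Tmul (divisor al k) q) (al 0 * a) (al 1 * b)
    - al k * ev (Tmul (divisor al k) q) a b = ev q a b.
Proof.
move=> hal hq; pose N := maxn (deg2 q) (deg2 (Tmul (divisor al k) q)).
rewrite !(@ev_coefs _ _ N) ?leq_maxl ?leq_maxr //.
rewrite mulr_sumr -sumrB; apply: eq_bigr => i _; rewrite mulr_sumr -sumrB; apply: eq_bigr => j _.
rewrite cfT /divisor; case: ltnP => h; first by rewrite hq // !(mul0r, mulr0) subrr.
have := hal _ _ h; rewrite -subr_eq0 => nz.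
by rewrite !exprMn; field.
Qed.

(** By ev_divisor, the fixed point equation h = id + T (f o h) is F o h = h o D. *)
Lemma siegel_from_weights F (al : 'I_2 -> C) (w : nat -> nat -> R) kappa :
  holo F -> frechet F 0 (diag2 al) -> 0 < kappa ->
  (forall k i j, (2 <= i + j)%N -> al 0 ^+ i * al 1 ^+ j != al k) ->
  (forall i j, kappa ^+ (i + j) <= w i j) ->
  submul w w -> (forall k, submul w (fun i j => md (divisor al k i j) * w i j)) ->
  exists H, [/\ holo H, frechet H 0 1%:M &
    exists2 r : R, 0 < r & forall z, mdv z < r -> F (H z) = H (diag2 al *m z)].
Proof.
move=> hF hF1 k0 hal wk wsub tsub.
have [rho [M [c [r0 M0 hf hc2 hc]]]] := nonlinear_expansion hF hF1.
have [H [r [K [rp H0 H1 hH happ]]]] := @solve_limit _ c (divisor al) w rho M kappa r0 M0 k0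
  (fun k => (hc k).1) hc2 wk wsub tsub.
exists H; split=> //; first by split=> //; exists r.
pose B := opn (diag2 al) + 1; have B0 : 0 < B by rewrite ltr_wpDl // opn_ge0.
exists (Num.min r (r / B)); first by rewrite lt_min rp divr_gt0.
move=> z; rewrite lt_min => /andP[hz]; rewrite ltr_pdivlMr // => hzB.
set y := diag2 al *m z.
have hy : mdv y <= r.
  by apply: le_trans (mdv_mul _ _) _; have := mdv_ge0 z; rewrite /B in hzB; nra.
suff h k : (F (H z) - H y) k 0 = 0.
  by apply/eqP; rewrite -subr_eq0; apply/eqP; apply: vecP; rewrite h mxE.
apply/eqP; rewrite -md_eq0 eq_le md_ge0 andbT; apply/ler_addgt0Pl => e e0; rewrite addr0.
pose A := md (al k) + 1; have A0 : 0 < A by rewrite ltr_wpDl // md_ge0.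
have e3 : 0 < e / 3 by rewrite divr_gt0.
have hz' := fun N k => happ z N k (ltW hz).
have [N0 hN0] := compo_limit k r0 (ltW M0) hf hc hz' e3.
have e3A : 0 < e / 3 / A by rewrite divr_gt0.
have [N1 hN1] := exists_pow2 (K / (e / 3 / A)).
pose N := maxn N0 N1; have := hN0 N (leq_maxl _ _) => h1.
have [_ _ h2] := hz' N.+1 k; have [_ _ h3] := happ y N.+1 k hy.
have eqn : ev (iter_sol c (divisor al) N.+1 k) (y 0 0) (y 1 0) -
    al k * ev (iter_sol c (divisor al) N.+1 k) (z 0 0) (z 1 0) =
    ev (compo (c k) N.+3 (iter_sol c (divisor al) N)) (z 0 0) (z 1 0).
  rewrite [iter_sol _ _ _ _]/= !evD !ev_coord /y !diag2E.
  rewrite -(@ev_divisor al k (compo (c k) N.+3 (iter_sol c (divisor al) N)) (z 0 0) (z 1 0)) //; last 2 first.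
  - exact: hal.
  - by move=> i j; apply: order_compo; [exact: hc2|move=> k'; apply: cfree_iter; exact: hc2].
  have -> : (if k == 0 then al 0 * z 0 0 else al 1 * z 1 0) = al k * (if k == 0 then z 0 0 else z 1 0).
    by have := coordE (diag2 al *m z) k; rewrite !diag2E coordE.
  by ring.
have small : K / 2 ^+ N.+1 <= e / 3 / A.
  apply: ltW; rewrite ltr_pdivrMr ?pow2_gt0 // mulrC -ltr_pdivrMr //.
  apply: lt_le_trans hN1 _; rewrite ler_eXn2l ?ltr1n //.
  by rewrite (leq_trans (leq_maxr N0 N1)).
have -> : (F (H z) - H y) k 0 =
   ((F (H z) - diag2 al *m H z) k 0 - ev (compo (c k) N.+3 (iter_sol c (divisor al) N)) (z 0 0) (z 1 0))
   + al k * (H z k 0 - ev (iter_sol c (divisor al) N.+1 k) (z 0 0) (z 1 0))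
   - (H y k 0 - ev (iter_sol c (divisor al) N.+1 k) (y 0 0) (y 1 0)).
  by rewrite -eqn !vecBE diag2E; ring.
have -> : e = e / 3 + e / 3 + e / 3 by field.
apply: le_trans (mdBD _ _) _; apply: lerD.
  apply: le_trans (mdD _ _) _; apply: lerD => //.
  rewrite mdM; apply: (@le_trans _ _ (A * (e / 3 / A))).
    by apply: ler_pM; rewrite ?md_ge0 ?lerDl //; apply: le_trans h2 small.
  by rewrite mulrC divfK // gt_eqF.
apply: le_trans h3 _; apply: le_trans small _.
rewrite ler_pdivrMr // ler_peMr ?(ltW e3) //.
by rewrite /A lerDr md_ge0.
Qed.

End Conjugation.

(** * Weights absorbing the small divisors *)

Section SmallDivisors.
Variable R : realType.
Local Notation C := R[i].
Variables (al : 'I_2 -> C) (k0 theta : R) (cc : nat).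
Hypothesis al0 : forall k, al k != 0.
Hypothesis k00 : 0 < k0.
Hypothesis cc0 : (0 < cc)%N.
Hypothesis dioph : forall k i j, (2 <= i + j)%N ->
  k0 / (i + j)%:R ^+ cc <= md (al 0 ^+ i * al 1 ^+ j - al k).

Let m0 := Num.min (md (al 0)) (md (al 1)).
Let m1 := Num.max (md (al 0)) (md (al 1)).
Let B := (m1 + m0 / 2) / (m0 / 2).
(* B bounds |Y| when X and X Y are both within m0 / 2 of the eigenvalues; theta is
   small enough for tiny_sep and dioph_size *)
Hypothesis th0 : 0 < theta.
Hypothesis th1 : theta <= 1.
Hypothesis thm : theta <= m0 / 2.
Hypothesis thk : theta * (1 + B) * 2 ^+ cc <= k0.

(** A small divisor at scale q: some divisor of index (i, j) is below theta * 2^-(cc q). *)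
Definition tiny q i j := (2 <= i + j)%N &&
  [|| md (al 0 ^+ i * al 1 ^+ j - al 0) < theta / 2 ^+ (cc * q)
    | md (al 0 ^+ i * al 1 ^+ j - al 1) < theta / 2 ^+ (cc * q)].

Lemma tinyP q i j : tiny q i j ->
  (2 <= i + j)%N /\ exists k, md (al 0 ^+ i * al 1 ^+ j - al k) < theta / 2 ^+ (cc * q).
Proof. by case/andP => h /orP[h'|h']; split=> //; [exists 0|exists 1]. Qed.

Lemma tinyN q i j k : (2 <= i + j)%N -> ~~ tiny q i j ->
  theta / 2 ^+ (cc * q) <= md (al 0 ^+ i * al 1 ^+ j - al k).
Proof.
move=> h; rewrite /tiny h /= negb_or -!leNgt => /andP[h0 h1].
by move: k; apply: ord2P.
Qed.

Lemma m0_gt0 : 0 < m0. Proof. by rewrite lt_min !md_gt0 !al0. Qed.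
Lemma m0_le k : m0 <= md (al k).
Proof. by move: k; apply: ord2P; rewrite ge_min lexx ?orbT. Qed.
Lemma m1_ge k : md (al k) <= m1.
Proof. by move: k; apply: ord2P; rewrite le_max lexx ?orbT. Qed.
Lemma B_ge0 : 0 <= B.
Proof.
have := m0_gt0; have := m0_le 0; have := m1_ge 0 => h1 h2 h3.
by rewrite /B divr_ge0 //; lra.
Qed.

(** The condition on theta turns the Diophantine bound into a lower bound on the degree
    of indices with a small divisor. *)
Lemma dioph_size q d k i j : (d = i + j)%N -> (2 <= i + j)%N ->
  md (al 0 ^+ i * al 1 ^+ j - al k) <= theta / 2 ^+ (cc * q) * (1 + B) ->
  (2 ^ q.+1 <= d)%N.
Proof.
move=> -> hij h; have := le_trans (dioph k hij) h.
have ij0 : 0 < (i + j)%:R :> R by rewrite ltr0n (leq_trans _ hij).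
rewrite ler_pdivrMr ?exprn_gt0 // => h1.
have h2 : (2 ^+ q.+1) ^+ cc <= (i + j)%:R ^+ cc :> R.
  have e1 : (2 ^+ q.+1) ^+ cc = 2 ^+ cc * 2 ^+ (cc * q) :> R.
    by rewrite -exprM mulnC mulnS exprD.
  have p1 : 0 < 2 ^+ (cc * q) :> R by apply: pow2_gt0.
  have hB := B_ge0.
  have tb : 0 < theta * (1 + B) by rewrite mulr_gt0 //; lra.
  rewrite e1 -(ler_pM2l tb); apply: (@le_trans _ _ (k0 * 2 ^+ (cc * q))).
    by rewrite mulrA ler_wpM2r // ltW.
  rewrite -(ler_pM2l p1) in h1.
  have e2 : 2 ^+ (cc * q) * (theta / 2 ^+ (cc * q) * (1 + B) * (i + j)%:R ^+ cc) =
     theta * (1 + B) * (i + j)%:R ^+ cc by field; rewrite gt_eqF.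
  by rewrite e2 in h1; rewrite mulrC.
move: h2; rewrite ler_pXn2r ?nnegrE ?exprn_ge0 //.
by rewrite -natrX ler_nat.
Qed.

Lemma tiny_low q i j : tiny q i j -> (2 ^ q <= i + j)%N.
Proof.
move=> /tinyP [hij [k hk]].
have : (2 ^ q.+1 <= i + j)%N.
  apply: (@dioph_size q _ k i j) => //; apply: le_trans (ltW hk) _.
  by rewrite ler_peMr ?divr_ge0 ?(ltW th0) ?(ltW (pow2_gt0 _ _)) // lerDl B_ge0.
by apply: leq_trans; rewrite leq_exp2l.
Qed.

(** If both X and X Y are close to eigenvalues a_k and a_l, then Y a_k is close to a_l;
    this is a small divisor of degree i' + j' + 1, and the Diophantine condition forces
    its degree to be large. *)
Lemma tiny_sep q i j i' j' : tiny q i j -> tiny q (i + i') (j + j') ->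
  (0 < i' + j')%N -> (2 ^ q <= i' + j')%N.
Proof.
move=> /tinyP [hij [k hk]] /tinyP [_ [l hl]] hd.
set X := al 0 ^+ i * al 1 ^+ j in hk; set Y := al 0 ^+ i' * al 1 ^+ j'.
have XY : al 0 ^+ (i + i') * al 1 ^+ (j + j') = X * Y by rewrite /X /Y !exprD; ring.
rewrite XY in hl; pose eta := theta / 2 ^+ (cc * q).
have etaE : theta / 2 ^+ (cc * q) = eta by [].
rewrite etaE in hk hl.
have eta0 : 0 < eta by rewrite divr_gt0 ?pow2_gt0.
have eta1 : eta <= theta.
  by rewrite ler_pdivrMr ?pow2_gt0 // ler_peMr ?(ltW th0) // exprn_ege1 // ler1n.
clearbody eta; have := m0_gt0; have := m0_le k; have := m1_ge l => g1 g2 g3.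
have thm' := thm.
have mX : m0 / 2 <= md X.
  have h : md (al k) - md X <= md (X - al k) by rewrite (mdB X); apply: mdBB.
  lra.
have mXY : md X * md Y <= m1 + m0 / 2.
  rewrite -mdM; have -> : X * Y = al l + (X * Y - al l) by ring.
  by apply: le_trans (mdD _ _) _; lra.
have mY : md Y <= B.
  rewrite /B ler_pdivlMr; last lra.
  by have := md_ge0 Y; nra.
have key : md (Y * al k - al l) <= eta * (1 + B).
  have -> : Y * al k - al l = (X * Y - al l) - Y * (X - al k) by ring.
  apply: le_trans (mdBD _ _) _; rewrite mdM mulrDr mulr1; apply: lerD; first exact: ltW.
  by rewrite mulrC; apply: ler_pM; rewrite ?md_ge0 // ltW.
have : (2 ^ q.+1 <= (i' + j').+1)%N.
  have [e|e] : k = 0 \/ k = 1 by move: (k); apply: ord2P; [left|right].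
    apply: (@dioph_size q _ l i'.+1 j') => //.
    by rewrite etaE; move: key; rewrite e /Y exprS; have -> : al 0 ^+ i' * al 1 ^+ j' * al 0 = al 0 * al 0 ^+ i' * al 1 ^+ j' by ring.
  apply: (@dioph_size q _ l i' j'.+1) => //; [by rewrite addnS|by rewrite addnS|].
  by rewrite etaE; move: key; rewrite e /Y exprS; have -> : al 0 ^+ i' * al 1 ^+ j' * al 1 = al 0 ^+ i' * (al 1 * al 1 ^+ j') by ring.
have : (0 < 2 ^ q)%N by rewrite expn_gt0.
by rewrite expnS; move: (2 ^ q)%N (i' + j')%N => x d; clear; lia.
Qed.

(** A distance t to a tiny index of scale q strictly above (i, j), or the cap 2 ^ q. *)
Definition upP q i j t := (t == 2 ^ q)%N || [exists a : 'I_t.+1, (0 < t)%N && tiny q (i + a) (j + (t - a))].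

Lemma up_ex q i j : exists t, upP q i j t.
Proof. by exists (2 ^ q)%N; rewrite /upP eqxx. Qed.

Definition up q i j := ex_minn (up_ex q i j).

Lemma up_le q i j : (up q i j <= 2 ^ q)%N.
Proof. by rewrite /up; case: ex_minnP => t _; apply; rewrite /upP eqxx. Qed.

Lemma up_tiny q i j a b : (0 < a + b)%N -> tiny q (i + a) (j + b) -> (up q i j <= a + b)%N.
Proof.
move=> hab h; rewrite /up; case: ex_minnP => t _; apply; rewrite /upP; apply/orP; right.
have ha : (a < (a + b).+1)%N by rewrite ltnS leq_addr.
by apply/existsP; exists (Ordinal ha); rewrite hab /= addKn.
Qed.

Lemma up_spec q i j : up q i j = (2 ^ q)%N \/
  exists a b, [/\ (0 < a + b)%N, tiny q (i + a) (j + b) & (a + b = up q i j)%N].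
Proof.
rewrite /up; case: ex_minnP => t /orP[/eqP ->|/existsP [a /andP[t0 h]] _]; first by left.
right; exists a, (t - a)%N; have ha : (a <= t)%N by rewrite -ltnS.
by rewrite subnKC.
Qed.

(** A tiny index above (i + a, j + b) is also above (i, j). *)
Lemma up_lip q i j a b : (up q i j <= up q (i + a) (j + b) + (a + b))%N.
Proof.
have [->|[a' [b' [h0 h1 <-]]]] := up_spec q (i + a) (j + b).
  by apply: leq_trans (up_le q i j) _; rewrite leq_addr.
rewrite -!addnA in h1.
have -> : (a' + b' + (a + b) = (a + a') + (b + b'))%N by clear; lia.
by apply: up_tiny => //; move: h0; clear; lia.
Qed.

Lemma up_tiny_self q i j : tiny q i j -> up q i j = (2 ^ q)%N.
Proof.
move=> h; have [//|[a [b [h0 h1 h2]]]] := up_spec q i j.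
by apply/eqP; rewrite eqn_leq up_le -h2 (tiny_sep h h1).
Qed.

(** The counting potential of Siegel and Brjuno. It is superadditive, at most twice the
    degree, and gains an extra 2 ^ q at tiny indices. The correction by up remembers how
    far the next tiny index of scale q is: by tiny_sep, after one of them the degree
    must grow by 2 ^ q before the next one. *)
Definition pot q i j : nat := (2 * (i + j) - maxn (2 ^ q) (2 * 2 ^ q - 2 * up q i j))%N.

(** At a tiny index (i + a, j + b) the value up is the full 2 ^ q by separation, while
    each of the two summands sees this index at a distance at most the degree of the
    other. All cases are linear arithmetic. *)
Lemma pot_super q i j a b : (0 < i + j)%N -> (0 < a + b)%N ->
  (pot q i j + pot q a b + tiny q (i + a) (j + b) * 2 ^ q <= pot q (i + a) (j + b))%N.
Proof.
move=> hn hm; rewrite /pot.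
have l1 := up_lip q i j a b; have l2 := up_lip q a b i j.
rewrite (addnC a i) (addnC b j) in l2.
have u1 := up_le q i j; have u2 := up_le q a b; have u3 := up_le q (i + a) (j + b).
case: (boolP (tiny q (i + a) (j + b))) => h; last by move: u1 u2 u3 l1 l2; clear -hn hm; lia.
have h3 := up_tiny_self h; have h4 := tiny_low h.
have h5 : (up q i j <= a + b)%N by apply: up_tiny.
have h6 : (up q a b <= i + j)%N by apply: up_tiny => //; rewrite (addnC a) (addnC b).
by move: u1 u2 h3 h4 h5 h6; clear -hn hm; lia.
Qed.

Lemma pot_le q i j : (pot q i j <= 2 * (i + j))%N.
Proof. by rewrite /pot leq_subr. Qed.

(** Summing over the scales q < i + j is enough: a tiny index of scale q has degree at
    least 2 ^ q. *)
Definition load i j : R := \sum_(q < i + j) (pot q i j)%:R / 2 ^+ q.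

(** Each scale at which (i + a, j + b) is tiny contributes 1. *)
Lemma load_super i j a b : (0 < i + j)%N -> (0 < a + b)%N ->
  load i j + load a b + \sum_(q < (i + a) + (j + b)) (tiny q (i + a) (j + b))%:R
  <= load (i + a) (j + b).
Proof.
move=> hn hm; rewrite /load.
have e : ((i + a) + (j + b) = (i + j) + (a + b))%N by rewrite addnACA.
have p0 q x y : 0 <= (pot q x y)%:R / 2 ^+ q :> R by rewrite divr_ge0 // ltW // pow2_gt0.
have wid x y N : (x + y <= N)%N ->
    \sum_(q < x + y) (pot q x y)%:R / 2 ^+ q <= \sum_(q < N) (pot q x y)%:R / 2 ^+ q :> R.
  move=> h; rewrite (big_ord_widen N (fun q => (pot q x y)%:R / 2 ^+ q) h).
  rewrite big_mkcond; apply: ler_sum => q _; case: ifP => // _.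
have h1 := wid i j _ (leq_addr (a + b) (i + j)).
have h2 := wid a b _ (leq_addl (i + j) (a + b)).
rewrite -e in h1 h2.
apply: le_trans (lerD (lerD h1 h2) (lexx _)) _.
rewrite -!big_split; apply: ler_sum => q _ /=.
rewrite ler_pdivlMr ?pow2_gt0 // !mulrDl !mulfVK ?gt_eqF ?pow2_gt0 //.
have := pot_super q hn hm; rewrite -(ler_nat R) !natrD natrM natrX.
by [].
Qed.

Lemma load_le i j : load i j <= 4 * (i + j)%:R.
Proof.
rewrite /load; set n := (i + j)%N.
have h N : \sum_(q < N) 2 * n%:R / 2 ^+ q = 4 * n%:R * (1 - 2^-1 ^+ N) :> R.
  elim: N => [|N IH]; first by rewrite big_ord0 expr0 subrr mulr0.
  by rewrite big_ord_recr /= IH exprS -exprVn; field.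
apply: (@le_trans _ _ (\sum_(q < n) 2 * n%:R / 2 ^+ q)).
  apply: ler_sum => q _; rewrite ler_pM2r ?invr_gt0 ?pow2_gt0 //.
  by rewrite -natrM ler_nat pot_le.
rewrite h ler_piMr ?mulr_ge0 // gerBl exprn_ge0 // invr_ge0 //.
Qed.

(** A bound for the growth of the coefficients of the linearization, at most exponential
    in the degree by load_le. *)
Definition growth i j : R := theta^-1 ^+ (i + j).-1 * expR (cc%:R * load i j).

Lemma growth_gt0 i j : 0 < growth i j.
Proof. by rewrite mulr_gt0 ?exprn_gt0 ?invr_gt0 ?expR_gt0. Qed.

Lemma growth_super i j a b : (0 < i + j)%N -> (0 < a + b)%N ->
  theta^-1 * expR (cc%:R * \sum_(q < (i + a) + (j + b)) (tiny q (i + a) (j + b))%:R)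
    * (growth i j * growth a b) <= growth (i + a) (j + b).
Proof.
move=> hn hm; rewrite /growth; set T := \sum_(q < _) _.
have -> : ((i + a + (j + b)).-1 = ((i + j).-1 + (a + b).-1).+1)%N.
  by rewrite addnACA -(prednK hn) -(prednK hm) /= addnS.
have h := load_super hn hm; rewrite -/T in h.
rewrite exprS exprD.
have -> : theta^-1 * expR (cc%:R * T) * (theta^-1 ^+ (i + j).-1 * expR (cc%:R * load i j) *
   (theta^-1 ^+ (a + b).-1 * expR (cc%:R * load a b))) =
  theta^-1 * (theta^-1 ^+ (i + j).-1 * theta^-1 ^+ (a + b).-1) *
  (expR (cc%:R * load i j) * expR (cc%:R * load a b) * expR (cc%:R * T)) by ring.
rewrite ler_wpM2l ?mulr_ge0 ?exprn_ge0 ?invr_ge0 ?(ltW th0) //.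
by rewrite -!expRD -!mulrDr ler_expR ler_wpM2l.
Qed.

(** If p is the first scale at which the index is not tiny, the divisor is at least
    theta * 2^-(cc p), and p is at most the number of scales at which it is tiny. *)
Lemma divisor_bound k i j : (2 <= i + j)%N ->
  md (divisor al k i j) <= theta^-1 * expR (cc%:R * \sum_(q < i + j) (tiny q i j)%:R).
Proof.
move=> hij; rewrite /divisor ltnNge hij /= mdV.
have ex : exists q, ~~ tiny q i j.
  exists (i + j)%N; apply/negP => /tiny_low; rewrite leqNgt => /negP; apply.
  exact: ltn_expl.
case: (ex_minnP ex) => p hp hmin.
have lep : p%:R <= \sum_(q < i + j) (tiny q i j)%:R :> R.
  have tl q : (q < p)%N -> tiny q i j.
    by move=> qp; apply: contraLR qp => /hmin; rewrite -leqNgt.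
  have pn : (p <= i + j)%N.
    case: (p) tl => // p' tl; apply: leq_trans (tiny_low (tl p' (ltnSn _))).
    exact: ltn_expl.
  rewrite (_ : p%:R = \sum_(q < p) (1 : R)); last by rewrite sumr_const card_ord.
  rewrite (big_ord_widen (i + j) (fun=> (1 : R)) pn) big_mkcond; apply: ler_sum => q _.
  by case: ifP => // /tl ->.
have h := tinyN k hij hp.
have c1 : 2 ^+ (cc * p) <= expR (cc%:R * p%:R) :> R.
  rewrite -natrM -[X in expR X]mulr1 expRM_natl; apply: lerXn2r; rewrite ?nnegrE ?expR_ge0 //.
  by apply: le_trans (expR_ge1Dx _); lra.
apply: (@le_trans _ _ (theta^-1 * 2 ^+ (cc * p))).
  rewrite -[leRHS]invrK lef_pV2 ?posrE ?invr_gt0 ?mulr_gt0 ?invr_gt0 ?pow2_gt0 //.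
    by rewrite invfM invrK.
  by apply: lt_le_trans h; rewrite divr_gt0 ?pow2_gt0.
rewrite ler_wpM2l ?invr_ge0 ?(ltW th0) //; apply: le_trans c1 _.
by rewrite ler_expR ler_wpM2l.
Qed.

Definition weight i j : R := (growth i j)^-1.

Lemma weight_submul : submul weight weight.
Proof.
move=> i j a b hn hm; have g2 := mulr_gt0 (growth_gt0 i j) (growth_gt0 a b).
rewrite /weight -invfM lef_pV2 ?posrE ?growth_gt0 //.
apply: le_trans (growth_super hn hm); rewrite ler_peMl ?(ltW g2) //.
have h1 : 1 <= theta^-1 by rewrite invf_ge1.
apply: le_trans h1 _; rewrite ler_peMr ?invr_ge0 ?(ltW th0) // -expR0 ler_expR.
by rewrite mulr_ge0 // sumr_ge0.
Qed.

Lemma weight_divisor k : submul weight (fun i j => md (divisor al k i j) * weight i j).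
Proof.
move=> i j a b hn hm; have g2 := mulr_gt0 (growth_gt0 i j) (growth_gt0 a b).
rewrite /weight -invfM ler_pdivrMr ?growth_gt0 // mulrC ler_pdivlMr //.
apply: le_trans (growth_super hn hm); rewrite ler_wpM2r ?(ltW g2) //.
by apply: divisor_bound; move: hn hm; clear; lia.
Qed.

Lemma weight_ge i j : (theta * expR (- (4 * cc%:R))) ^+ (i + j) <= weight i j.
Proof.
have b0 : 0 < (theta * expR (- (4 * cc%:R))) ^+ (i + j) by rewrite exprn_gt0 // mulr_gt0 ?expR_gt0.
rewrite /weight -[leLHS]invrK lef_pV2 ?posrE ?invr_gt0 ?growth_gt0 //.
rewrite -exprVn invfM expRN invrK exprMn /growth; apply: ler_pM.
- by rewrite exprn_ge0 // invr_ge0 ltW.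
- exact: expR_ge0.
- by rewrite ler_weXn2l ?leq_pred // invf_ge1.
- rewrite -expRM_natl ler_expR.
  have -> : (i + j)%:R * (4 * cc%:R) = cc%:R * (4 * (i + j)%:R) :> R by ring.
  by rewrite ler_wpM2l // load_le.
Qed.

End SmallDivisors.

(** * Siegel's theorem and uniqueness for diagonal linear parts *)

Section SiegelDiagonal.
Variable R : realType.
Local Notation C := R[i].
Local Notation K2 := 'cV[C]_2.
Implicit Types F : K2 -> K2.

(** The exponent is rounded up to an integer. *)
Lemma diophantine_nat (a1 a2 : C) : diophantine a1 a2 ->
  exists (k0 : R) cc, [/\ 0 < k0, (0 < cc)%N & forall a i j, a = a1 \/ a = a2 ->
    (2 <= i + j)%N -> k0 / (i + j)%:R ^+ cc <= md (a1 ^+ i * a2 ^+ j - a)].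
Proof.
move=> [_ _ [k0 [c [k00 c0 h]]]]; exists k0, (Num.bound c).
have hc : c < (Num.bound c)%:R by apply: archi_boundP; apply: ltW.
split=> //.
move=> a i j ha hij; have := h a i j ha hij; rewrite normC_md lecR mdB; apply: le_trans.
rewrite ler_pM2l // powRN lef_pV2 ?posrE ?exprn_gt0 ?powR_gt0 ?ltr0n ?(leq_trans _ hij) //.
rewrite -powR_mulrn //; apply: ler_powR; last exact: ltW.
by rewrite ler1n (leq_trans _ hij).
Qed.

(** Small divisors are controlled by the weights of the Siegel-Brjuno counting argument,
    for a constant theta small enough. *)
Lemma siegel_diag F (al : 'I_2 -> C) : holo F -> frechet F 0 (diag2 al) ->
  diophantine (al 0) (al 1) ->
  exists H, [/\ holo H, frechet H 0 1%:M &
    exists2 r : R, 0 < r & forall z, mdv z < r -> F (H z) = H (diag2 al *m z)].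
Proof.
move=> hF hF1 hd; have [a0 a1 _] := hd.
have al0 : forall k, al k != 0 by apply: ord2P.
have [k0 [cc [k00 cc0 hk]]] := diophantine_nat hd.
have dio k i j : (2 <= i + j)%N -> k0 / (i + j)%:R ^+ cc <= md (al 0 ^+ i * al 1 ^+ j - al k).
  by apply: hk; move: k; apply: ord2P; [left|right].
pose m0 := Num.min (md (al 0)) (md (al 1)); pose m1 := Num.max (md (al 0)) (md (al 1)).
pose B := (m1 + m0 / 2) / (m0 / 2).
have m00 : 0 < m0 by rewrite lt_min !md_gt0 !al0.
have m10 : 0 <= m1 by rewrite le_max md_ge0.
have B0 : 0 <= B by rewrite /B divr_ge0 // ?addr_ge0 // divr_ge0 // ltW.
have B1 : 0 < (1 + B) * 2 ^+ cc by rewrite mulr_gt0 ?pow2_gt0 //; lra.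
pose theta := Num.min 1 (Num.min (m0 / 2) (k0 / ((1 + B) * 2 ^+ cc))).
have th0 : 0 < theta by rewrite !lt_min ltr01 !divr_gt0.
have th1 : theta <= 1 by rewrite ge_min lexx.
have thm : theta <= m0 / 2 by rewrite !ge_min lexx orbT.
have thk : theta * (1 + B) * 2 ^+ cc <= k0.
  by rewrite -mulrA -ler_pdivlMr // !ge_min lexx !orbT.
have kp : 0 < theta * expR (- (4 * cc%:R)) by rewrite mulr_gt0 // expR_gt0.
apply: (siegel_from_weights hF hF1 kp).
- move=> k i j hij; rewrite -subr_eq0 -md_gt0; apply: lt_le_trans (dio k i j hij).
  by rewrite divr_gt0 ?exprn_gt0 // ltr0n (leq_trans _ hij).
- exact: (@weight_ge _ al theta cc th0 th1).
- exact: (weight_submul al0 cc0 dio th0 th1 thm thk).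
- exact: (weight_divisor al0 cc0 dio th0 thm thk).
Qed.

Lemma LL_prod (u v : C -> C) M M' : bdG u M -> bdG v M' ->
  LL (fun z w => u z * v w) = L u * L v.
Proof.
move=> hu hv; rewrite -(L_scale (L u) hv); apply: eq_L => w gw.
rewrite mulrC -(L_scale (v w) hu); apply: eq_L => z gz; exact: mulrC.
Qed.

Lemma LL_monomials (d : nat -> nat -> C) N m n : (m < N)%N -> (n < N)%N ->
  LL (fun z w => psum d N z w * (z^-1 ^+ m.+1 * w^-1 ^+ n.+1)) = d m n.
Proof.
move=> hm hn; pose u i m (z : C) := z ^+ i * z^-1 ^+ m.+1.
have ub i m' : (i < N)%N -> bdG (u i m') (2 ^+ N).
  move=> hi z gz; rewrite mdM -[leRHS]mulr1; apply: ler_pM; rewrite ?md_ge0 ?invpow_bound //.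
  rewrite mdX; apply: (@le_trans _ _ (2 ^+ i)).
    by apply: lerXn2r; rewrite ?nnegrE ?md_ge0 //; apply: bigsq_md; apply: gam_bigsq.
  by rewrite ler_eXn2l ?ltr1n // ltnW.
have uub i j : (i < N)%N -> (j < N)%N -> bd2 (fun z w => u i m z * u j n w) (2 ^+ N * 2 ^+ N).
  by move=> hi hj z w gz gw; rewrite mdM ler_pM ?md_ge0 ?ub.
transitivity (LL (fun z w => \sum_(i < N) 1 * \sum_(j < N) d i j * (u i m z * u j n w))).
  apply: eq_LL => z w gz gw; rewrite /psum mulr_suml; apply: eq_bigr => i _.
  by rewrite mul1r mulr_suml; apply: eq_bigr => j _; rewrite /u; ring.
pose B := \sum_(i < N) \sum_(j < N) md (d i j) * (2 ^+ N * 2 ^+ N).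
rewrite (@LL_sum _ N (fun=> 1) (fun i z w => \sum_(j < N) d i j * (u i m z * u j n w)) B); last first.
  move=> i z w gz gw; apply: (@le_trans _ _ (\sum_(j < N) md (d i j) * (2 ^+ N * 2 ^+ N))).
    apply: le_trans (md_sum _ _ _) _; apply: ler_sum => j _.
    by rewrite mdM ler_wpM2l ?md_ge0 ?uub.
  rewrite /B [leRHS](bigD1 i) //= lerDl; apply: sumr_ge0 => k _; apply: sumr_ge0 => j _.
  by rewrite !mulr_ge0 ?md_ge0 ?(ltW (pow2_gt0 _ _)).
transitivity (\sum_(i < N) \sum_(j < N) d i j * ((i == m :> nat)%:R * (j == n :> nat)%:R)).
  apply: eq_bigr => i _; rewrite mul1r.
  rewrite (@LL_sum _ N (fun j : 'I_N => d i j) (fun j z w => u i m z * u j n w) (2 ^+ N * 2 ^+ N)).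
    by apply: eq_bigr => j _; rewrite (LL_prod (ub i m (ltn_ord i)) (ub j n (ltn_ord j))) !L_monomial.
  by move=> j; apply: uub.
rewrite (bigD1 (Ordinal hm)) //= [X in _ + X]big1 ?addr0; last first.
  move=> i hi; rewrite big1 // => j _.
  have -> : (i == m :> nat) = false by apply/negbTE; move: hi; rewrite -val_eqE.
  by rewrite mul0r mulr0.
rewrite (bigD1 (Ordinal hn)) //= [X in _ + X]big1 ?addr0; last first.
  move=> j hj; have -> : (j == n :> nat) = false by apply/negbTE; move: hj; rewrite -val_eqE.
  by rewrite !mulr0.
by rewrite !eqxx !mulr1.
Qed.

(** The Taylor coefficients are recovered by the functional LL from the partial sums,
    which are within M 2^-N of 0. *)
Lemma expansion_zero rho M c (f : C -> C -> C) delta : 0 < rho -> expansion rho M c f ->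
  0 < delta -> (forall a b, md a < delta -> md b < delta -> f a b = 0) ->
  forall m n, c m n = 0.
Proof.
move=> r0 [_ hf] d0 hz m n.
(* boundary points of the square have modulus at most 2, so r z stays where f vanishes *)
pose r := Num.min delta (rho / 2) / 4.
have hmin : 0 < Num.min delta (rho / 2) by rewrite lt_min d0 divr_gt0.
have rp : 0 < r by rewrite divr_gt0.
have mr : md (r%:C : C) = r by rewrite md_real gtr0_norm.
have small (z : C) : gam z -> md (r%:C * z) < delta /\ md (r%:C * z) <= rho / 2.
  move=> /gam_bigsq /bigsq_md hz2; rewrite mdM mr.
  have h1 : Num.min delta (rho / 2) <= delta by rewrite ge_min lexx.
  have h2 : Num.min delta (rho / 2) <= rho / 2 by rewrite ge_min lexx orbT.
  have h3 : r * md z <= Num.min delta (rho / 2) / 2.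
    apply: (@le_trans _ _ (r * 2)); first by rewrite ler_wpM2l // ltW.
    by rewrite /r; lra.
  by move: hmin h1 h2 h3; move: (Num.min _ _) (r * md z) => x y ? ? ? ?; split; lra.
pose d i j := c i j * r%:C ^+ (i + j).
suff h : d m n = 0.
  move/eqP: h; rewrite mulf_eq0 => /orP[/eqP //|].
  by rewrite expf_eq0 -md_eq0 mr gt_eqF // andbF.
apply/eqP; rewrite -md_eq0; apply/eqP; apply: (@le_geom0 _ _ (4 * M)); first exact: md_ge0.
move=> N0; pose N := (N0 + (m + n).+1)%N.
have hm : (m < N)%N by rewrite /N addnS ltnS addnA addnAC leq_addl.
have hn : (n < N)%N by rewrite /N addnS ltnS addnA leq_addl.
rewrite -(LL_monomials d hm hn).
have M0 : 0 <= M.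
  have := hf 0 0 0%N; rewrite md0 expr0 divr1 => h; apply: le_trans (md_ge0 _) (h _ _);
  by rewrite divr_ge0 // ltW.
have hb : bd2 (fun z w => psum d N z w) (M / 2 ^+ N).
  move=> z w gz gw; have [z1 z2] := small z gz; have [w1 w2] := small w gw.
  have := hf _ _ N z2 w2; rewrite hz // sub0r mdN.
  have -> : psum c N (r%:C * z) (r%:C * w) = psum d N z w.
    apply: eq_bigr => i _; apply: eq_bigr => j _; rewrite /d !exprMn exprD; ring.
  by [].
apply: le_trans (LL_bound (bd2M hb (invpow2_bound m.+1 n.+1))) _.
rewrite mulr1 mulrA ler_wpM2l ?mulr_ge0 // lef_pV2 ?posrE ?pow2_gt0 //.
by rewrite ler_eXn2l ?ltr1n // leq_addr.
Qed.

(** Commutation multiplies the coefficient of index (m, n) in component k by al^(m, n) -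
    al k, and the resulting series vanishes. *)
Lemma commuting_zero (E : K2 -> K2) (al : 'I_2 -> C) (delta : R) : holo E -> frechet E 0 0 ->
  (forall k i j, (2 <= i + j)%N -> al 0 ^+ i * al 1 ^+ j != al k) ->
  0 < delta -> (forall z, mdv z < delta -> E (diag2 al *m z) = diag2 al *m E z) ->
  exists2 r : R, 0 < r & forall z, mdv z < r -> E z = 0.
Proof.
move=> hE hE0 hal d0 hcom.
have [rho [M [c [r0 M0 _ hc2 hc]]]] := nonlinear_expansion hE hE0.
have hcE k : expansion rho M (c k) (fun a b => E (vec a b) k 0).
  by have := hc k; rewrite (_ : (fun a b => (E (vec a b) - 0 *m vec a b) k 0) = (fun a b => E (vec a b) k 0)) //;
  apply/funext => a; apply/funext => b; rewrite mul0mx subr0.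
(* diag2 al dilates by at most A, so the series of the composition is controlled at radius rho / A *)
pose A := Num.max 1 (Num.max (md (al 0)) (md (al 1))).
have A1 : 1 <= A by rewrite le_max lexx.
have Ak k : md (al k) <= A by move: k; apply: ord2P; rewrite !le_max lexx !orbT.
have A0 : 0 < A by lra.
have c0 k m n : c k m n = 0.
  have [h|h] := ltnP (m + n) 2; first exact: hc2.
  have := hal k _ _ h; rewrite -subr_eq0 => nz.
  suff : c k m n * (al 0 ^+ m * al 1 ^+ n - al k) = 0.
    by move=> /eqP; rewrite mulf_eq0 (negbTE nz) orbF => /eqP.
  pose c' m n := c k m n * (al 0 ^+ m * al 1 ^+ n - al k).
  pose g a b := E (vec (al 0 * a) (al 1 * b)) k 0 - al k * E (vec a b) k 0.
  apply: (@expansion_zero (rho / A) (M * (1 + A)) c' g delta); rewrite ?divr_gt0 //.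
    have [cb cr] := hcE k; split.
      move=> i j; rewrite mdM expr_div_n invf_div.
      have -> : M * (1 + A) * (A ^+ (i + j) / rho ^+ (i + j)) = M / rho ^+ (i + j) * ((1 + A) * A ^+ (i + j)) by ring.
      apply: ler_pM; rewrite ?md_ge0 //; apply: le_trans (mdBD _ _) _.
      have e1 : md (al 0 ^+ i * al 1 ^+ j) <= A ^+ (i + j).
        rewrite mdM !mdX exprD; apply: ler_pM; rewrite ?exprn_ge0 ?md_ge0 //; apply: lerXn2r;
        by rewrite ?nnegrE ?md_ge0 ?Ak // ltW.
      have e2 : 1 <= A ^+ (i + j) by rewrite exprn_ege1.
      have e3 := Ak k; rewrite mulrDl mul1r; apply: lerD => //.
      by apply: le_trans e3 _; rewrite ler_peMr // ltW.
    move=> a b N ha hb.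
    have sm x k' : md x <= rho / A / 2 -> md (al k' * x) <= rho / 2.
      move=> hx; rewrite mdM; apply: (@le_trans _ _ (A * (rho / A / 2))).
        by apply: ler_pM; rewrite ?md_ge0.
      by rewrite le_eqVlt; apply/orP; left; apply/eqP; field; rewrite gt_eqF.
    have sm1 x : md x <= rho / A / 2 -> md x <= rho / 2.
      move=> hx; apply: le_trans hx _; rewrite ler_pM2r // ler_pdivrMr //.
      by rewrite ler_peMr // ltW.
    have -> : g a b - psum c' N a b = (E (vec (al 0 * a) (al 1 * b)) k 0 - psum (c k) N (al 0 * a) (al 1 * b))
        - al k * (E (vec a b) k 0 - psum (c k) N a b).
      have -> : psum c' N a b = psum (c k) N (al 0 * a) (al 1 * b) - al k * psum (c k) N a b.
        rewrite /psum mulr_sumr -sumrB; apply: eq_bigr => i _; rewrite mulr_sumr -sumrB.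
        by apply: eq_bigr => j _; rewrite /c' !exprMn; ring.
      by rewrite /g; ring.
    apply: le_trans (mdBD _ _) _; rewrite mdM.
    have -> : M * (1 + A) / 2 ^+ N = M / 2 ^+ N + A * (M / 2 ^+ N) by ring.
    apply: lerD; first by apply: cr; apply: sm.
    by apply: ler_pM; rewrite ?md_ge0 //; apply: cr; apply: sm1.
  move=> a b ha hb; rewrite /g; have := hcom (vec a b).
  rewrite mdv_lt vec0E vec1E ha hb => /(_ isT).
  have -> : diag2 al *m vec a b = vec (al 0 * a) (al 1 * b).
    by apply: vecP; rewrite diag2E !(vec0E, vec1E).
  by move=> ->; rewrite diag2E subrr.
exists (rho / 2); first by rewrite divr_gt0.
move=> z hz; have zE k : E z k 0 = 0.
  apply/eqP; rewrite -md_eq0; apply/eqP; apply: (@le_geom0 _ _ M); first exact: md_ge0.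
  move=> N; have := (hcE k).2 (z 0 0) (z 1 0) N; rewrite -vec_eta.
  have -> : psum (c k) N (z 0 0) (z 1 0) = 0.
    by rewrite /psum big1 // => i _; rewrite big1 // => j _; rewrite c0 mul0r.
  by rewrite subr0; apply; apply: le_trans (mdv_entry _ _) (ltW hz).
by apply: vecP; rewrite zE mxE.
Qed.

End SiegelDiagonal.

(** * Calculus of germs *)

Section Germs.
Variable R : realType.
Local Notation C := R[i].
Local Notation K2 := 'cV[C]_2.
Local Notation M2 := 'M[C]_2.
Implicit Types (F H : K2 -> K2) (z : K2).

(** Validity near 0, as near0P spells it out. *)
Definition loc (P : K2 -> Prop) := exists2 e : R, 0 < e & forall z, mdv z < e -> P z.

Lemma locS (P Q : K2 -> Prop) : (forall z, P z -> Q z) -> loc P -> loc Q.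
Proof. by move=> h [e e0 he]; exists e => // z /he/h. Qed.

Lemma locI (P Q : K2 -> Prop) : loc P -> loc Q -> loc (fun z => P z /\ Q z).
Proof.
move=> [d d0 hd] [e e0 he]; exists (Num.min d e); first by rewrite lt_min d0.
by move=> z; rewrite lt_min => /andP[/hd ? /he].
Qed.

Lemma loc_all (I : eqType) (s : seq I) (P : I -> K2 -> Prop) :
  (forall i, i \in s -> loc (P i)) -> loc (fun z => forall i, i \in s -> P i z).
Proof.
elim: s => [|i s ih] h; first by exists 1.
have hi : loc (P i) by apply: h; rewrite mem_head.
have hs : loc (fun z => forall j, j \in s -> P j z).
  by apply: ih => j js; apply: h; rewrite inE js orbT.
apply: locS (locI hi hs) => z [pi ps] j.
by rewrite inE => /orP[/eqP ->|/ps].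
Qed.

Lemma loc_lin (A : M2) (P : K2 -> Prop) : loc P -> loc (fun z => P (A *m z)).
Proof.
move=> [e e0 he]; have hA := opn_ge0 A.
exists (e / (opn A + 1)); first by rewrite divr_gt0 //; lra.
move=> z hz; apply: he; apply: le_lt_trans (mdv_mul _ _) _.
apply: le_lt_trans (_ : (opn A + 1) * mdv z < e); first by rewrite ler_wpM2r ?mdv_ge0 //; lra.
by rewrite mulrC -ltr_pdivlMr //; lra.
Qed.

Lemma frechet_comp F H z A B : frechet F z A -> frechet H (F z) B ->
  frechet (fun z => H (F z)) z (B *m A).
Proof.
move=> hF hH e e0; have hA := opn_ge0 A; have hB := opn_ge0 B.
have a0 : 0 < opn A + 1 by lra.
have b0 : 0 < opn B + 1 by lra.
pose e1 := e / 2 / (opn A + 1); have e10 : 0 < e1 by rewrite !divr_gt0.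
pose e2 := Num.min 1 (e / 2 / (opn B + 1)).
have e20 : 0 < e2 by rewrite lt_min ltr01 !divr_gt0.
have [d1 d10 h1] := hH _ e10; have [d2 d20 h2] := hF _ e20.
exists (Num.min d2 (d1 / (opn A + 1))); first by rewrite lt_min d20 divr_gt0.
move=> h; rewrite lt_min => /andP[hd2 hd1]; have m0 := mdv_ge0 h.
have {}h2 := h2 h hd2; pose k := F (h + z) - F z.
have hk : mdv k <= (opn A + 1) * mdv h.
  rewrite -(subrK (A *m h) k) mulrDl mul1r; apply: le_trans (mdvD _ _) _.
  rewrite addrC lerD ?mdv_mul //; apply: le_trans h2 _.
  by rewrite ler_piMl // ge_min lexx.
have kd : mdv k < d1.
  by apply: le_lt_trans hk _; rewrite mulrC -ltr_pdivlMr.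
have {h1} := h1 k kd; rewrite /k subrK -/k => h1.
rewrite (_ : _ - _ - _ = H (F (h + z)) - H (F z) - B *m k + B *m (k - A *m h)); last first.
  by rewrite (mulmxBr B k (A *m h)) mulmxA subrKA.
apply: le_trans (mdvD _ _) _.
have t1 : e1 * mdv k <= e / 2 * mdv h.
  apply: le_trans (_ : e1 * ((opn A + 1) * mdv h) <= _); first by rewrite ler_pM2l.
  by rewrite mulrA divfK ?gt_eqF.
have t2 : mdv (B *m (k - A *m h)) <= e / 2 * mdv h.
  apply: le_trans (mdv_mul _ _) _.
  apply: le_trans (_ : (opn B + 1) * (e2 * mdv h) <= _).
    by apply: ler_pM => //; rewrite ?mdv_ge0 //; lra.
  rewrite mulrA ler_wpM2r // mulrC -ler_pdivlMr //.
  by rewrite ge_min lexx orbT.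
by move: h1 t1 t2; clear; lra.
Qed.

Lemma frechetD F H z A B : frechet F z A -> frechet H z B ->
  frechet (fun z => F z + H z) z (A + B).
Proof.
move=> hF hH e e0; have e2 : 0 < e / 2 by rewrite divr_gt0.
have [d d0 hd] := hF _ e2; have [d' d'0 hd'] := hH _ e2.
exists (Num.min d d'); first by rewrite lt_min d0.
move=> h; rewrite lt_min => /andP[/hd h1 /hd' h2].
rewrite mulmxDl (_ : _ - _ - _ = (F (h + z) - F z - A *m h) + (H (h + z) - H z - B *m h)); last first.
  by rewrite !opprD [in RHS]addrACA; congr (_ + _); rewrite addrACA.
by apply: le_trans (mdvD _ _) _; rewrite [e]splitr mulrDl lerD.
Qed.

Lemma frechet_sum (I : Type) (s : seq I) (f : I -> K2 -> K2) (A : I -> M2) z :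
  (forall i, frechet (f i) z (A i)) ->
  frechet (fun z => \sum_(i <- s) f i z) z (\sum_(i <- s) A i).
Proof.
move=> hf; elim: s => [|i s ih].
  rewrite big_nil => e e0; exists 1 => // h _.
  by rewrite !big_nil mul0mx !subr0 mdv0 mulr_ge0 ?mdv_ge0 // ltW.
rewrite big_cons; apply: (@frechet_near _ (fun z => f i z + \sum_(j <- s) f j z) _ _ _ 1 ltr01).
  by move=> h _; rewrite big_cons.
exact: frechetD.
Qed.

Lemma frechet_loc F H A : loc (fun z => F z = H z) -> frechet F 0 A -> frechet H 0 A.
Proof.
move=> [e e0 he]; apply: (@frechet_near _ _ _ _ _ e) => // h hh.
by rewrite addr0 he.
Qed.

Lemma holo0 F : holo F -> F 0 = 0. Proof. by case. Qed.

Lemma holo_frechet F : holo F -> exists A, frechet F 0 A.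
Proof. by move=> [_ [e e0 h]]; apply: h; rewrite mdv0. Qed.

Lemma holomorphic_germP F : holomorphic_germ F <-> holo F.
Proof.
split=> -[F0 h]; split=> //.
  have /near0P[e e0 he] := h; exists e => // z /he hz.
  by exists (diffmx F z); apply: diff_frechet.
by apply/near0P; have [e e0 he] := h; exists e => // z /he [A /frechet_diff[]].
Qed.

Lemma germ_eqP F H : germ_eq F H <-> loc (fun z => F z = H z).
Proof. exact: (near0P (fun z => F z = H z)). Qed.

Lemma holo_jac F : holo F -> frechet F 0 (jac F).
Proof. by move=> /holo_frechet[A hA]; rewrite (frechet_jac hA). Qed.

Lemma loc_holo F (P : K2 -> Prop) : holo F -> loc P -> loc (fun z => P (F z)).
Proof.
move=> hF [e e0 he]; have [A hA] := holo_frechet hF.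
have e2 : 0 < e / 2 by rewrite divr_gt0.
have [d d0 hd] := frechet_cont hA e2; exists d => // z /hd.
rewrite addr0 (holo0 hF) subr0 => h; apply: he; apply: le_lt_trans h _.
by move: e0; clear; lra.
Qed.

Lemma holo_comp F H : holo F -> holo H -> holo (fun z => H (F z)).
Proof.
move=> hF hH; split; first by rewrite (holo0 hF) (holo0 hH).
have lH : loc (fun z => exists A, frechet H z A) by case: hH.
have lF : loc (fun z => exists A, frechet F z A) by case: hF.
apply: locS (locI lF (loc_holo hF lH)) => z [[A hA] [B hB]].
by exists (B *m A); apply: frechet_comp.
Qed.

Lemma holo_lin (A : M2) : holo (mulmx A).
Proof. by split; [rewrite mulmx0|exists 1 => // z _; exists A; apply: frechet_lin]. Qed.

Lemma holoB F H : holo F -> holo H -> holo (fun z => F z - H z).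
Proof.
move=> [F0 hF] [H0 hH]; split; first by rewrite F0 H0 subr0.
apply: locS (locI hF hH) => z [[A hA] [B hB]].
by exists (A - B); apply: frechetB.
Qed.

Lemma holo_sum (I : Type) (s : seq I) (f : I -> K2 -> K2) :
  (forall i, holo (f i)) -> holo (fun z => \sum_(i <- s) f i z).
Proof.
move=> hf; split; first by rewrite big1 // => i _; apply: holo0.
elim: s => [|i s ih].
  exists 1 => // z _; exists 0; apply: (@frechet_near _ (mulmx 0) _ _ _ 1) => //.
    by move=> h _; rewrite big_nil mul0mx.
  exact: frechet_lin.
have [_ lF] := hf i.
apply: locS (locI lF ih) => z [[A hA] [B hB]]; exists (A + B).
apply: (@frechet_near _ (fun z => f i z + \sum_(j <- s) f j z) _ _ _ 1 ltr01).
  by move=> h _; rewrite big_cons.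
exact: frechetD.
Qed.

Lemma frechet_id z : frechet id z 1%:M.
Proof.
apply: (@frechet_near _ (mulmx 1%:M) _ _ _ 1) => //; last exact: frechet_lin.
by move=> h _; rewrite mul1mx.
Qed.

(** The right inverse K of H has itself a right inverse, which must be H. *)
Lemma two_sided H : holo H -> frechet H 0 1%:M -> exists K, [/\ holo K, frechet K 0 1%:M,
  loc (fun z => H (K z) = z) & loc (fun z => K (H z) = z)].
Proof.
move=> hH dH; have [K [hK dK HK]] := right_inverse hH dH.
have [L [hL dL KL]] := right_inverse hK dK.
exists K; split=> //.
have HL : loc (fun z => L z = H z).
  by apply: locS (locI KL (loc_holo hL HK)) => z [e1]; rewrite e1 => <-.
by apply: locS (locI HL KL) => z [<-].
Qed.

(** The chain rule at 0. *)
Lemma jac_unit F H : holo F -> holo H -> loc (fun z => H (F z) = z) ->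
  jac H *m jac F = 1%:M.
Proof.
move=> hF hH h; apply: (@frechet_unique _ _ 0) (frechet_id 0).
apply: frechet_loc h _; apply: frechet_comp; first exact: holo_jac.
by rewrite (holo0 hF); apply: holo_jac.
Qed.

Lemma holo_lin_comp F A B : holo F -> holo (fun z => A *m F (B *m z)).
Proof.
move=> hF; apply: (@holo_comp (fun z => F (B *m z))) (holo_lin A).
exact: holo_comp (holo_lin B) hF.
Qed.

Lemma frechet_lin_comp F A B M : frechet F 0 M ->
  frechet (fun z => A *m F (B *m z)) 0 (A *m (M *m B)).
Proof.
move=> dF; apply: (@frechet_comp (fun z => F (B *m z))); last exact: frechet_lin.
by apply: frechet_comp; [apply: frechet_lin|rewrite mulmx0].
Qed.
End Germs.

(** * Matrices in SU(2) *)

Section Quaternions.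
Variable R : realType.
Local Notation C := R[i].
Local Notation K2 := 'cV[C]_2.
Local Notation M2 := 'M[C]_2.
Local Notation cj x := (Num.conj (x : C)).
Implicit Types (A B g h N X : M2).

Lemma mx2P A B : A 0 0 = B 0 0 -> A 0 1 = B 0 1 -> A 1 0 = B 1 0 -> A 1 1 = B 1 1 -> A = B.
Proof.
move=> h00 h01 h10 h11; apply/matrixP => i j.
by move: i; apply: ord2P; move: j; apply: ord2P.
Qed.

Lemma mulmx2E A B i j : (A *m B) i j = A i 0 * B 0 j + A i 1 * B 1 j.
Proof.
rewrite mxE !big_ord_recl big_ord0 addr0.
by congr (_ + A i _ * B _ j); apply: val_inj.
Qed.

Lemma det2E A : \det A = A 0 0 * A 1 1 - A 0 1 * A 1 0.
Proof.
rewrite (expand_det_row A 0) !big_ord_recl big_ord0 addr0 /cofactor !det_mx11 !mxE /=.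
have e1 : lift 0 0 = 1 :> 'I_2 by apply: val_inj.
have e0 : lift 1 0 = 0 :> 'I_2 by apply: val_inj.
rewrite e1 e0 /= expr0 expr1 mul1r mulN1r mulrN.
by congr (_ - _ * A _ _); apply: val_inj.
Qed.

Lemma tr2E A : \tr A = A 0 0 + A 1 1.
Proof.
rewrite /mxtrace !big_ord_recl big_ord0 addr0.
by congr (_ + A _ _); apply: val_inj.
Qed.

Lemma scalar2E (c : C) : let S := c%:M : M2 in
  [/\ S 0 0 = c, S 0 1 = 0, S 1 0 = 0 & S 1 1 = c].
Proof. by move=> S; rewrite /S !mxE. Qed.

(** The shape of the real multiples of SU(2) matrices, that is of the quaternions;
    unlike SU(2) it is stable under subtraction. *)
Definition quaternion A := A 1 1 = cj (A 0 0) /\ A 1 0 = - cj (A 0 1).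

(** The inverse of g is both its adjugate and its conjugate transpose. *)
Lemma SU2_quaternion g : g \is unitarymx -> \det g = 1 -> quaternion g.
Proof.
move=> /unitarymxP gu dg.
have e00 := congr1 (fun M : M2 => M 0 0) gu; have e01 := congr1 (fun M : M2 => M 0 1) gu.
have e10 := congr1 (fun M : M2 => M 1 0) gu; have e11 := congr1 (fun M : M2 => M 1 1) gu.
have [s00 s01 s10 s11] := scalar2E 1.
move: e00 e01 e10 e11; rewrite !mulmx2E s00 s01 s10 s11 !mxE => e00 e01 e10 e11.
move: dg; rewrite det2E /quaternion.
move: e00 e01 e10 e11; rewrite /=.
move: (cj (g 0 0)) (cj (g 0 1)) (cj (g 1 0)) (cj (g 1 1)).
move: (g 0 0) (g 0 1) (g 1 0) (g 1 1); clear => a b c d a' b' c' d' e00 e01 e10 e11 dt.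
split.
  transitivity (d * (a * a' + b * b')); first by rewrite e00 mulr1.
  transitivity (a' * (a * d - b * c) + b * (c * a' + d * b')); first by ring.
  by rewrite dt e10 mulr1 mulr0 addr0.
transitivity (c * (a * a' + b * b')); first by rewrite e00 mulr1.
transitivity (a * (c * a' + d * b') - b' * (a * d - b * c)); first by ring.
by rewrite dt e10 mulr1 mulr0 add0r.
Qed.

Lemma quaternionB A B : quaternion A -> quaternion B -> quaternion (A - B).
Proof.
move=> [a1 a2] [b1 b2]; rewrite /quaternion !mxE a1 a2 b1 b2 !rmorphB.
by split=> //; rewrite !opprB opprK addrC.
Qed.

(** The determinant is a sum of two squared moduli. *)
Lemma quaternion_det0 A : quaternion A -> \det A = 0 -> A = 0.
Proof.
move=> [a1 a2]; rewrite det2E a1 a2 mulrN opprK => /eqP.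
rewrite paddr_eq0 ?mul_conjC_ge0 // !mul_conjC_eq0 => /andP[/eqP a0 /eqP b0].
by apply: mx2P; rewrite ?a1 ?a2 ?a0 ?b0 ?rmorph0 ?oppr0 !mxE.
Qed.

Lemma SU2_sub_unit g h : g \is unitarymx -> \det g = 1 -> h \is unitarymx -> \det h = 1 ->
  g != h -> g - h \in unitmx.
Proof.
move=> gu dg hu dh; apply: contraR; rewrite unitmxE unitfE negbK => /eqP d0.
rewrite -subr_eq0; apply/eqP; apply: quaternion_det0 d0.
by apply: quaternionB; apply: SU2_quaternion.
Qed.

(** A traceless X commuting with a nonzero nilpotent matrix is a multiple of it. *)
Lemma commuting_nilpotent_det N X : N != 0 -> N *m N = 0 -> \tr X = 0 -> X *m N = N *m X ->
  \det X = 0.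
Proof.
move=> N0 NN trX XN.
have n00 := congr1 (fun M : M2 => M 0 0) NN; have n01 := congr1 (fun M : M2 => M 0 1) NN.
have n10 := congr1 (fun M : M2 => M 1 0) NN; have n11 := congr1 (fun M : M2 => M 1 1) NN.
have x00 := congr1 (fun M : M2 => M 0 0) XN; have x01 := congr1 (fun M : M2 => M 0 1) XN.
have x10 := congr1 (fun M : M2 => M 1 0) XN.
move: n00 n01 n10 n11 x00 x01 x10 trX; rewrite !mulmx2E tr2E det2E !mxE.
have : ~ [/\ N 0 0 = 0, N 0 1 = 0, N 1 0 = 0 & N 1 1 = 0].
  by move=> [h0 h1 h2 h3]; case/eqP: N0; apply: mx2P; rewrite mxE.
move: (N 0 0) (N 0 1) (N 1 0) (N 1 1) (X 0 0) (X 0 1) (X 1 0) (X 1 1).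
clear => n m p q x y z w nz n00 n01 n10 n11 x00 x01 x10 /eqP; rewrite addr_eq0 => /eqP ew.
have z2 (a : C) : a * a = 0 -> a = 0 by move=> /eqP; rewrite mulf_eq0 orbb => /eqP.
have [m0|m0] := eqVneq m 0.
  have n0 : n = 0 by apply: z2; rewrite -n00 m0; ring.
  have q0 : q = 0 by apply: z2; rewrite -n11 m0; ring.
  have [p0|p0] := eqVneq p 0; first by case: nz.
  have y0 : y = 0.
    have : y * p = 0.
      transitivity ((x * n + y * p) - n * x); first by ring.
      by rewrite x00 m0; ring.
    by move=> /eqP; rewrite mulf_eq0 (negPf p0) orbF => /eqP.
  have x0 : x = 0.
    have : 2 * (x * p) = 0.
      transitivity ((p * x + q * z) - (z * n + w * p)); last by rewrite x10 subrr.
      by rewrite ew n0 q0; ring.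
    by move=> /eqP; rewrite !mulf_eq0 (negPf p0) orbF pnatr_eq0 => /eqP.
  by rewrite x0 y0; ring.
have /eqP : m * (n + q) = 0 by rewrite -n01; ring.
rewrite mulf_eq0 (negPf m0) addrC addr_eq0 /= => /eqP eq.
have mx : m * x = n * y.
  have : 2 * (m * x - n * y) = 0.
    transitivity ((x * m + y * q) - (n * y + m * w)); last by rewrite x01 subrr.
    by rewrite eq -[w]opprK -ew; ring.
  by move=> /eqP; rewrite mulf_eq0 pnatr_eq0 subr_eq0 => /eqP.
have mz : m * z = y * p by apply: (addrI (n * x)); rewrite -x00; ring.
have /eqP : m ^+ 2 * (x * w - y * z) = 0.
  transitivity (- (m * x) ^+ 2 - m * y * (m * z)); first by rewrite -[w]opprK -ew; ring.
  rewrite mx mz; transitivity (- y ^+ 2 * (n * n + m * p)); first by ring.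
  by rewrite n00 mulr0.
by rewrite mulf_eq0 expf_eq0 (negPf m0) => /eqP.
Qed.

(** The trace of a quaternion is real, so the traceless part of g is again a quaternion;
    it commutes with N, hence has determinant 0, hence vanishes. *)
Lemma SU2_commuting_nilpotent N g : N != 0 -> N *m N = 0 -> g \is unitarymx -> \det g = 1 ->
  g *m N = N *m g -> g = 1%:M \/ g = - 1%:M.
Proof.
move=> N0 NN gu dg gN; have [q1 q2] := SU2_quaternion gu dg.
pose c := (g 0 0 + g 1 1) / 2; have [c00 c01 c10 c11] := scalar2E c.
have cc : cj c = c.
  have q3 : cj (g 1 1) = g 0 0 by rewrite q1; apply: conjCK.
  transitivity ((cj (g 0 0) + cj (g 1 1)) / 2); last by rewrite q3 -q1 addrC.
  by rewrite /c rmorphM rmorphD fmorphV rmorph_nat.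
have X0 : g - c%:M = 0.
  apply: quaternion_det0.
    apply: quaternionB => //; rewrite /quaternion c00 c01 c10 c11 cc.
    by rewrite rmorph0 oppr0.
  apply: (commuting_nilpotent_det N0 NN); last by rewrite mulmxBl mulmxBr gN scalar_mxC.
  have h i : (g - c%:M) i i = g i i - c by rewrite !mxE eqxx.
  by rewrite tr2E !h /c; field.
have gc : g = c%:M by apply/eqP; rewrite -subr_eq0 X0.
have : c ^+ 2 = 1 by rewrite -dg gc det_scalar.
move=> /eqP; rewrite sqrf_eq1 => /orP[] /eqP e; [left|right]; rewrite gc e //.
by rewrite raddfN.
Qed.

Lemma nilpotent_shift_exp (a : C) N k : N *m N = 0 ->
  (a%:M + N) ^+ k.+1 = (a ^+ k.+1)%:M + (k.+1%:R * a ^+ k) *: N.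
Proof.
move=> NN; elim: k => [|k ih]; first by rewrite !expr1 expr0 mulr1 scale1r.
rewrite exprS ih -mulmxE mulmxDl !mulmxDr -scalar_mxM -exprS -!scalemxAr NN scaler0 addr0.
rewrite -addrA; congr (_ + _).
rewrite mul_scalar_mx scalerA mul_mx_scalar -scalerDl; congr (_ *: _).
by rewrite [in RHS]mulrS mulrDl mul1r exprS; ring.
Qed.

(** The power is a scalar plus a nonzero multiple of N. *)
Lemma commute_power_nilpotent (a : C) N g k : a != 0 -> N *m N = 0 ->
  (a%:M + N) ^+ k.+1 *m g = g *m (a%:M + N) ^+ k.+1 -> g *m N = N *m g.
Proof.
move=> a0 NN; rewrite nilpotent_shift_exp // mulmxDl mulmxDr scalar_mxC => /addrI.
rewrite -scalemxAl -scalemxAr => /scalerI -> //.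
by rewrite mulf_neq0 ?pnatr_eq0 // expf_neq0.
Qed.

(** Distinct eigenvalues would make J diagonalizable, and N^2 = 0 is the Cayley-Hamilton
    theorem for a double eigenvalue. *)
Lemma nondiagonalizable (J : M2) : ~~ `[< diagonalizable J >] ->
  exists a N, [/\ J = a%:M + N, N != 0 & N *m N = 0].
Proof.
move=> nd; have [rs ers] := closed_field_poly_normal (char_poly J).
have := size_char_poly J; rewrite ers (monicP (char_poly_monic J)) scale1r.
rewrite size_prod_XsubC; case: rs ers => [|a [|b [|]]] // ers _.
move: ers; rewrite (monicP (char_poly_monic J)) scale1r => ers.
have [ab|ab] := eqVneq a b; last first.
  case/negP: nd; apply/asboolP/diagonalizableP; exists [:: a; b]; first by rewrite /= inE ab.
  by rewrite -ers mxminpoly_dvd_char.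
exists a, (J - a%:M); rewrite addrC subrK; split=> //.
  apply: contra nd; rewrite subr_eq0 => /eqP ->; apply/asboolP; exact: diagonalizable_scalar.
have := Cayley_Hamilton J; rewrite ers !big_cons big_nil mulr1 -ab rmorphM rmorphB /=.
by rewrite horner_mx_X horner_mx_C.
Qed.
End Quaternions.

(** * Germs that are linear up to a finite choice *)

Section PiecewiseLinear.
Variable R : realType.
Local Notation C := R[i].
Local Notation K2 := 'cV[C]_2.
Local Notation M2 := 'M[C]_2.
Implicit Types (f : K2 -> K2) (A h : M2) (S : seq M2).

Lemma frechet_small f A e : f 0 = 0 -> frechet f 0 A -> 0 < e ->
  loc (fun z => mdv (f z - A *m z) <= e * mdv z).
Proof. by move=> f0 fA /fA[d d0 hd]; exists d => // z /hd; rewrite addr0 f0 subr0. Qed.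

(** The polynomial p A in x has the four entries of A as coefficients, and vanishes at x
    if A kills the vector (1, x). A product of finitely many nonzero polynomials has a
    nonroot. *)
Lemma direction_avoiding_kernels S : (forall A, A \in S -> A != 0) ->
  exists v : K2, forall A, A \in S -> A *m v != 0.
Proof.
pose p A : {poly C} := (A 0 0)%:P + (A 0 1)%:P * 'X + ((A 1 0)%:P + (A 1 1)%:P * 'X) * 'X^2.
have p0 A : A != 0 -> p A != 0.
  apply: contra => /eqP pA; have c i : (p A)`_i = 0 by rewrite pA coef0.
  apply/eqP; apply: mx2P; rewrite mxE; [rewrite -(c 0)|rewrite -(c 1)|rewrite -(c 2)|rewrite -(c 3)];
    by rewrite /p !(coefD, coefMXn, coefMX, coefC) /= ?addr0 ?add0r.
move=> hS; have : \prod_(A <- S) p A != 0.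
  by rewrite prodf_seq_neq0; apply/allP => A /hS/p0 ->.
case/closed_nonrootP=> x; rewrite /root horner_prod prodf_seq_neq0 => /allP hx.
exists (vec 1 x) => A /hx /=; apply: contra => /eqP Ax.
have e0 := congr1 (fun v : K2 => v 0 0) Ax; have e1 := congr1 (fun v : K2 => v 1 0) Ax.
move: e0 e1; rewrite /= !mul2E vec0E vec1E !mxE !mulr1 /p !hornerE /= => -> ->.
by rewrite !mul0r addr0.
Qed.

(** If A were not in S, each h - A would move a common direction v at a definite rate,
    which the germ f, tangent to A, cannot match on small multiples of v. *)
Lemma linear_part_mem S f A : f 0 = 0 -> frechet f 0 A ->
  loc (fun z => exists2 h, h \in S & f z = h *m z) -> A \in S.
Proof.
move=> f0 fA hS; apply: contraT => AS.
have [|v hv] := @direction_avoiding_kernels [seq h - A | h <- S].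
  by move=> _ /mapP[h hS' ->]; rewrite subr_eq0; apply: contraNneq AS => <-.
have {}hv h : h \in S -> 0 < mdv ((h - A) *m v).
  move=> hh; rewrite lt_def mdv_ge0 andbT; apply: contra (hv (h - A) (map_f _ hh)).
  by move=> /eqP m0; apply/eqP/mdv_eq0; rewrite m0.
have far : loc (fun z => forall h, h \in S -> forall t : R, 0 < t -> z = t%:C *: v -> f z != h *m z).
  apply: loc_all => h /hv c0; have m0 := mdv_ge0 v.
  have e0 : 0 < mdv ((h - A) *m v) / (2 * (mdv v + 1)).
    by rewrite divr_gt0 // mulr_gt0 //; lra.
  apply: locS (frechet_small f0 fA e0) => z + t t0 ez; rewrite {z}ez => fz.
  apply: contraTneq fz => ->; rewrite -ltNge -mulmxBl -scalemxAr !mdvZ md_real.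
  rewrite gtr0_norm // mulrCA ltr_pM2l //.
  rewrite mulrAC ltr_pdivrMr ?mulr_gt0 //; last by lra.
  by rewrite ltr_pM2l //; move: m0; clear; lra.
have [e e0 he] := locI far hS; have m0 := mdv_ge0 v.
pose t := e / (2 * (mdv v + 1)); have t0 : 0 < t by rewrite divr_gt0 // mulr_gt0 //; lra.
have [|nf [h hh fh]] := he (t%:C *: v).
  rewrite mdvZ md_real gtr0_norm // /t mulrAC ltr_pdivrMr ?mulr_gt0 //; last by lra.
  by rewrite ltr_pM2l //; move: m0; clear; lra.
by have := nf h hh t t0 erefl; rewrite fh eqxx.
Qed.

(** Where f z = h z with h different from A, invertibility of h - A gives |f z - A z| >=
    c |z|, against tangency, unless z = 0. *)
Lemma linear_of_piecewise_linear S f A : f 0 = 0 -> frechet f 0 A ->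
  (forall h, h \in S -> h != A -> h - A \in unitmx) ->
  loc (fun z => exists2 h, h \in S & f z = h *m z) -> loc (fun z => f z = A *m z).
Proof.
move=> f0 fA hS hf.
have far : loc (fun z => forall h, h \in S -> f z = h *m z -> f z = A *m z).
  apply: loc_all => h hh; have [->|hA] := eqVneq h A; first by exists 1.
  have u := hS h hh hA; have o0 := opn_ge0 (invmx (h - A)).
  have e0 : 0 < (2 * (opn (invmx (h - A)) + 1))^-1 by rewrite invr_gt0 mulr_gt0 //; lra.
  apply: locS (frechet_small f0 fA e0) => z + fz; rewrite fz -mulmxBl => le.
  suff -> : z = 0 by rewrite !mulmx0.
  have := mdv_mul (invmx (h - A)) ((h - A) *m z); rewrite mulKmx // => le'.
  have m0 := mdv_ge0 z; apply: mdv_eq0.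
  have : mdv z <= (opn (invmx (h - A)) + 1) * ((2 * (opn (invmx (h - A)) + 1))^-1 * mdv z).
    by apply: le_trans le' _; apply: ler_pM => //; rewrite ?mdv_ge0 //; lra.
  have o1 : opn (invmx (h - A)) + 1 != 0 by rewrite gt_eqF //; lra.
  rewrite invfM mulrA mulrCA mulfV // mulr1.
  by move: m0; clear; lra.
by apply: locS (locI far hf) => z [nf [h hh fh]]; apply: nf fh.
Qed.
End PiecewiseLinear.

(** * Linear part of an equivariant germ *)

Section EquivariantGerms.
Variable R : realType.
Local Notation C := R[i].
Local Notation K2 := 'cV[C]_2.
Local Notation M2 := 'M[C]_2.
Variables (G : {fset M2}) (F Finv : K2 -> K2).
Hypothesis GSU : finite_subgroup_SU2 G.
Hypothesis (hF : holo F) (hFinv : holo Finv).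
Hypothesis FK : loc (fun z => Finv (F z) = z).
Hypothesis equivF : forall g, g \in G ->
  loc (fun z => exists2 h, h \in G & F (g *m Finv z) = h *m z).
Local Notation J := (jac F).
Local Notation conj g := (J *m g *m invmx J).

Lemma jac_unitmx : J \in unitmx.
Proof. by have [] := mulmx1_unit (jac_unit hF hFinv FK). Qed.

Lemma jac_inverse : jac Finv = invmx J.
Proof.
have Ju := jac_unitmx; apply: (can_inj (mulmxK Ju)).
by rewrite mulVmx // (jac_unit hF hFinv FK).
Qed.

Lemma conj_frechet g : frechet (fun z => F (g *m Finv z)) 0 (conj g).
Proof.
rewrite -mulmxA; apply: (@frechet_comp _ (fun z => g *m Finv z)).
  apply: frechet_comp; last exact: frechet_lin.
  by rewrite -jac_inverse; apply: holo_jac.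
by rewrite (holo0 hFinv) mulmx0; apply: holo_jac.
Qed.

Lemma conj_fix0 g : F (g *m Finv 0) = 0.
Proof. by rewrite (holo0 hFinv) mulmx0 (holo0 hF). Qed.

Lemma conj_mem g : g \in G -> conj g \in G.
Proof. by move=> /equivF; apply: linear_part_mem (conj_fix0 g) (conj_frechet g). Qed.

Lemma conj_equivariant g : g \in G -> loc (fun z => F (g *m z) = conj g *m F z).
Proof.
move=> gG; have [GS _ _ _] := GSU.
have E : loc (fun z => F (g *m Finv z) = conj g *m z).
  apply: (linear_of_piecewise_linear (conj_fix0 g) (conj_frechet g)) (equivF gG) => h hG hn.
  have [[hu hd] [cu cd]] := (GS h hG, GS _ (conj_mem gG)).
  exact: SU2_sub_unit hu hd cu cd hn.
by apply: locS (locI FK (loc_holo hF E)) => z [e]; rewrite e.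
Qed.

Lemma conj_inj : injective (fun g => conj g).
Proof.
have Ju := jac_unitmx => g h /(can_inj (mulmxKV Ju)); exact: (can_inj (mulKmx Ju)).
Qed.

(** The orbit of g under conjugation by J stays in the finite set G, and conjugation is
    injective, so the orbit returns to g. *)
Lemma conj_periodic g : g \in G -> exists k, J ^+ k.+1 *m g = g *m J ^+ k.+1.
Proof.
move=> gG; have Ju := jac_unitmx; pose c i := iter i (fun g => conj g) g.
have cG i : c i \in G by elim: i => [|i ih] //=; apply: conj_mem.
have cJ i : J ^+ i *m g = c i *m J ^+ i.
  elim: i => [|i ih]; first by rewrite expr0 mul1mx mulmx1.
  by rewrite exprS -mulmxE -mulmxA ih /c iterS !mulmxA mulmxKV.
have : ~~ uniq [seq c i | i <- iota 0 #|` G|.+1].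
  apply/negP => u; have : (size [seq c i | i <- iota 0 #|` G|.+1] <= size (enum_fset G))%N.
    by apply: uniq_leq_size u _ => _ /mapP[i _ ->]; apply: cG.
  by rewrite size_map size_iota ltnn.
case/(uniqPn 0) => i [j [ij]]; rewrite size_map size_iota => jn.
rewrite !(nth_map 0%N) ?size_iota ?nth_iota //; try exact: ltn_trans jn.
rewrite !add0n -(subnKC ij) addSnnS => e.
suff e' : c (j - i.+1).+1 = g by exists (j - i.+1)%N; rewrite cJ e'.
move: (_ - _)%N e => k {cJ}; elim: i {ij jn} => [|i ih]; first by rewrite add0n.
by rewrite addSn /c !iterS => /conj_inj.
Qed.

(** A non-diagonalizable J is a scalar plus a nilpotent N, and every g in G commutes
    with N; this leaves only 1 and -1. *)
Lemma jac_diagonalizable : G <> [fset 1%:M]%fset -> #|` G|%fset <> 2%N -> diagonalizable J.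
Proof.
move=> G1 G2; apply: contrapT => nd; have Ju := jac_unitmx.
have [|a [N [eJ N0 NN]]] := @nondiagonalizable _ J; first by apply/asboolP.
have [GS G1' _ _] := GSU.
have a0 : a != 0.
  apply: contraNneq N0 => a0; rewrite -[N](mulKmx Ju) {2}eJ a0.
  by rewrite raddf0 add0r NN mulmx0.
have pm g : g \in G -> g = 1%:M \/ g = - 1%:M.
  move=> gG; have [gu dg] := GS g gG.
  have [k Jk] := conj_periodic gG; rewrite eJ in Jk.
  exact: SU2_commuting_nilpotent N0 NN gu dg (commute_power_nilpotent a0 NN Jk).
have [mG|mG] := boolP (- 1%:M \in G); last first.
  apply: G1; apply/fsetP => g; rewrite inE; apply/idP/eqP => [gG|->] //.
  by case: (pm g gG) => // e; rewrite e in gG; rewrite gG in mG.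
apply: G2; have -> : G = [fset 1%:M; - 1%:M]%fset.
  apply/fsetP => g; rewrite !inE; apply/idP/orP => [/pm[]->|[]/eqP ->] //; first by left.
  by right.
rewrite cardfs2; suff -> : 1%:M != - 1%:M :> M2 by [].
apply/eqP => /(congr1 (fun M : M2 => M 0 0)); rewrite !mxE /= => /eqP.
by rewrite -addr_eq0 (pnatr_eq0 _ 2).
Qed.
End EquivariantGerms.

(** * Linearization with a diagonalizable linear part *)

Section Linearization.
Variable R : realType.
Local Notation C := R[i].
Local Notation K2 := 'cV[C]_2.
Local Notation M2 := 'M[C]_2.
Implicit Types (F H K Phi Psi : K2 -> K2) (P J : M2).

Definition tangent_to_id F := holo F /\ frechet F 0 1%:M.

Lemma conjugated_to_diagonal P J : P \in unitmx -> similar_diag P J ->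
  exists al : 'I_2 -> C, P *m J *m invmx P = diag2 al.
Proof.
move=> Pu /(similar_diagP _ Pu) h; exists (fun i => (P *m J *m invmx P) i i).
by apply: mx2P; rewrite [RHS]mxE // h.
Qed.

Lemma diophantine_sym (a b : C) : diophantine a b -> diophantine b a.
Proof.
move=> [a0 b0 [k [c [k0 c0 h]]]]; split=> //; exists k, c; split=> // x m n hx mn.
by rewrite addnC [b ^+ m * _]mulrC; apply: h; [case: hx; [right|left]|rewrite addnC].
Qed.

(** Trace and determinant determine the two eigenvalues up to order. *)
Lemma diagonal_eigenvalues P J (al : 'I_2 -> C) a b : P \in unitmx ->
  P *m J *m invmx P = diag2 al -> char_poly J = ('X - a%:P) * ('X - b%:P) ->
  (al 0 = a /\ al 1 = b) \/ (al 0 = b /\ al 1 = a).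
Proof.
move=> Pu e cp.
have tr : al 0 + al 1 = a + b.
  have -> : al 0 + al 1 = \tr (diag2 al) by rewrite tr2E !mxE.
  rewrite -e mxtrace_mulC mulKmx // -[LHS]opprK -char_poly_trace // cp mulrBl.
  rewrite coefB coefXM coefCM !coefB !coefX !coefC /=.
  by rewrite subr0 sub0r mulr1; ring.
have dt : al 0 * al 1 = a * b.
  have -> : al 0 * al 1 = \det (diag2 al) by rewrite det2E !mxE /= mulr0 subr0.
  have := char_poly_det J; rewrite cp => h.
  rewrite -e !det_mulmx mulrAC -det_mulmx mulmxV // det1 mul1r.
  rewrite -[LHS]mul1r -(sqrr_sign C 1) expr1 -h mulrBl.
  rewrite coefB coefXM coefCM !coefB !coefX !coefC /=; ring.
have /eqP : (al 0 - a) * (al 0 - b) = 0.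
  transitivity (al 0 ^+ 2 - (a + b) * al 0 + a * b); first by ring.
  by rewrite -tr -dt; ring.
rewrite mulf_eq0 !subr_eq0 => /orP[] /eqP e0; [left|right]; split=> //.
  by apply: (addrI (al 0)); rewrite tr e0.
by apply: (addrI (al 0)); rewrite tr e0 addrC.
Qed.

Lemma linearizing_chart F P (al : 'I_2 -> C) : holo F -> P \in unitmx ->
  P *m jac F *m invmx P = diag2 al -> diophantine (al 0) (al 1) ->
  exists2 Phi, tangent_to_id Phi & loc (fun z => Phi (F z) = jac F *m Phi z).
Proof.
move=> hF Pu e dio.
pose F' z := P *m F (invmx P *m z).
have hF' : holo F' by exact: holo_lin_comp.
have dF' : frechet F' 0 (diag2 al).
  by rewrite -e -mulmxA; apply: frechet_lin_comp; apply: holo_jac.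
have [H' [hH' dH' HJ']] := siegel_diag hF' dF' dio.
pose H z := invmx P *m H' (P *m z).
have hH : holo H by exact: holo_lin_comp.
have dH : frechet H 0 1%:M.
  rewrite (_ : 1%:M = invmx P *m (1%:M *m P)); last by rewrite mul1mx mulVmx.
  exact: frechet_lin_comp.
have HJ : loc (fun z => F (H z) = H (jac F *m z)).
  apply: locS (loc_lin P HJ') => z; rewrite /F' => hz.
  have DP : diag2 al *m (P *m z) = P *m (jac F *m z).
    by rewrite -e -!mulmxA mulKmx.
  by apply: (can_inj (mulKmx Pu)); rewrite hz DP /H mulKVmx.
have [Phi [hPhi dPhi HPhi PhiH]] := two_sided hH dH.
exists Phi => //.
apply: locS (locI HPhi (locI (loc_holo hPhi HJ) (loc_holo hPhi (loc_lin (jac F) PhiH)))).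
by move=> z [e1 [e2 e3]]; rewrite -[in LHS]e1 e2 e3.
Qed.

(** In diagonal coordinates K - id is flat and commutes with the linear part; the
    Diophantine condition excludes resonances. *)
Lemma commuting_with_diagonalizable K P J (al : 'I_2 -> C) : tangent_to_id K -> P \in unitmx ->
  P *m J *m invmx P = diag2 al -> diophantine (al 0) (al 1) ->
  loc (fun z => K (J *m z) = J *m K z) -> loc (fun z => K z = z).
Proof.
move=> [hK dK] Pu e dio KJ; pose E z := P *m K (invmx P *m z) - z.
have hE : holo E.
  apply: (holoB (F := fun z => P *m K (invmx P *m z)) (H := id)).
    exact: holo_lin_comp.
  by split=> //; exists 1 => // z _; exists 1%:M; apply: frechet_id.
have dE : frechet E 0 0.
  rewrite (_ : 0 = P *m (1%:M *m invmx P) - 1%:M); last by rewrite mul1mx mulmxV ?subrr.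
  by apply: frechetB (frechet_id _); apply: frechet_lin_comp.
have nonres k i j : (2 <= i + j)%N -> al 0 ^+ i * al 1 ^+ j != al k.
  move=> ij; have [k0 [cc [k00 _ h]]] := diophantine_nat dio.
  have hk : al k = al 0 \/ al k = al 1 by move: k; apply: ord2P; [left|right].
  rewrite -subr_eq0 -md_eq0 gt_eqF //; apply: lt_le_trans (h _ _ _ hk ij).
  by rewrite divr_gt0 // exprn_gt0 // ltr0n; apply: leq_trans ij.
have [d d0 hd] : loc (fun z => E (diag2 al *m z) = diag2 al *m E z).
  apply: locS (loc_lin (invmx P) KJ) => z hz; rewrite /E mulmxBr -e; congr (_ - _).
  have -> : invmx P *m (P *m J *m invmx P *m z) = J *m (invmx P *m z).
    by rewrite -!mulmxA mulKmx.
  by rewrite hz -[RHS]mulmxA mulKmx // mulmxA.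
have E0 := commuting_zero hE dE nonres d0 hd.
apply: locS (loc_lin P E0) => z /eqP; rewrite /E mulKmx // subr_eq0 => /eqP.
exact: (can_inj (mulKmx Pu)).
Qed.

(** With H the inverse of Phi, the germ Psi o H commutes with J. *)
Lemma linearizing_chart_unique F P J (al : 'I_2 -> C) Phi Psi : holo F -> P \in unitmx ->
  P *m J *m invmx P = diag2 al -> diophantine (al 0) (al 1) ->
  tangent_to_id Phi -> loc (fun z => Phi (F z) = J *m Phi z) ->
  tangent_to_id Psi -> loc (fun z => Psi (F z) = J *m Psi z) ->
  loc (fun z => Psi z = Phi z).
Proof.
move=> hF Pu e dio [hPhi dPhi] PhiF [hPsi dPsi] PsiF.
have [H [hH dH PhiH HPhi]] := two_sided hPhi dPhi.
have FH : loc (fun z => F (H z) = H (J *m z)).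
  have h := loc_holo hH (loc_holo hF HPhi).
  apply: locS (locI h (locI (loc_holo hH PhiF) PhiH)) => z [e1 [e2 e3]].
  by rewrite -[LHS]e1 e2 e3.
have K1 : loc (fun z => Psi (H z) = z).
  apply: (@commuting_with_diagonalizable _ P J al) => //.
    split; first exact: holo_comp.
    by rewrite -[1%:M]mulmx1; apply: frechet_comp => //; rewrite (holo0 hH).
  by apply: locS (locI FH (loc_holo hH PsiF)) => z [<-].
by apply: locS (locI HPhi (loc_holo hPhi K1)) => z [e1]; rewrite e1.
Qed.

Lemma normalized_linearizationP F Phi : holo F -> normalized_linearization F Phi <->
  tangent_to_id Phi /\ loc (fun z => Phi (F z) = jac F *m Phi z).
Proof.
move=> hF; split.
  move=> [[/holomorphic_germP hPhi _] [H [/holomorphic_germP hH /germ_eqP HPhi _] /germ_eqP lin] dPhi].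
  split; first by split=> //; rewrite -dPhi; apply: holo_jac.
  by apply: locS (locI HPhi (loc_holo hPhi lin)) => z /= [e1]; rewrite e1.
move=> [[hPhi dPhi] lin].
have [H [hH dH PhiH HPhi]] := two_sided hPhi dPhi.
have inv : inverse_germ Phi H.
  by split; [apply/holomorphic_germP|apply/germ_eqP|apply/germ_eqP].
split; last exact: frechet_jac.
  by split; [apply/holomorphic_germP|exists H].
exists H => //; apply/germ_eqP.
by apply: locS (locI PhiH (loc_holo hH lin)) => z /= [e1 ->]; rewrite e1.
Qed.

End Linearization.

(** * Averaging over the group *)

Section EquivariantLinearization.
Variable R : realType.
Local Notation C := R[i].
Local Notation K2 := 'cV[C]_2.
Local Notation M2 := 'M[C]_2.
Variable G : {fset M2}.
Hypothesis GSU : finite_subgroup_SU2 G.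

Lemma group_unitmx g : g \in G -> g \in unitmx.
Proof. by case: GSU => GS _ _ _ /GS[_ dg]; rewrite unitmxE dg unitr1. Qed.

Lemma sum_reindex (s : M2 -> M2) (f : M2 -> K2) : injective s ->
  (forall g, g \in G -> s g \in G) ->
  \sum_(g <- enum_fset G) f (s g) = \sum_(g <- enum_fset G) f g.
Proof.
move=> s_inj sG; rewrite -(big_map s xpredT f); apply: perm_big.
have us : uniq [seq s g | g <- enum_fset G] by rewrite map_inj_uniq ?fset_uniq.
have sub : {subset [seq s g | g <- enum_fset G] <= enum_fset G}.
  by move=> _ /mapP[g gG ->]; apply: sG.
apply: uniq_perm => //; first exact: fset_uniq.
by have [|_ e] := uniq_min_size us sub; first by rewrite size_map.
Qed.

Definition average (Phi : K2 -> K2) z :=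
  (#|` G|%:R^-1)%:M *m \sum_(g <- enum_fset G) invmx g *m Phi (g *m z).

Lemma card_group_neq0 : #|` G|%:R != 0 :> C.
Proof.
have [_ G1 _ _] := GSU; rewrite pnatr_eq0 cardfs_eq0.
by apply: contraTneq G1 => ->.
Qed.

Lemma average_tangent (Phi : K2 -> K2) : tangent_to_id Phi -> tangent_to_id (average Phi).
Proof.
move=> [hPhi dPhi]; split.
  apply: (holo_comp _ (holo_lin _)); apply: holo_sum => g.
  exact: holo_lin_comp.
have -> : 1%:M = (#|` G|%:R^-1)%:M *m \sum_(g <- enum_fset G) (invmx g *m (1%:M *m g)) :> M2.
  rewrite big_seq (eq_bigr (fun => 1%:M)); last first.
    by move=> g /group_unitmx gu; rewrite mul1mx mulVmx.
  rewrite -big_seq big_const_seq count_predT iter_addr_0.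
  rewrite mul_scalar_mx -[1%:M *+ _]scaler_nat scalerA mulVf ?scale1r //.
  exact: card_group_neq0.
apply: frechet_comp (frechet_lin _ _); apply: frechet_sum => g.
exact: frechet_lin_comp.
Qed.

Lemma average_commutes (Phi : K2 -> K2) g z : g \in G ->
  average Phi (g *m z) = g *m average Phi z.
Proof.
move=> gG; have [_ _ GM _] := GSU; have gu := group_unitmx gG.
rewrite /average [RHS]mulmxA [g *m _%:M]scalar_mxC -[RHS]mulmxA; congr (_ *m _); rewrite mulmx_sumr.
rewrite -[RHS](sum_reindex (s := fun h => h *m g)); first last.
- by move=> h hG; apply: GM.
- exact: (can_inj (mulmxK gu)).
apply: eq_big_seq => h hG; have hu := group_unitmx hG.
rewrite mulmxA; apply: (can_inj (mulKmx hu)); rewrite mulKVmx // mulmxA.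
by rewrite mulKVmx // unitmx_mul hu.
Qed.

(** Replacing g by J g J^-1 in the sum moves F from inside to outside. *)
Lemma average_linearizes F (Phi : K2 -> K2) J : J \in unitmx -> holo F ->
  (forall g, g \in G -> J *m g *m invmx J \in G) ->
  (forall g, g \in G -> loc (fun z => F (g *m z) = J *m g *m invmx J *m F z)) ->
  loc (fun z => Phi (F z) = J *m Phi z) ->
  loc (fun z => average Phi (F z) = J *m average Phi z).
Proof.
move=> Ju hF conjG conjF lin.
have E : loc (fun z => forall g, g \in enum_fset G ->
    Phi (J *m g *m invmx J *m F z) = J *m Phi (g *m z)).
  apply: loc_all => g gG.
  by apply: locS (locI (conjF g gG) (loc_lin g lin)) => z [<-].
apply: locS E => z hz; rewrite /average [RHS]mulmxA [J *m _%:M]scalar_mxC -[RHS]mulmxA; congr (_ *m _).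
rewrite -(sum_reindex (s := fun g => J *m g *m invmx J)) ?mulmx_sumr //; last first.
  by move=> g h /(can_inj (mulmxKV Ju)); exact: (can_inj (mulKmx Ju)).
apply: eq_big_seq => g gG; have gu := group_unitmx gG; rewrite hz // !mulmxA; congr (_ *m _).
have cu := group_unitmx (conjG g gG).
apply: (can_inj (mulKmx cu)); rewrite mulKVmx //.
by rewrite -!mulmxA (mulmxA (invmx J)) mulVmx // mul1mx mulmxV // mulmx1.
Qed.
End EquivariantLinearization.
Close Scope complex_scope.

(** * Equivariant linearization *)

Theorem theorem1p6 (R : realType) (G : {fset 'M[R[i]]_2})
    (F : 'cV[R[i]]_2 -> 'cV[R[i]]_2) :
  finite_subgroup_SU2 G ->
  G <> [fset 1%:M]%fset ->
  local_biholo F ->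
  equivariant G F ->
  let J := jac F in
  [/\ J \in unitmx,
      forall g, g \in G -> J *m g *m invmx J \in G,
      #|` G|%fset <> 2%N -> diagonalizable J
    & (#|` G|%fset = 2%N -> diagonalizable J) ->
      forall a1 a2 : R[i],
        char_poly J = ('X - a1%:P) * ('X - a2%:P) ->
        diophantine a1 a2 ->
        exists Phi : 'cV[R[i]]_2 -> 'cV[R[i]]_2,
          [/\ normalized_linearization F Phi,
              forall Psi, normalized_linearization F Psi -> germ_eq Psi Phi
            & forall g, g \in G -> germ_eq (Phi \o mulmx g) (mulmx g \o Phi)]].
Proof.
move=> GSU G1 [/holomorphic_germP hF _] [Finv [/holomorphic_germP hFinv /germ_eqP FK _] eqv] J.
have equivF g : g \in G -> loc (fun z => exists2 h, h \in G & F (g *m Finv z) = h *m z).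
  by move=> /eqv /near0P.
have Ju : J \in unitmx := jac_unitmx hF hFinv FK.
have conjG g (gG : g \in G) : J *m g *m invmx J \in G := conj_mem hF hFinv FK equivF gG.
have conjF g (gG : g \in G) := conj_equivariant GSU hF hFinv FK equivF gG.
have diagJ := jac_diagonalizable GSU hF hFinv FK equivF G1.
split=> // d2 a1 a2 cp dio.
have [P Pu sP] : diagonalizable J.
  by have [/d2|/eqP/diagJ] := eqVneq #|` G|%fset 2%N.
have [al e] := conjugated_to_diagonal Pu sP.
have {}dio : diophantine (al 0) (al 1).
  by have [[-> ->]|[-> ->]] := diagonal_eigenvalues Pu e cp; last exact: diophantine_sym.
have [Phi tPhi lin] := linearizing_chart hF Pu e dio.
exists Phi; split.
- exact/normalized_linearizationP.
- move=> Psi /(normalized_linearizationP _ hF)[tPsi linPsi]; apply/germ_eqP.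
  exact: linearizing_chart_unique hF Pu e dio tPhi lin tPsi linPsi.
have E := linearizing_chart_unique hF Pu e dio tPhi lin (average_tangent GSU tPhi)
  (average_linearizes GSU Ju hF conjG conjF lin).
move=> g gG; apply/germ_eqP; apply: locS (locI E (loc_lin g E)) => z /= [<- <-].
exact: average_commutes.
Qed.
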